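(* Let $p>1$, $0<s<1$, and let $\Omega\subset\mathbb{R}^n$ be a bounded open set with Wiener regular boundary for the $s$-fractional $p$-Laplacian. Let $\delta>0$, let $g\in C([0,\infty))$ with $g(0)=0$, and let $u\in L^{p-1}_{ps}(\mathbb{R}^n)\cap C(\overline{\Omega_\delta})$ be a non-negative viscosity supersolution of $(-\Delta_p)^su=g(u)$ in $\Omega$. Then either $u=0$ a.e. in $\mathbb{R}^n$, or $u>0$ in $\Omega$ and there is a constant $C>0$ such that $u\ge C\,u_{\mathrm{tor}}$ in $\Omega$, where $u_{\mathrm{tor}}$ is the torsion function of $\Omega$.
   Context: Notation. $\Omega_\delta:=\{x\in\mathbb{R}^n:\operatorname{dist}(x,\overline\Omega)<\delta\}$; $C(\overline{\Omega_\delta})$ means that the restriction to the closure of $\Omega_\delta$ is continuous. $L^{p-1}_{ps}(\mathbb{R}^n)$ is the set of measurable $u:\mathbb{R}^n\to\mathbb{R}$ with $\int_{\mathbb{R}^n}\frac{|u(x)|^{p-1}}{1+|x|^{n+ps}}dx<\infty$. The operator is, pointwise, $(-\Delta_p)^su(x)=2\lim_{\epsilon\to0}\int_{\mathbb{R}^n\setminus B(x,\epsilon)}\frac{|u(x)-u(y)|^{p-2}(u(x)-u(y))}{|x-y|^{n+ps}}dy$; singular integrals below are in this principal value sense. Viscosity solutions. For $D$ open and $\beta\ge1$, $C^2_\beta(D)$ is the set of $\phi\in C^2(D)$ with $\sup_{x\in D\setminus N_\phi}\Big(\frac{\min\{\operatorname{dist}(x,N_\phi)^{\beta-1},1\}}{|\nabla\phi(x)|}+\frac{|D^2\phi(x)|}{\operatorname{dist}(x,N_\phi)^{\beta-2}}\Big)<\infty$,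 where $N_\phi$ is the set of critical points of $\phi$. For $f\in C(\Omega)$, a function $u\in L^{p-1}_{ps}(\mathbb{R}^n)\cap C(\Omega)$ is a viscosity subsolution (resp. supersolution) of $(-\Delta_p)^su=f$ in $\Omega$ if for every $x_0\in\Omega$, every $r>0$ with $\overline{B(x_0,r)}\subset\Omega$ and every $\phi\in C^2(B(x_0,r))$ touching $u$ from above (resp. below) at $x_0$, i.e. $\phi(x_0)=u(x_0)$ and $\phi>u$ (resp. $\phi<u$) in $\overline{B(x_0,r)}\setminus\{x_0\}$, and satisfying at least one of (a) $\nabla\phi(x_0)\ne0$ or $p>\frac{2}{2-s}$; (b) $1<p\le\frac2{2-s}$, $\nabla\phi(x_0)=0$, $x_0$ is an isolated critical point of $\phi$, and $\phi\in C^2_\beta(B(x_0,r))$ for some $\beta>\frac{ps}{p-1}$; one has $2\int_{\mathbb{R}^n}\frac{|w(x_0)-w(y)|^{p-2}(w(x_0)-w(y))}{|x_0-y|^{n+ps}}dy\le f(x_0)$ (resp. $\ge f(x_0)$), where $w=\phi$ in $B(x_0,r)$ and $w=u$ in $\mathbb{R}^n\setminus B(x_0,r)$. A viscosity solution is both. For the equation $(-\Delta_p)^su=g(u)$ one takes $f(x)=g(u(x))$. Weak solutions. $V^{s,p}(\Omega|\mathbb{R}^n)$ is the set of $u:\mathbb{R}^n\to\mathbb{R}$ with $u|_\Omega\in L^p(\Omega)$ and $\frac{u(x)-u(y)}{|x-y|^{n/p+s}}\in L^p(\Omega\times\mathbb{R}^n)$; $V^{s,p}_0(\Omega|\mathbb{R}^n)$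 is the completion of $C_0^\infty(\Omega)$ in it with respect to $[u]_{V^{s,p}(\mathbb{R}^n)}=\big(\iint_{\mathbb{R}^n\times\mathbb{R}^n}\frac{|u(x)-u(y)|^p}{|x-y|^{n+ps}}dxdy\big)^{1/p}$; for $h\in V^{s,p}(\Omega|\mathbb{R}^n)$, $V^{s,p}_h(\Omega|\mathbb{R}^n)=\{u\in V^{s,p}(\Omega|\mathbb{R}^n):u-h\in V^{s,p}_0(\Omega|\mathbb{R}^n)\}$. A function $u\in V^{s,p}_h(\Omega|\mathbb{R}^n)$ is a weak solution of $(-\Delta_p)^su=f$ in $\Omega$ if $\iint_{\mathbb{R}^n\times\mathbb{R}^n}\frac{|u(x)-u(y)|^{p-2}(u(x)-u(y))(\phi(x)-\phi(y))}{|x-y|^{n+ps}}dxdy=\int_\Omega f\phi\,dx$ for all $\phi\in C_0^\infty(\Omega)$. Regular boundary. $\xi_0\in\partial\Omega$ is regular for the $s$-fractional $p$-Laplacian if for all $f\in L^\infty(\Omega)$, $h\in C(\mathbb{R}^n)\cap V^{s,p}(\Omega|\mathbb{R}^n)$ and every weak solution $u\in V^{s,p}_h(\Omega|\mathbb{R}^n)$ of $(-\Delta_p)^su=f$ in $\Omega$, one has $\lim_{\xi\to\xi_0}u(\xi)=h(\xi_0)$. $\Omega$ has Wiener regular boundary if all points of $\partial\Omega$ are regular. Torsion function. $u_{\mathrm{tor}}\in L^{p-1}_{ps}(\mathbb{R}^n)\cap C(\mathbb{R}^n)$ satisfies $u_{\mathrm{tor}}=0$ in $\mathbb{R}^n\setminus\Omega$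 and $(-\Delta_p)^su_{\mathrm{tor}}=1$ in $\Omega$ in the viscosity sense; it is given by the weak solution in $V^{s,p}_0(\Omega|\mathbb{R}^n)$ of $(-\Delta_p)^su_{\mathrm{tor}}=1$ in $\Omega$. *)

(* Defs.v *)
(* R^n is 'rV[R]_n for an arbitrary R : realType. *)
From HB Require Import structures.
From mathcomp Require Import all_boot all_order all_algebra.
From mathcomp Require Import all_classical all_reals all_analysis.

Set Implicit Arguments.
Unset Strict Implicit.
Unset Printing Implicit Defensive.

Import Order.TTheory GRing.Theory Num.Theory.
Import numFieldNormedType.Exports.

Local Open Scope classical_set_scope.
Local Open Scope ring_scope.

Section cons_measure.
Context {R : realType} (n : nat).
Local Notation RB := (measurableTypeR R).
Variable mu : {sigma_finite_measure set (n.-tuple RB) -> \bar R}.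

Definition cons_tuple (z : RB * n.-tuple RB) : n.+1.-tuple RB :=
  [tuple of z.1 :: z.2].

Lemma measurable_cons_tuple : measurable_fun setT cons_tuple.
Proof. exact: measurable_cons. Qed.

Definition uncons_tuple (t : n.+1.-tuple RB) : RB * n.-tuple RB :=
  (thead t, [tuple of behead t]).

Lemma measurable_uncons_tuple : measurable_fun setT uncons_tuple.
Proof.
apply: measurable_fun_pair; last exact: measurable_behead.
exact: measurable_tnth.
Qed.

Lemma cons_tupleK : cancel cons_tuple uncons_tuple.
Proof.
case=> x t; rewrite /uncons_tuple /cons_tuple /= theadE.
by congr pair; apply: val_inj.
Qed.

Lemma uncons_tupleK : cancel uncons_tuple cons_tuple.
Proof. by move=> t; rewrite /cons_tuple /= -tuple_eta. Qed.

Definition cons_measure : set (n.+1.-tuple RB) -> \bar R :=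
  pushforward (@lebesgue_measure R \x mu)%E cons_tuple.

Let cons_measure0 : cons_measure set0 = 0%E.
Proof. by rewrite /cons_measure /pushforward preimage_set0 measure0. Qed.

Let cons_measure_ge0 A : (0 <= cons_measure A)%E.
Proof. exact: (measure_ge0 (@lebesgue_measure R \x mu)%E). Qed.

Let cons_measure_sigma_additive : semi_sigma_additive cons_measure.
Proof.
move=> F mF tF mUF; rewrite /cons_measure /pushforward preimage_bigcup.
have mpre A : measurable A -> measurable (cons_tuple @^-1` A).
  by move=> mA; rewrite -[X in measurable X]setTI; exact: measurable_cons_tuple.
apply: measure_semi_sigma_additive => [k||]; first exact: mpre.
- apply/trivIsetP => i j _ _ ij; rewrite -preimage_setI.
  by move/trivIsetP : tF => /(_ _ _ _ _ ij) ->//; rewrite preimage_set0.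
- by rewrite -preimage_bigcup; exact: mpre.
Qed.

HB.instance Definition _ := isMeasure.Build _ _ _ cons_measure
  cons_measure0 cons_measure_ge0 cons_measure_sigma_additive.

Let cons_measure_sigma_finite : sigma_finite setT cons_measure.
Proof.
have /sigma_finiteP[F [TF ndF Foo]] := sigma_finiteT (@lebesgue_measure R).
have /sigma_finiteP[G [TG ndG Goo]] := sigma_finiteT mu.
exists (fun k => uncons_tuple @^-1` (F k `*` G k)).
  rewrite -preimage_bigcup (_ : \bigcup_k _ = setT) ?preimage_setT//.
  rewrite -subTset => -[x y] _.
  have [n1 _ Fx] : (\bigcup_k F k) x by rewrite -TF.
  have [n2 _ Gy] : (\bigcup_k G k) y by rewrite -TG.
  exists (maxn n1 n2) => //; split => /=.
  - by move: x Fx; exact/subsetPset/ndF/leq_maxl.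
  - by move: y Gy; exact/subsetPset/ndG/leq_maxr.
move=> k; have [? ?] := Foo k; have [? ?] := Goo k; split.
  by rewrite -[X in measurable X]setTI; apply: measurable_uncons_tuple => //;
    exact: measurableX.
rewrite /cons_measure /pushforward -comp_preimage.
rewrite (_ : uncons_tuple \o cons_tuple = id) ?preimage_id//; last first.
  by apply/funext => z; exact: cons_tupleK.
by rewrite product_measure1E// lte_mul_pinfty// ge0_fin_numE.
Qed.

HB.instance Definition _ := Measure_isSigmaFinite.Build _ _ _ cons_measure
  cons_measure_sigma_finite.

End cons_measure.

(* Product of n copies of the Borel-Lebesgue measure on the line. *)
Fixpoint lebesgue_tuple {R : realType} (n : nat) :
    {sigma_finite_measure set (n.-tuple (measurableTypeR R)) -> \bar R} :=
  match n with
  | 0 => \d_([tuple] : 0.-tuple (measurableTypeR R))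
  | m.+1 => cons_measure (lebesgue_tuple m)
  end.

Section lebesgue_rV.
Context {R : realType} (n : nat).

Definition row_of_tuple (t : n.-tuple (measurableTypeR R)) : 'rV[R]_n :=
  \row_i tnth t i.

Definition lebesgue_outer (A : set 'rV[R]_n) : \bar R :=
  ((lebesgue_tuple n)^*)%mu (row_of_tuple @^-1` A).

Let lebesgue_outer0 : lebesgue_outer set0 = 0%E.
Proof. by rewrite /lebesgue_outer preimage_set0 outer_measure0. Qed.

Let lebesgue_outer_ge0 A : (0 <= lebesgue_outer A)%E.
Proof. exact: outer_measure_ge0. Qed.

Let le_lebesgue_outer :
  {homo lebesgue_outer : A B / A `<=` B >-> (A <= B)%E}.
Proof. by move=> A B AB; apply: le_outer_measure => x; exact: AB. Qed.

Let lebesgue_outer_sigma_subadditive : sigma_subadditive lebesgue_outer.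
Proof.
move=> F; rewrite /lebesgue_outer preimage_bigcup.
exact: outer_measure_sigma_subadditive.
Qed.

HB.instance Definition _ := isOuterMeasure.Build R 'rV[R]_n lebesgue_outer
  lebesgue_outer0 lebesgue_outer_ge0 le_lebesgue_outer
  lebesgue_outer_sigma_subadditive.

(* 'rV[R]_n with the (complete) sigma-algebra of Lebesgue measurable sets. *)
Definition lebesgueType := caratheodory_type lebesgue_outer.

HB.instance Definition _ := Measurable.on lebesgueType.

Definition lebesgue_rV : set lebesgueType -> \bar R := lebesgue_outer.

HB.instance Definition _ := isMeasure.Build _ lebesgueType R lebesgue_rV
  (@caratheodory_measure0 R 'rV[R]_n lebesgue_outer)
  (@caratheodory_measure_ge0 R 'rV[R]_n lebesgue_outer)
  (@caratheodory_measure_sigma_additive R 'rV[R]_n lebesgue_outer).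

Let lebesgue_rV_sigma_finite : sigma_finite setT lebesgue_rV.
Proof.
have [F FT mF] := sigma_finiteT (@lebesgue_tuple R n).
pose tuple_of_row (v : 'rV[R]_n) : n.-tuple (measurableTypeR R) :=
  [tuple v 0 i | i < n].
have tK : tuple_of_row \o row_of_tuple = id.
  by apply/funext => t; apply: eq_from_tnth => i /=; rewrite tnth_mktuple mxE.
exists (fun k => tuple_of_row @^-1` F k).
  by rewrite -preimage_bigcup -FT preimage_setT.
move=> k; have [mFk Fk] := mF k; split; last first.
  rewrite /lebesgue_rV /lebesgue_outer -comp_preimage tK preimage_id.
  by rewrite measurable_mu_extE.
have FE : F k = row_of_tuple @^-1` (tuple_of_row @^-1` F k).
  by rewrite -comp_preimage tK preimage_id.
have := caratheodory_measurable_mu_ext (lebesgue_tuple n) mFk.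
rewrite [X in measurable X -> _]FE => Fcara.
suff : caratheodory_measurable lebesgue_outer (tuple_of_row @^-1` F k) by [].
by move=> X; exact: (Fcara (row_of_tuple @^-1` X)).
Qed.

HB.instance Definition _ := Measure_isSigmaFinite.Build _ _ _ lebesgue_rV
  lebesgue_rV_sigma_finite.

End lebesgue_rV.
Arguments lebesgue_rV {R} n _.
Arguments lebesgueType : clear implicits.

Section euclidean.
Context {R : realType} {n : nat}.
Implicit Types (x y : 'rV[R]_n) (A D : set 'rV[R]_n) (f : 'rV[R]_n -> R).

(* The library norm on 'rV[R]_n is the sup norm (same topology). *)
Definition enorm x : R := Num.sqrt (\sum_i x 0 i ^+ 2).

Definition eball x (r : R) : set 'rV[R]_n := [set y | enorm (y - x) < r].

(* Equal to +oo when A is empty. *)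
Definition dist_set x A : \bar R :=
  ereal_inf [set (enorm (x - a))%:E | a in A].

Definition thickening A (delta : R) : set 'rV[R]_n :=
  [set x | (dist_set x (closure A) < delta%:E)%E].

Definition partial (i : 'I_n) f x : R := 'D_(delta_mx 0 i) f x.

Definition grad f x : 'rV[R]_n := \row_i partial i f x.

Definition hessian_norm f x : R :=
  Num.sqrt (\sum_i \sum_j partial i (partial j f) x ^+ 2).

(* f is of class C^k on the open set D. *)
Fixpoint Ck (k : nat) D f : Prop :=
  (forall x, D x -> {for x, continuous f}) /\
  match k with
  | 0 => True
  | k'.+1 => forall i, (forall x, D x -> derivable f x (delta_mx 0 i)) /\
                       Ck k' D (partial i f)
  end.

Definition Cc_infty D f : Prop :=
  [/\ forall k, Ck k setT f,
      compact (closure [set x | f x != 0]) &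
      closure [set x | f x != 0] `<=` D].

Definition critical_set D f : set 'rV[R]_n := [set x | D x /\ grad f x = 0].

(* Only used when the critical set is nonempty, so that the distance to it is
   finite. *)
Definition C2beta (beta : R) D f : Prop :=
  let N := critical_set D f in
  let d x := fine (dist_set x N) in
  Ck 2 D f /\
  has_ubound [set Num.min (d x `^ (beta - 1)) 1 / enorm (grad f x)
                  + hessian_norm f x / d x `^ (beta - 2) | x in D `\` N].

End euclidean.

Section fractional_p_laplacian.
Context {R : realType} {n : nat}.
Variables (p s : R).
Implicit Types (u h f w phi : 'rV[R]_n -> R) (Omega : set 'rV[R]_n).
Local Notation mu := (@lebesgue_rV R n).
Local Notation LT := (lebesgueType R n).

Definition signed_pow (t : R) : R := `|t| `^ (p - 2) * t.

Definition tail_space u : Prop :=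
  measurable_fun [set: LT] (u : LT -> R) /\
  (\int[mu]_x (`|u x| `^ (p - 1) / (1 + enorm x `^ (n%:R + p * s)))%:E
     < +oo)%E.

(* Principal value. For the functions w tested below the limit exists in
   \bar R; it may be infinite since phi need not be bounded near the boundary
   of its ball. *)
Definition frac_plap w (x : 'rV[R]_n) : \bar R :=
  (2%:E * lim ((\int[mu]_(y in ~` eball x eps)
     (signed_pow (w x - w y) / enorm (x - y) `^ (n%:R + p * s))%:E)
     @[eps --> 0^'+]))%E.

Definition admissible_test (x0 : 'rV[R]_n) (r : R) phi : Prop :=
  (grad phi x0 != 0 \/ 2 / (2 - s) < p) \/
  [/\ 1 < p <= 2 / (2 - s),
      grad phi x0 = 0,
      isolated (critical_set (eball x0 r) phi) x0 &
      exists beta, [/\ 1 <= beta, p * s / (p - 1) < beta &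
                       C2beta beta (eball x0 r) phi]].

Definition viscosity_subsolution Omega f u : Prop :=
  [/\ tail_space u,
      {within Omega, continuous u},
      {within Omega, continuous f} &
      forall (x0 : 'rV[R]_n) (r : R) phi,
        Omega x0 -> 0 < r -> closure (eball x0 r) `<=` Omega ->
        Ck 2 (eball x0 r) phi ->
        phi x0 = u x0 ->
        (forall x, closure (eball x0 r) x -> x != x0 -> u x < phi x) ->
        admissible_test x0 r phi ->
        (frac_plap (patch u (eball x0 r) phi) x0 <= (f x0)%:E)%E].

Definition viscosity_supersolution Omega f u : Prop :=
  [/\ tail_space u,
      {within Omega, continuous u},
      {within Omega, continuous f} &
      forall (x0 : 'rV[R]_n) (r : R) phi,
        Omega x0 -> 0 < r -> closure (eball x0 r) `<=` Omega ->
        Ck 2 (eball x0 r) phi ->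
        phi x0 = u x0 ->
        (forall x, closure (eball x0 r) x -> x != x0 -> phi x < u x) ->
        admissible_test x0 r phi ->
        ((f x0)%:E <= frac_plap (patch u (eball x0 r) phi) x0)%E].

Definition viscosity_solution Omega f u : Prop :=
  viscosity_subsolution Omega f u /\ viscosity_supersolution Omega f u.

Definition mem_Lp d (T : measurableType d) (nu : set T -> \bar R) (D : set T)
    (v : T -> R) : Prop :=
  measurable_fun D v /\ (\int[nu]_(x in D) (`|v x| `^ p)%:E < +oo)%E.

Definition Vsp Omega u : Prop :=
  mem_Lp mu (Omega : set LT) u /\
  mem_Lp (mu \x mu)%E ((Omega : set LT) `*` [set: LT])
    (fun z => (u z.1 - u z.2) / enorm (z.1 - z.2) `^ (n%:R / p + s)).

Definition gagliardo u : \bar R :=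
  ((\int[(mu \x mu)%E]_z
      (`|u z.1 - u z.2| `^ p / enorm (z.1 - z.2) `^ (n%:R + p * s))%:E)
   `^ p^-1)%E.

(* gagliardo does not see additive constants; a limit in the completion of
   Cc_infty Omega is the one that vanishes outside Omega. *)
Definition Vsp0 Omega u : Prop :=
  [/\ Vsp Omega u,
      {ae mu, forall x, ~ Omega x -> u x = 0} &
      exists phi : nat -> 'rV[R]_n -> R,
        (forall k, Cc_infty Omega (phi k)) /\
        (gagliardo (u \- phi k) @[k --> \oo] --> 0%E)].

Definition Vsp_bdry Omega h u : Prop := Vsp Omega u /\ Vsp0 Omega (u \- h).

Definition weak_solution Omega h f u : Prop :=
  Vsp_bdry Omega h u /\
  forall phi, Cc_infty Omega phi ->
    (\int[(mu \x mu)%E]_z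
       (signed_pow (u z.1 - u z.2) * (phi z.1 - phi z.2)
        / enorm (z.1 - z.2) `^ (n%:R + p * s))%:E
     = \int[mu]_(x in Omega) (f x * phi x)%:E)%E.

Definition mem_Linfty Omega f : Prop :=
  measurable_fun (Omega : set LT) (f : LT -> R) /\
  exists M : R, {ae mu, forall x, Omega x -> `|f x| <= M}.

(* Weak solutions are only defined up to null sets, hence the essential
   limit. *)
Definition ess_lim u (xi : 'rV[R]_n) (l : R) : Prop :=
  forall e : R, 0 < e -> exists2 rho : R, 0 < rho &
    {ae mu, forall x, eball xi rho x -> `|u x - l| < e}.

Definition regular_point Omega (xi : 'rV[R]_n) : Prop :=
  forall f h u, mem_Linfty Omega f -> continuous h -> Vsp Omega h ->
    weak_solution Omega h f u -> ess_lim u xi (h xi).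

Definition Wiener_regular Omega : Prop :=
  forall xi, (closure Omega `\` interior Omega) xi -> regular_point Omega xi.

Definition torsion_function Omega u : Prop :=
  [/\ tail_space u,
      continuous u,
      forall x, ~ Omega x -> u x = 0,
      viscosity_solution Omega (cst 1) u &
      weak_solution Omega (cst 0) (cst 1) u].

End fractional_p_laplacian.

(* Main.v *)
Require Import Defs.
From HB Require Import structures.
From mathcomp Require Import all_boot all_order all_algebra.
From mathcomp Require Import all_classical all_reals all_analysis.
From mathcomp Require Import measurable_realfun ring lra.

Import Order.TTheory GRing.Theory Num.Theory.
Import numFieldNormedType.Exports.

Local Open Scope classical_set_scope.
Local Open Scope ring_scope.

(** Both alternatives come from testing the equation with u shifted by small
    polynomials [b.z + a |z|^(2k)], for which the principal value near the
    contact point is small by odd cancellation, so that only the integral of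
    the increments of u over the complement of a ball is left.

    If [u x = 0] at a point x of Omega, the tests [- a |z|^(2k)] with a -> 0
    show that the nonpositive tail integral of [signed_pow (- u)] is at least
    [g 0 = 0], hence u = 0 almost everywhere.  Otherwise u > c on some bounded
    set K of positive measure.  If [C u_tor > u] somewhere, the maximum of
    [C u_tor x - u y - H |x - y|^(2k)] is attained in Omega x Omega for H
    large, and translating both points by the same vector leaves the penalty
    unchanged, so the increments of [C u_tor] and u at the maximum are ordered.
    For z with y + z in K they differ by a fixed amount, since [C u_tor <= c/4];
    this contributes a gain independent of C, whereas the difference of the two
    equations is at most [C^(p - 1) - g (u y)], with [0 <= u y <= C sup u_tor],
    which is small when C is. *)

(** * Translations and reflections preserve Lebesgue measure *)

(** The operator cannot be evaluated on [u] itself, only on functions touching it, so the equations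
    of u and C u_tor cannot simply be subtracted at one common point; this is what forces two points
    and a penalty. For p <= 2/(2 - s) a test with vanishing gradient must be as flat as C^2_beta
    with beta > ps/(p - 1), hence the power 2k with k large. At a maximum with x = y the penalty
    gives an admissible radial test; at x <> y its gradient does not vanish, and its increment is
    dominated by a linear term plus a quadratic one. H is never sent to infinity. The gain over K
    depends neither on C nor on H nor on the maximum point, so one finite H leads to a
    contradiction. H only has to keep the maximum point close to the diagonal, where uniform
    continuity of C u_tor, which vanishes outside Omega, keeps it in Omega x Omega. *)

Section lebesgue_reflection_translation.
Context {R : realType}.
Local Notation RB := (measurableTypeR R).

Lemma measurable_affine1 (a e : R) :
  measurable_fun [set: RB] (fun x : RB => (a + e * x : RB)).
Proof. by apply: measurable_funD => //; apply: measurable_funM. Qed.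

Lemma lebesgue_measure_shift (a : R) (A : set RB) : measurable A ->
  lebesgue_measure ((fun x : RB => a + x) @^-1` A) = lebesgue_measure A.
Proof.
have mT : measurable_fun [set: RB] (fun x : RB => a + x : RB).
  by apply: measurable_funD.
move=> mA.
pose mT_mixin := isMeasurableFun.Build _ _ _ _ _ mT.
pose T : {mfun RB >-> RB} := HB.pack (fun x : RB => a + x : RB) mT_mixin.
apply/esym/(@lebesgue_measure_unique R (pushforward lebesgue_measure T)) => //.
move=> _ [[x y]] _ <-; rewrite /pushforward.
transitivity (lebesgue_measure (`](x - a), (y - a)]%classic : set RB)).
  rewrite !lebesgue_measure_itv/= !lte_fin ltrD2r.
  by case: ifP => // _; rewrite !EFinB /=; congr (_%:E); ring.
congr lebesgue_measure; apply/seteqP; split => z /=;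
  by rewrite !in_itv/= ltrBlDl lerBrDl.
Qed.

Lemma lebesgue_measure_affine (a e : R) (A : set RB) :
  e = 1 \/ e = -1 -> measurable A ->
  lebesgue_measure ((fun x : RB => a + e * x) @^-1` A) = lebesgue_measure A.
Proof.
move=> he mA; case: he => ->.
  by rewrite -[RHS](lebesgue_measure_shift a) //; congr lebesgue_measure;
    apply/seteqP; split => z/=; rewrite mul1r.
rewrite -[RHS](lebesgue_measure_shift a) // -[RHS]lebesgue_measureN; last first.
  rewrite -[X in measurable X]setTI.
  by apply: (measurable_funD (measurable_cst a) (@measurable_id _ _ setT)).
by congr lebesgue_measure; apply/seteqP; split => z/=; rewrite mulN1r.
Qed.

Definition affine_tuple n (a : 'I_n -> R) (e : R) (t : n.-tuple RB) :
  n.-tuple RB := [tuple a i + e * tnth t i | i < n].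

Lemma measurable_affine_tuple n (a : 'I_n -> R) e :
  measurable_fun setT (affine_tuple n a e).
Proof.
apply/measurable_fun_tnthP => i.
rewrite (_ : _ \o _ = (fun t : n.-tuple RB => a i + e * tnth t i)).
  apply: (measurableT_comp (measurable_affine1 (a i) e)).
  exact: measurable_tnth.
by apply/funext => t /=; rewrite tnth_mktuple.
Qed.

(** Induction on the dimension: the map acts separately on head and tail, so the induction
    hypothesis removes it from each section, and the one-dimensional invariance removes it from the
    integral of the section measures. *)
Lemma lebesgue_tuple_affine n (a : 'I_n -> R) e (A : set (n.-tuple RB)) :
  e = 1 \/ e = -1 -> measurable A ->
  lebesgue_tuple n (affine_tuple n a e @^-1` A) = lebesgue_tuple n A.
Proof.
move=> he; elim: n a A => [|n ih] a A mA.
  suff -> : affine_tuple 0 a e = id by [].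
  by apply/funext => t; rewrite [LHS]tuple0 [RHS]tuple0.
rewrite /= /cons_measure /pushforward.
pose B : set (RB * n.-tuple RB) := @Defs.cons_tuple R n @^-1` A.
have mB : measurable B.
  by rewrite -[B]setTI; exact: Defs.measurable_cons_tuple.
pose b (i : 'I_n) := a (lift ord0 i).
have affine_consE x t : affine_tuple n.+1 a e (@Defs.cons_tuple R n (x, t)) =
    @Defs.cons_tuple R n (a ord0 + e * x, affine_tuple n b e t).
  apply: (@eq_from_tnth n.+1) => i; rewrite tnth_mktuple.
  case: (unliftP ord0 i) => [j|] ->; last by rewrite !(tnth_nth 0).
  rewrite !(tnth_nth 0) /= (nth_map j) ?size_enum_ord ?ltn_ord// nth_ord_enum.
  by rewrite (tnth_nth 0).
transitivity ((lebesgue_measure \x lebesgue_tuple n)%E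
    ((fun z : RB * n.-tuple RB => (a ord0 + e * z.1, affine_tuple n b e z.2))
      @^-1` B)).
  congr (_ _); apply/seteqP; split => -[x t]; rewrite /B /=;
    by rewrite affine_consE.
rewrite /product_measure1; pose T1 (x : RB) : RB := a ord0 + e * x.
transitivity (\int[lebesgue_measure]_x
   ((lebesgue_tuple n \o xsection B) \o T1) x)%E.
  apply: eq_integral => x _ /=.
  rewrite -[RHS](ih b); last by apply: (@measurable_xsection _ _ RB).
  by congr (_ _); apply/seteqP; split => t /=; rewrite /xsection/= !inE.
rewrite -[in LHS](preimage_setT T1).
rewrite -(@ge0_integral_pushforward _ _ _ _ R _
   (measurable_affine1 (a ord0) e)) //; last first.
  exact: measurable_fun_xsection.
apply: eq_measure_integral => [|mT1 C mC _]; first exact: measurable_affine1.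
exact: lebesgue_measure_affine.
Qed.

End lebesgue_reflection_translation.

Section lebesgue_rV_invariance.
Context {R : realType} {n : nat}.
Local Notation RB := (measurableTypeR R).
Local Notation mu := (@lebesgue_rV R n).
Local Notation LT := (lebesgueType R n).
Implicit Types (a : 'rV[R]_n) (e : R).

(** Pulling back a measurable cover of [A] gives a cover of the preimage with the same total
    measure. The reverse inequality follows later from the inverse map, which has the same form
    because e^2 = 1. *)
Lemma lebesgue_outer_affine_le a e (A : set 'rV[R]_n) : e = 1 \/ e = -1 ->
  (lebesgue_outer ((fun z : 'rV[R]_n => (a + e *: z)%R) @^-1` A)
    <= lebesgue_outer A)%E.
Proof.
move=> he; rewrite /lebesgue_outer.
apply: le_ereal_inf_tmp => _ [F [mF cF] <-].
pose G k := affine_tuple n (fun i => a 0 i) e @^-1` F k.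
have mG k : measurable (G k).
  by rewrite -[G k]setTI; apply: measurable_affine_tuple => //; exact: mF.
apply: ereal_inf_lbound; exists G; last first.
  by apply: eq_eseriesr => k _; rewrite /G lebesgue_tuple_affine.
split => // t /= At.
have /cF [k _ Fk] : (@row_of_tuple R n @^-1` A) (affine_tuple n (fun i => a 0 i) e t).
  rewrite /= (_ : row_of_tuple _ = a + e *: row_of_tuple t) //.
  by apply/rowP => i; rewrite !mxE tnth_mktuple.
by exists k.
Qed.

Lemma affine_preimageK a e (A : set 'rV[R]_n) : e = 1 \/ e = -1 ->
  (fun z : 'rV[R]_n => - e *: a + e *: z) @^-1`
    ((fun z => a + e *: z) @^-1` A) = A.
Proof.
move=> he; apply/seteqP; split => z /=;
  rewrite (_ : a + _ = z) //; apply/rowP => i; rewrite !mxE;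
  by case: he => ->; ring.
Qed.

Lemma lebesgue_outer_affine a e (A : set 'rV[R]_n) : e = 1 \/ e = -1 ->
  lebesgue_outer ((fun z : 'rV[R]_n => a + e *: z) @^-1` A) = lebesgue_outer A.
Proof.
move=> he; apply/eqP; rewrite eq_le lebesgue_outer_affine_le//=.
rewrite -[X in (lebesgue_outer X <= _)%E](affine_preimageK a e A he).
exact: lebesgue_outer_affine_le.
Qed.

Lemma measurable_affine a e : e = 1 \/ e = -1 ->
  measurable_fun [set: LT] ((fun z : 'rV[R]_n => a + e *: z) : LT -> LT).
Proof.
move=> he _ A mA; rewrite setTI.
move=> X /=.
(* Measurability is the Caratheodory condition against an arbitrary set [X]. Writing [X] as the
   preimage of [Y] turns it into the condition for [A] against [Y], since the outer measure is
   invariant. *)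
rewrite -(affine_preimageK (- e *: a) e X he).
set Y := _ @^-1` X.
have -> : - e *: (- e *: a) = a.
  by rewrite scalerA mulrNN; case: he => ->; rewrite ?mulrNN mulr1 scale1r.
have : lebesgue_outer Y =
  (lebesgue_outer (Y `&` A) + lebesgue_outer (Y `&` ~` A))%E by exact: mA.
by rewrite -(lebesgue_outer_affine a e Y he) -(lebesgue_outer_affine a e (Y `&` A) he)
  -(lebesgue_outer_affine a e (Y `&` ~` A) he).
Qed.

Lemma measurable_fun_affine d (T' : measurableType d) (f : LT -> T') a e :
  e = 1 \/ e = -1 -> measurable_fun [set: LT] f ->
  measurable_fun [set: LT] ((fun z : 'rV[R]_n => f (a + e *: z)) : LT -> T').
Proof. by move=> he mf; exact: (measurableT_comp mf (measurable_affine a e he)). Qed.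

Lemma measurable_fun_shift d (T' : measurableType d) (f : LT -> T') a :
  measurable_fun [set: LT] f ->
  measurable_fun [set: LT] ((fun z : 'rV[R]_n => f (a + z)) : LT -> T').
Proof.
move=> mf; rewrite (_ : (fun z => _) = fun z : 'rV[R]_n => f (a + 1 *: z)).
  exact: (measurable_fun_affine _ _ f a 1 (or_introl erefl) mf).
by apply/funext => z; rewrite scale1r.
Qed.

(** [lebesgue_outer] is the extension of [lebesgue_tuple] read through [row_of_tuple], so
    Caratheodory measurability of a Borel set of tuples carries over to rows. *)
Lemma measurable_coord (i : 'I_n) :
  measurable_fun [set: LT] ((fun z : 'rV[R]_n => z 0 i) : LT -> R).
Proof.
move=> _ B mB; rewrite setTI.
have mT : measurable ((fun t : n.-tuple RB => tnth t i) @^-1` B).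
  by rewrite -[X in measurable X]setTI; exact: measurable_tnth.
have := caratheodory_measurable_mu_ext (lebesgue_tuple n) mT.
have -> : (fun t : n.-tuple RB => tnth t i) @^-1` B =
    @row_of_tuple R n @^-1` ((fun z : 'rV[R]_n => z 0 i) @^-1` B).
  by apply/seteqP; split => t /=; rewrite mxE.
move=> Bcara.
suff : caratheodory_measurable (@lebesgue_outer R n)
    ((fun z : 'rV[R]_n => z 0 i) @^-1` B) by [].
by move=> X; exact: (Bcara (@row_of_tuple R n @^-1` X)).
Qed.

Lemma ge0_integral_affine a e (D : set LT) (f : LT -> \bar R) :
  e = 1 \/ e = -1 -> measurable D -> measurable_fun D f ->
  (forall x, D x -> (0 <= f x)%E) ->
  (\int[mu]_(x in D) f x =
   \int[mu]_(z in ((fun z : 'rV[R]_n => (a + e *: z)%R) @^-1` D))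
     f (a + e *: (z : 'rV[R]_n))%R)%E.
Proof.
move=> he mD mf f0.
pose T (z : LT) : LT := (a + e *: (z : 'rV[R]_n))%R.
pose mT := isMeasurableFun.Build _ _ _ _ T (measurable_affine a e he).
pose Tm : {mfun LT >-> LT} := HB.pack T mT.
transitivity (\int[pushforward mu Tm]_(x in D) f x)%E.
  apply: (@eq_measure_integral _ LT R D (pushforward mu Tm) mu f) => C mC _.
  by apply/esym; exact: lebesgue_outer_affine.
apply: (@ge0_integral_pushforward _ _ LT LT R _ (measurable_affine a e he)) => //.
by move=> x; rewrite inE => /f0.
Qed.

Lemma integral_affine a e (D : set LT) (f : LT -> \bar R) :
  e = 1 \/ e = -1 -> measurable D -> measurable_fun D f ->
  (\int[mu]_(x in D) f x =
   \int[mu]_(z in ((fun z : 'rV[R]_n => (a + e *: z)%R) @^-1` D))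
     f (a + e *: (z : 'rV[R]_n))%R)%E.
Proof.
move=> he mD mf.
have Hp := ge0_integral_affine a e D (f^\+)%E he mD (measurable_funepos mf)
  (fun x _ => funepos_ge0 f x).
have Hn := ge0_integral_affine a e D (f^\-)%E he mD (measurable_funeneg mf)
  (fun x _ => funeneg_ge0 f x).
rewrite [LHS]integralE Hp Hn [RHS]integralE; congr (_ - _)%E.
  apply: eq_integral => z _. by rewrite !funeposE.
apply: eq_integral => z _. by rewrite !funenegE.
Qed.

Lemma lebesgue_rV_affine a e (A : set LT) : e = 1 \/ e = -1 ->
  mu ((fun z : 'rV[R]_n => a + e *: z) @^-1` A) = mu A.
Proof. exact: lebesgue_outer_affine. Qed.

End lebesgue_rV_invariance.

(** * Euclidean norm and balls *)

Section euclidean_space.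
Context {R : realType} {n : nat}.
Implicit Types (x y z b : 'rV[R]_n) (a r : R).

Definition dot x y : R := \sum_i x 0 i * y 0 i.

Lemma dotC x y : dot x y = dot y x.
Proof. by apply: eq_bigr => i _; rewrite mulrC. Qed.

Lemma dotDr x y z : dot x (y + z) = dot x y + dot x z.
Proof. by rewrite -big_split; apply: eq_bigr => i _; rewrite mxE mulrDr. Qed.

Lemma dotZr a x y : dot x (a *: y) = a * dot x y.
Proof. by rewrite mulr_sumr; apply: eq_bigr => i _; rewrite mxE mulrCA. Qed.

Lemma dotNr x y : dot x (- y) = - dot x y.
Proof. by rewrite -scaleN1r dotZr mulN1r. Qed.

Lemma dotZl a x y : dot (a *: x) y = a * dot x y.
Proof. by rewrite dotC dotZr dotC. Qed.

Lemma dotDl x y z : dot (x + y) z = dot x z + dot y z.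
Proof. by rewrite dotC dotDr !(dotC z). Qed.

Lemma dotxx_ge0 x : 0 <= dot x x.
Proof. by apply: sumr_ge0 => i _; rewrite -expr2 sqr_ge0. Qed.

Lemma enormE x : enorm x = Num.sqrt (dot x x).
Proof. by rewrite /enorm; congr Num.sqrt; apply: eq_bigr => i _; rewrite expr2. Qed.

Lemma enorm_sqr x : enorm x ^+ 2 = dot x x.
Proof. by rewrite enormE sqr_sqrtr// dotxx_ge0. Qed.

Lemma enorm_ge0 x : 0 <= enorm x.
Proof. exact: sqrtr_ge0. Qed.

Lemma dotxx_eq0 x : (dot x x == 0) = (x == 0).
Proof.
apply/idP/eqP => [|->]; last first.
  by apply/eqP; apply: big1 => i _; rewrite mxE mul0r.
rewrite psumr_eq0 => [/allP x0|i _]; last by rewrite -expr2 sqr_ge0.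
apply/rowP => i; rewrite mxE; apply/eqP.
by have := x0 i (mem_index_enum _); rewrite /= -expr2 sqrf_eq0.
Qed.

Lemma enorm_eq0 x : (enorm x == 0) = (x == 0).
Proof. by rewrite -sqrf_eq0 enorm_sqr dotxx_eq0. Qed.

Lemma enorm0 : enorm (0 : 'rV[R]_n) = 0.
Proof. by apply/eqP; rewrite enorm_eq0. Qed.

Lemma enorm_gt0 x : (0 < enorm x) = (x != 0).
Proof. by rewrite lt0r enorm_eq0 enorm_ge0 andbT. Qed.

Lemma enormZ a x : enorm (a *: x) = `|a| * enorm x.
Proof.
by rewrite !enormE dotZl dotZr mulrA -expr2 sqrtrM ?sqr_ge0// sqrtr_sqr.
Qed.

Lemma enormN x : enorm (- x) = enorm x.
Proof. by rewrite -scaleN1r enormZ normrN1 mul1r. Qed.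

Lemma enormB x y : enorm (x - y) = enorm (y - x).
Proof. by rewrite -enormN opprB. Qed.

(** Cauchy-Schwarz, from the square of the component of [x] orthogonal to [y], scaled by [dot y y]
    to avoid a division. *)
Lemma dot_le x y : `|dot x y| <= enorm x * enorm y.
Proof.
have [->|y0] := eqVneq y 0.
  by rewrite enorm0 mulr0 /dot big1 ?normr0// => i _; rewrite mxE mulr0.
rewrite -(ler_pXn2r (n := 2))// ?nnegrE ?mulr_ge0 ?enorm_ge0//.
rewrite real_normK ?num_real// exprMn !enorm_sqr.
have := dotxx_ge0 (dot y y *: x - dot x y *: y).
have yy : 0 < dot y y by rewrite lt0r dotxx_eq0 y0 dotxx_ge0.
rewrite dotDr !dotDl -!scaleNr !dotZl !dotZr (dotC y x) => H.
have {}H : 0 <= dot y y * (dot x x * dot y y - dot x y ^+ 2) by nra.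
by rewrite -subr_ge0 -(pmulr_rge0 _ yy).
Qed.

Lemma enormD x y : enorm (x + y) <= enorm x + enorm y.
Proof.
rewrite -(ler_pXn2r (n := 2))// ?nnegrE ?addr_ge0 ?enorm_ge0//.
rewrite sqrrD !enorm_sqr dotDr !dotDl (dotC y x).
have := le_trans (ler_norm _) (dot_le x y).
by rewrite -mulr_natl; lra.
Qed.

Lemma enormBD x y z : enorm (x - z) <= enorm (x - y) + enorm (y - z).
Proof. by rewrite -[x - z](subrKA y); exact: enormD. Qed.

Lemma coord_le_enorm x i : `|x 0 i| <= enorm x.
Proof.
rewrite -sqrtr_sqr; apply: ler_wsqrtr; rewrite (bigD1 i)//= lerDl.
by apply: sumr_ge0 => j _; rewrite sqr_ge0.
Qed.

Lemma normr_le_enorm x : `|x| <= enorm x.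
Proof.
rewrite [`|x|]mx_normrE; apply: bigmax_le; first exact: enorm_ge0.
by move=> [i j] _ /=; rewrite (ord1 i); exact: coord_le_enorm.
Qed.

Lemma enorm_le_normr x : enorm x <= n%:R * `|x|.
Proof.
have x0 i : `|x 0 i| <= `|x|.
  rewrite [leRHS]mx_normrE.
  by rewrite (le_bigmax _ (fun ij => `|x ij.1 ij.2|) (ord0, i)).
rewrite -[leRHS]ger0_norm ?mulr_ge0// -sqrtr_sqr; apply: ler_wsqrtr.
apply: (@le_trans _ _ (n%:R * `|x| ^+ 2)).
  rewrite -[n in n%:R]card_ord -sumr_const mulr_suml.
  apply: ler_sum => i _; rewrite mul1r -real_normK ?num_real//.
  by rewrite lerXn2r ?nnegrE.
rewrite exprMn ler_wpM2r ?sqr_ge0// -natrX ler_nat.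
by case: (n) => // m; rewrite leq_pmull.
Qed.

End euclidean_space.

(** * Measurability and volume of Euclidean balls *)

Section lebesgue_balls.
Context {R : realType} {n : nat}.
Local Notation RB := (measurableTypeR R).
Local Notation mu := (@lebesgue_rV R n).
Local Notation LT := (lebesgueType R n).
Implicit Types (x y z b : 'rV[R]_n) (r : R).

Lemma measurable_dot b : measurable_fun [set: LT] (dot b : LT -> R).
Proof.
rewrite /dot; apply: measurable_sum => i.
exact: (measurable_funM (measurable_cst (b 0 i)) (measurable_coord i)).
Qed.

Lemma measurable_dotxx : measurable_fun [set: LT] ((fun z => dot z z) : LT -> R).
Proof.
rewrite /dot; apply: measurable_sum => i.
exact: (measurable_funM (measurable_coord i) (measurable_coord i)).
Qed.

Lemma measurable_enorm : measurable_fun [set: LT] (@enorm R n : LT -> R).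
Proof.
rewrite (_ : enorm = (fun z : LT => Num.sqrt (dot z z))); last first.
  by apply/funext => z; rewrite enormE.
apply: measurableT_comp measurable_dotxx.
by apply: continuous_measurable_fun; exact: sqrt_continuous.
Qed.

Lemma measurable_enorm_powR (v : R) :
  measurable_fun [set: LT] (fun z : LT => enorm z `^ v).
Proof. exact: (measurableT_comp (measurable_powR v) measurable_enorm). Qed.

Lemma measurable_eball0 r : measurable (eball 0 r : set LT).
Proof.
rewrite (_ : eball 0 r = [set: LT] `&` (@enorm R n) @^-1` `]-oo, r[%classic).
  exact: measurable_enorm.
by apply/seteqP; split => z; rewrite /eball /= in_itv/= subr0 => //; case.
Qed.

Lemma eball_shift x r : eball 0 r = (fun z : 'rV[R]_n => x + 1 *: z) @^-1` eball x r.
Proof.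
by apply/seteqP; split => z; rewrite /eball /= subr0 scale1r addrC addKr.
Qed.

Lemma eball_shiftN x r :
  eball x r = (fun z : 'rV[R]_n => - x + 1 *: z) @^-1` eball 0 r.
Proof.
by apply/seteqP; split => z; rewrite /eball /= subr0 scale1r addrC.
Qed.

Lemma measurable_eball x r : measurable (eball x r : set LT).
Proof.
rewrite eball_shiftN -[X in measurable X]setTI.
by apply: measurable_affine => //; [left|exact: measurable_eball0].
Qed.

Lemma lebesgue_tuple_cube m r : 0 <= r ->
  let Q := [set t : m.-tuple RB | forall i, `|tnth t i| <= r] in
  measurable Q /\ lebesgue_tuple m Q = ((2 * r) ^+ m)%:E.
Proof.
move=> r0; elim: m => [|m [mQ ihQ]].
  have -> : [set t : 0.-tuple RB | forall i, `|tnth t i| <= r] = setT.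
    by apply/seteqP; split => // t _ [].
  by split; [exact: measurableT|rewrite expr0 /= diracT].
pose I : set RB := `[- r, r]%classic.
set Q := [set t : m.-tuple RB | _] in mQ ihQ.
set Q1 := [set t | _].
have IQ : @Defs.cons_tuple R m @^-1` Q1 = I `*` Q.
  apply/seteqP; split => -[x t]; rewrite /Q1 /Q /I /= in_itv /= -ler_norml.
    move=> H; split; first by have := H ord0; rewrite (tnth_nth 0).
    by move=> i; have := H (lift ord0 i); rewrite !(tnth_nth 0).
  move=> [xr tr] i; case: (unliftP ord0 i) => [j|] ->; rewrite (tnth_nth 0) //.
  by have := tr j; rewrite (tnth_nth 0).
have mIQ : measurable (I `*` Q).
  by apply: measurableX => //; exact: measurable_itv.
split; last first.
  rewrite /= /cons_measure /pushforward IQ product_measure1E//; last first.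
    exact: measurable_itv.
  rewrite [X in (_ * X)%E]ihQ [X in (X * _)%E]lebesgue_measure_itv/= lte_fin.
  rewrite -EFinB opprK; case: ltP => [_|rr]; first by rewrite -EFinM exprS; congr EFin; ring.
  have -> : r = 0 by lra.
  by rewrite mul0e mulr0 exprS mul0r.
have -> : Q1 = @uncons_tuple R m @^-1` (I `*` Q).
  rewrite -IQ -comp_preimage (_ : _ \o _ = id) ?preimage_id//.
  by apply/funext => t; exact: uncons_tupleK.
by rewrite -[X in measurable X]setTI; exact: (@measurable_uncons_tuple R m).
Qed.

(** The ball lies in a cube of side 2r; every later estimate relies on the scaling r^n and not on
    the exact volume. *)
Lemma lebesgue_rV_eball x r : 0 <= r -> (mu (eball x r) <= ((2 * r) ^+ n)%:E)%E.
Proof.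
move=> r0; rewrite -[leLHS](lebesgue_rV_affine x 1 _ (or_introl erefl)).
rewrite -eball_shift.
have [mQ <-] := lebesgue_tuple_cube n r r0.
rewrite -(measurable_mu_extE _ mQ); apply: le_mu_ext => t /=.
rewrite /eball/= subr0 => tr i; apply: le_trans (ltW tr).
by apply: le_trans (coord_le_enorm _ i); rewrite mxE.
Qed.

End lebesgue_balls.

(** * Integrals over dyadic annuli *)

Section dyadic_layers.
Context {R : realType}.

Lemma halving_layer (r x : R) : 0 < x -> x < r ->
  exists k : nat, r / 2 ^+ k.+1 <= x < r / 2 ^+ k.
Proof.
move=> x0 xr.
have ex : exists m : nat, r / 2 ^+ m <= x.
  exists (Num.truncn (r / x)).+1; rewrite ler_pdivrMr ?exprn_gt0//.
  rewrite mulrC -ler_pdivrMr//.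
  have h : r / x < (Num.truncn (r / x)).+1%:R by exact: truncnS_gt.
  by rewrite (le_trans (ltW h))// -natrX ler_nat ltnW// ltn_expl.
(* The least exponent is not 0 because x < r, so its predecessor gives the upper bound. *)
case: (ex_minnP ex) => -[|k] hk hmin.
  by move: hk; rewrite expr0 divr1; lra.
exists k; rewrite hk /= ltNge; apply/negP => /hmin.
by rewrite ltnn.
Qed.

Lemma doubling_layer (r x : R) : 0 < r -> r <= x ->
  exists k : nat, r * 2 ^+ k <= x < r * 2 ^+ k.+1.
Proof.
move=> r0 rx.
have ex : exists m : nat, x < r * 2 ^+ m.
  exists (Num.truncn (x / r)).+1; rewrite mulrC -ltr_pdivrMr//.
  have h : x / r < (Num.truncn (x / r)).+1%:R by exact: truncnS_gt.
  by rewrite (lt_le_trans h)// -natrX ler_nat ltnW// ltn_expl.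
case: (ex_minnP ex) => -[|k] hk hmin.
  by move: hk; rewrite expr0 mulr1; lra.
exists k; rewrite hk andbT leNgt; apply/negP => /hmin.
by rewrite ltnn.
Qed.

Lemma trivIset_layers (T : Type) (g : T -> R) (a b : nat -> R) :
  (forall i j, (i < j)%N -> b i <= a j \/ b j <= a i) ->
  trivIset setT (fun k => [set z | a k <= g z < b k]).
Proof.
move=> H; apply/trivIsetP => i j _ _ ij.
apply/seteqP; split => // z /= [/andP[i1 i2] /andP[j1 j2]].
by move: ij; rewrite neq_ltn => /orP[] /H [] h; lra.
Qed.

(** Common summation step for the singularity at the origin, the tail at infinity and the
    singularity along a hyperplane. *)
Lemma integral_bigcup_geometric d (T : measurableType d)
    (m : {measure set T -> \bar R}) (F : nat -> set T) (f : T -> \bar R)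
    (c l : R) :
  (forall k, measurable (F k)) -> trivIset setT F ->
  measurable_fun (\bigcup_k F k) f ->
  (forall x, (\bigcup_k F k) x -> (0 <= f x)%E) -> 0 <= l < 1 ->
  (forall k, (\int[m]_(x in F k) f x <= (c * l ^+ k)%:E)%E) ->
  (\int[m]_(x in \bigcup_k F k) f x <= (c / (1 - l))%:E)%E.
Proof.
move=> mF tF mf f0 /andP[l0 l1] H.
rewrite ge0_integral_bigcup//.
apply: (@le_trans _ _ (\sum_(k <oo) (c * l ^+ k)%:E)%E).
  apply: lee_nneseries => [k _ _|k _]; last exact: H.
  by apply: integral_ge0 => x Fx; apply: f0; exists k.
rewrite le_eqVlt; apply/orP; left; apply/eqP/cvg_lim => //.
have -> : (fun n => (\sum_(0 <= k < n) (c * l ^+ k)%:E)%E) =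
    EFin \o series (geometric c l).
  by apply/funext => k /=; rewrite sumEFin.
apply: cvg_EFin; first exact: nearW.
by apply: cvg_geometric_series; rewrite ger0_norm.
Qed.

Lemma powR_half_lt1 (s : R) : 0 < s -> 0 <= 2^-1 `^ s < 1.
Proof.
move=> s0; rewrite powR_ge0 /= -[X in _ < X](congr1 (@^~ s) (powR1 R)).
by apply: gt0_ltr_powR => //; rewrite ?nnegrE//; lra.
Qed.

Lemma powR_halves (r s : R) k : 0 <= r ->
  (r / 2 ^+ k) `^ s = r `^ s * (2^-1 `^ s) ^+ k.
Proof.
move=> r0; have -> : (2 ^+ k)^-1 = 2^-1 `^ k%:R :> R.
  by rewrite powR_mulrn ?exprVn ?invr_ge0.
rewrite powRM ?powR_ge0// powRAC; congr (_ * _).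
by apply: powR_mulrn; exact: powR_ge0.
Qed.

End dyadic_layers.

Section annuli.
Context {R : realType} {n : nat}.
Local Notation mu := (@lebesgue_rV R n).
Local Notation LT := (lebesgueType R n).
Implicit Types (b z : 'rV[R]_n) (r : R).

Definition annulus (a r : R) : set 'rV[R]_n := [set z | a <= enorm z < r].

Lemma measurable_annulus a r : measurable (annulus a r : set LT).
Proof.
rewrite (_ : annulus a r = [set: LT] `&` (@enorm R n) @^-1` `[a, r[%classic).
  exact: measurable_enorm.
by apply/seteqP; split => z; rewrite /annulus /= in_itv/= => //; case.
Qed.

Lemma lebesgue_annulus a r : 0 <= r -> (mu (annulus a r) <= ((2 * r) ^+ n)%:E)%E.
Proof.
move=> r0; apply: le_trans (lebesgue_rV_eball 0 r r0).
apply: le_measure; rewrite ?inE.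
- exact: measurable_annulus.
- exact: measurable_eball.
- by move=> z /= /andP[_]; rewrite /eball /= subr0.
Qed.

Lemma integral_le_cst (D : set LT) (f : LT -> \bar R) (c v : R) :
  measurable D -> measurable_fun D f -> (forall x, D x -> (0 <= f x)%E) ->
  (forall x, D x -> (f x <= c%:E)%E) -> 0 <= c -> (mu D <= v%:E)%E ->
  (\int[mu]_(x in D) f x <= (c * v)%:E)%E.
Proof.
move=> mD mf f0 fc c0 Dv.
apply: (@le_trans _ _ (\int[mu]_(x in D) c%:E)%E).
  by apply: ge0_le_integral.
by rewrite integral_cst// EFinM lee_wpmul2l// lee_fin.
Qed.

(** The annuli have outer radii r / 2^k, so their bounds decrease with ratio 2^-s. *)
Lemma integral_punctured_ball (f : LT -> \bar R) (c s r : R) :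
  measurable_fun [set: LT] f -> (forall z, 0 <= f z)%E -> 0 < s -> 0 < r ->
  (forall rho : R, 0 < rho <= r ->
    (\int[mu]_(z in annulus (rho / 2) rho) f z <= (c * rho `^ s)%:E)%E) ->
  (\int[mu]_(z in [set z | (0 < enorm z < r)%R]) f z <=
    (c / (1 - 2^-1 `^ s) * r `^ s)%:E)%E.
Proof.
move=> mf f0 s0 r0 H.
have -> : [set z : LT | 0 < enorm z < r] =
    \bigcup_k (annulus (r / 2 ^+ k / 2) (r / 2 ^+ k) : set LT).
  apply/seteqP; split => z /=.
    move=> /andP[z0 zr]; have [k hk] := halving_layer r (enorm z) z0 zr.
    by exists k => //; rewrite /annulus/=; rewrite exprSr invfM mulrA in hk.
  move=> [k _ /= /andP[h1 h2]]; apply/andP; split.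
    by apply: lt_le_trans h1; rewrite !divr_gt0// exprn_gt0.
  apply: (lt_le_trans h2); rewrite ler_pdivrMr ?exprn_gt0//.
  by apply: ler_peMr; [exact: ltW|rewrite exprn_ege1// ler1n].
rewrite mulrAC; apply: integral_bigcup_geometric => //.
- by move=> k; exact: measurable_annulus.
- apply: trivIset_layers => i j ij; right.
  rewrite -mulrA -invfM -exprSr ler_pM2l// lef_pV2 ?posrE ?exprn_gt0//.
  by rewrite ler_eXn2l// ltr1n.
- exact: measurable_funTS.
- exact: powR_half_lt1.
- move=> k; rewrite -[c * _ * _]mulrA -powR_halves ?(ltW r0)//; apply: H.
  rewrite divr_gt0 ?exprn_gt0//= ler_pdivrMr ?exprn_gt0//.
  by apply: ler_peMr; [exact: ltW|rewrite exprn_ege1// ler1n].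
Qed.

(** On the layer of inner radius rho the kernel is at most rho^-(n + t) and the volume at most (4
    rho)^n, so the layers contribute multiples of rho^-t, with ratio 2^-t. *)
Lemma integral_tail (t r : R) : 0 < t -> 0 < r -> exists C : R,
  (\int[mu]_(z in ~` eball 0 r) ((enorm z `^ (n%:R + t))^-1)%:E <= C%:E)%E.
Proof.
move=> t0 r0.
pose v := n%:R + t.
have v0 : 0 <= v by rewrite /v; have := ler0n R n; lra.
have -> : (~` eball 0 r : set LT) =
    \bigcup_k (annulus (r * 2 ^+ k) (r * 2 ^+ k.+1) : set LT).
  apply/seteqP; split => z; rewrite /eball /= subr0.
    move=> /negP; rewrite -leNgt => rz.
    by have [k hk] := doubling_layer r (enorm z) r0 rz; exists k.
  move=> [k _ /= /andP[h1 h2]]; apply/negP; rewrite -leNgt; apply: le_trans h1.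
  by apply: ler_peMr; [exact: ltW|rewrite exprn_ege1// ler1n].
exists ((r `^ v)^-1 * (4 * r) ^+ n / (1 - 2^-1 `^ t)).
have mf : measurable_fun [set: LT] (fun z : LT => ((enorm z `^ v)^-1)%:E).
  apply/measurable_EFinP.
  rewrite (_ : (fun z => _) = (fun z : LT => enorm z `^ (- v))).
    exact: measurable_enorm_powR.
  by apply/funext => z; rewrite powRN.
apply: integral_bigcup_geometric.
- by move=> k; exact: measurable_annulus.
- apply: trivIset_layers => i j ij; left.
  by rewrite ler_pM2l// ler_eXn2l// ltr1n.
- exact: measurable_funTS.
- by move=> z _; rewrite lee_fin invr_ge0 powR_ge0.
- exact: powR_half_lt1.
move=> k.
have rk : 0 < r * 2 ^+ k by rewrite mulr_gt0// exprn_gt0.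
have -> : (r `^ v)^-1 * (4 * r) ^+ n * (2^-1 `^ t) ^+ k =
    ((r * 2 ^+ k) `^ v)^-1 * (2 * (r * 2 ^+ k.+1)) ^+ n.
  have -> : 2 * (r * 2 ^+ k.+1) = 4 * (r * 2 ^+ k) by rewrite exprS; ring.
  have vE x : 0 < x -> x `^ v = x ^+ n * x `^ t.
    by move=> x0; rewrite powRD ?powR_mulrn ?(ltW x0)// (gt_eqF x0) implybT.
  have h2 : (2^-1 : R) `^ t ^+ k = ((2 ^+ k) `^ t)^-1.
    by rewrite -(powR_mulrn k) ?powR_ge0// powRAC powR_mulrn ?invr_ge0//
      exprVn -powR_inv1 ?exprn_ge0// powRAC powR_inv1 ?powR_ge0.
  rewrite h2 !vE// [(r * _) `^ t]powRM ?exprn_ge0 ?(ltW r0)// !exprMn.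
  have : r `^ t != 0 by rewrite gt_eqF// powR_gt0.
  have : (2 ^+ k) `^ t != 0 :> R by rewrite gt_eqF// powR_gt0// exprn_gt0.
  have : r ^+ n != 0 by rewrite gt_eqF// exprn_gt0.
  have : (2 ^+ k) ^+ n != 0 :> R by rewrite gt_eqF// !exprn_gt0.
  by move=> *; field; apply/and4P.
apply: integral_le_cst.
- exact: measurable_annulus.
- exact: measurable_funTS.
- by move=> z _; rewrite lee_fin invr_ge0 powR_ge0.
- move=> z /= /andP[h1 h2]; rewrite lee_fin lef_pV2 ?posrE ?powR_gt0//.
    by apply: ge0_ler_powR => //; rewrite ?nnegrE ?enorm_ge0// ltW.
  exact: lt_le_trans rk h1.
- by rewrite invr_ge0 powR_ge0.
- by apply: lebesgue_annulus; rewrite mulr_ge0 ?exprn_ge0// ltW.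
Qed.

(* N + 1 translates of the slab in the direction of b are disjoint and fit in
   a ball of radius 2 rho. *)
Lemma lebesgue_slab b (t rho : R) : b != 0 -> 0 < t -> 0 < rho ->
  (mu [set z | (enorm z < rho)%R /\ (`|dot b z| < t)%R] <=
    ((4 * rho) ^+ n * (2 * t) / (rho * enorm b))%:E)%E.
Proof.
move=> b0 t0 rho0.
set S := [set z | _].
have mS : measurable (S : set LT).
  rewrite (_ : S = (eball 0 rho : set LT) `&` ([set: LT] `&` (dot b) @^-1` `]-t, t[%classic)).
    by apply: measurableI; [exact: measurable_eball|exact: measurable_dot].
  apply/seteqP; split => z; rewrite /S /eball /= subr0 in_itv/= ltr_norml.
    by move=> [-> ->].
  by move=> [-> [_ ->]].
have nb0 : 0 < enorm b by rewrite enorm_gt0.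
(* Translating by [e], of length 2t / |b|, moves [dot b z] by 2t, the width of the slab. N such
   steps stay within distance rho, and the strict bound on N + 1 yields the estimate. *)
pose N := Num.truncn (rho * enorm b / (2 * t)).
have Nle : N%:R * (2 * t) <= rho * enorm b.
  rewrite -ler_pdivlMr ?mulr_gt0//.
  by rewrite truncn_le divr_ge0 ?mulr_ge0// ltW.
have Nlt : rho * enorm b < N.+1%:R * (2 * t).
  by rewrite -ltr_pdivrMr ?mulr_gt0//; exact: truncnS_gt.
pose e : 'rV[R]_n := (2 * t / dot b b) *: b.
have bb : dot b b = enorm b ^+ 2 by rewrite enorm_sqr.
have bb0 : dot b b != 0 by rewrite dotxx_eq0.
have be : dot b e = 2 * t by rewrite dotZr -mulrA mulVf ?mulr1.
have ee : enorm e = 2 * t / enorm b.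
  rewrite enormZ bb ger0_norm; last first.
    by rewrite divr_ge0 ?mulr_ge0 ?exprn_ge0 ?(ltW t0) ?(ltW nb0).
  by field; rewrite gt_eqF.
pose F (k : 'I_N.+1) : set LT :=
  (fun z : 'rV[R]_n => - (k%:R *: e) + 1 *: z) @^-1` S.
have FE k z : F k z <-> enorm (z - k%:R *: e) < rho /\
    `|dot b z - k%:R * (2 * t)| < t.
  rewrite /F /S /= scale1r addrC.
  by rewrite dotDr dotNr dotZr be.
have mF k : measurable (F k).
  rewrite -[F k]setTI; apply: measurable_affine => //; exact: or_introl.
have tF : trivIset setT F.
  apply/trivIsetP => i j _ _ ij; apply/seteqP; split => // z.
  move=> [/FE [_ zi] /FE [_ zj]].
  wlog ltij : i j ij zi zj / (i < j)%N => [wl|].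
    move: (ij); rewrite neq_ltn => /orP[] h; first exact: (wl i j).
    by apply: (wl j i) => //; rewrite eq_sym.
  have {ltij} : i%:R + 1 <= j%:R :> R by rewrite natr1 ler_nat.
  by move: zi zj; rewrite !ltr_norml => /andP[z1 z2] /andP[z3 z4]; nra.
have muF k : mu (F k) = mu S by apply: lebesgue_rV_affine; left.
have sub : \big[setU/set0]_(k < N.+1) F k `<=` eball 0 (2 * rho).
  move=> z; rewrite -bigcup_mkord_ord => -[k _ /FE [zk _]].
  rewrite /eball /= subr0.
  have := enormD (z - (inord k : 'I_N.+1)%:R *: e) ((inord k : 'I_N.+1)%:R *: e).
  rewrite subrK => h; apply: (le_lt_trans h).
  have : enorm ((inord k : 'I_N.+1)%:R *: e) <= rho.
    rewrite enormZ ee normr_nat mulrA ler_pdivrMr//; apply: le_trans Nle.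
    by apply: ler_wpM2r; [rewrite mulr_ge0 ?(ltW t0)|rewrite ler_nat -ltnS].
  lra.
have : (mu (\big[setU/set0]_(k < N.+1) F k) <= ((4 * rho) ^+ n)%:E)%E.
  have -> : 4 * rho = 2 * (2 * rho) by ring.
  apply: le_trans (lebesgue_rV_eball 0 (2 * rho) _); last by rewrite mulr_ge0 ?(ltW rho0).
  apply: le_measure; rewrite ?inE => //; last exact: measurable_eball.
  exact: bigsetU_measurable.
rewrite measure_semi_additive_ord//; last exact: bigsetU_measurable.
rewrite (eq_bigr (fun=> mu S)); last by move=> k _; exact: muF.
have Sfin : mu S \is a fin_num.
  rewrite ge0_fin_numE//; apply: (@le_lt_trans _ _ (mu (eball 0 rho))).
    apply: le_measure; rewrite ?inE//; first exact: measurable_eball.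
    by move=> z [zr _]; rewrite /eball /= subr0.
  by apply: le_lt_trans (lebesgue_rV_eball 0 rho (ltW rho0)) _; rewrite ltry.
rewrite -(fineK Sfin); have := fine_ge0 (measure_ge0 mu S).
move: (fine _) => v v0.
rewrite sumEFin sumr_const card_ord -(mulr_natr v) !lee_fin => h.
rewrite ler_pdivlMr ?mulr_gt0//.
apply: (@le_trans _ _ (v * (N.+1%:R * (2 * t)))); first by rewrite ler_wpM2l// ltW.
rewrite [leLHS]mulrA; apply: ler_wpM2r; first by rewrite mulr_ge0 ?(ltW t0).
exact: h.
Qed.

End annuli.

(** * Elementary inequalities for the signed power *)

Section signed_power.
Context {R : realType}.
Variable p : R.
Hypothesis p_gt1 : 1 < p.
Implicit Types (t x y m c : R).
Local Notation J := (signed_pow p).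

Lemma signed_pow_ge0E t : 0 <= t -> J t = t `^ (p - 1).
Proof.
have p1 := p_gt1.
move=> t0; rewrite /signed_pow ger0_norm// mulrC.
have -> : p - 2 = (p - 1) - 1 by ring.
by rewrite mulr_powRB1//; lra.
Qed.

Lemma signed_powN t : J (- t) = - J t.
Proof. by rewrite /signed_pow normrN mulrN. Qed.

Lemma signed_powM c t : 0 <= c -> J (c * t) = c `^ (p - 1) * J t.
Proof.
move=> c0; have H x : 0 <= x -> J (c * x) = c `^ (p - 1) * J x.
  by move=> x0; rewrite !signed_pow_ge0E ?mulr_ge0// powRM.
have [|t0] := leP 0 t; first exact: H.
by rewrite -[t]opprK mulrN signed_powN (signed_powN (- t)) H ?mulrN//; lra.
Qed.

Lemma signed_pow_ge0 t : 0 <= t -> 0 <= J t.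
Proof. by move=> t0; rewrite signed_pow_ge0E// powR_ge0. Qed.

Lemma normr_signed_pow t : `|J t| = `|t| `^ (p - 1).
Proof.
have [t0|t0] := leP 0 t.
  by rewrite !ger0_norm ?signed_pow_ge0E// powR_ge0.
rewrite -[in LHS](opprK t) signed_powN normrN signed_pow_ge0E; last by rewrite oppr_ge0 ltW.
by rewrite ger0_norm ?powR_ge0// ltr0_norm.
Qed.

Lemma ler_signed_pow_ge0 x y : 0 <= x -> x <= y -> J x <= J y.
Proof.
have p1 := p_gt1.
move=> x0 xy; have y0 := le_trans x0 xy.
rewrite !signed_pow_ge0E//; by apply: ge0_ler_powR; rewrite ?nnegrE//; lra.
Qed.

Lemma ler_signed_pow x y : x <= y -> J x <= J y.
Proof.
have [x0|x0] := leP 0 x; first exact: ler_signed_pow_ge0.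
have [y0|y0] := leP 0 y => xy.
  apply: (@le_trans _ _ 0); last exact: signed_pow_ge0.
  by rewrite -[x]opprK signed_powN oppr_le0 signed_pow_ge0// oppr_ge0 ltW.
rewrite -[x]opprK -[y]opprK !(signed_powN (- _)) lerN2.
by apply: ler_signed_pow_ge0; lra.
Qed.

Lemma ltr_signed_pow_ge0 x y : 0 <= x -> x < y -> J x < J y.
Proof.
have p1 := p_gt1.
move=> x0 xy; have y0 : 0 <= y by lra.
by rewrite !signed_pow_ge0E//; apply: gt0_ltr_powR; rewrite ?nnegrE//; lra.
Qed.

Lemma normr_signed_powB x y :
  `|J (x - y)| <= 2 `^ (p - 1) * (`|x| `^ (p - 1) + `|y| `^ (p - 1)).
Proof.
have p1 := p_gt1.
wlog xy : x y / `|x| <= `|y| => [wl|].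
  have [|/ltW yx] := leP `|x| `|y|; first exact: wl.
  by rewrite -opprB signed_powN normrN [X in _ * X]addrC wl.
rewrite normr_signed_pow.
apply: (@le_trans _ _ ((2 * `|y|) `^ (p - 1))).
  apply: ge0_ler_powR; rewrite ?nnegrE; [lra|by []|by rewrite mulr_ge0|].
  by have := ler_normB x y; lra.
by rewrite powRM// ler_wpM2l ?powR_ge0// lerDr powR_ge0.
Qed.

Lemma measurable_signed_pow : measurable_fun [set: R] J.
Proof.
apply: measurable_funM => //.
exact: (measurableT_comp (measurable_powR (p - 2)) (@normr_measurable R setT)).
Qed.

(** Here t is the odd part and m the even part of an increment, so the left-hand side is the sum of
    the values of [J] at z and -z. The linear part cancels, leaving a difference across a gap 2m. *)
Lemma signed_pow_symE t m : J (t + m) + J (- t + m) = J (t + m) - J (t - m).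
Proof. by rewrite -[t - m]opprB signed_powN opprK [- t + m]addrC. Qed.

Lemma signed_pow_symN t m :
  J (- t + m) - J (- t - m) = J (t + m) - J (t - m).
Proof.
have -> : - t - m = - (t + m) by ring.
have -> : - t + m = - (t - m) by ring.
by rewrite !signed_powN; ring.
Qed.

Lemma signed_pow_sym_ge0 t m : 0 <= m -> 0 <= J (t + m) - J (t - m).
Proof. by move=> m0; rewrite subr_ge0 ler_signed_pow//; lra. Qed.

(** A mean value inequality obtained without derivatives: induction lowers the exponent by one until
    a < 1. The constant N + 1 replaces a + 1. *)
Lemma powR_diff_le (a x y : R) (N : nat) : 0 <= a <= N%:R -> 0 <= y <= x ->
  x `^ (a + 1) - y `^ (a + 1) <= N.+1%:R * (x - y) * x `^ a.
Proof.
elim: N a => [|N ih] a /andP[a0 aN] /andP[y0 yx].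
  have -> : a = 0 by lra.
  by rewrite add0r !powRr1 ?powRr0//; lra.
have x0 : 0 <= x by lra.
have xa0 : 0 <= x `^ a by exact: powR_ge0.
have E z : 0 <= z -> z `^ (a + 1) = z * z `^ a.
  by move=> z0; rewrite -[in RHS](addrK 1 a) mulr_powRB1//; lra.
rewrite !E//.
have [->|y_neq0] := eqVneq y 0.
  by rewrite mul0r !subr0 -mulrA ler_peMl ?mulr_ge0// ler1n.
have y_gt0 : 0 < y by rewrite lt0r y_neq0.
suff H : y * (x `^ a - y `^ a) <= N.+1%:R * (x - y) * x `^ a.
  by rewrite -[N.+2]addn1 natrD; lra.
have [a1|a1] := leP 1 a.
  have := ih (a - 1); rewrite subrK => /(_ _ _) H.
  have {}H : x `^ a - y `^ a <= N.+1%:R * (x - y) * x `^ (a - 1).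
    by apply: H; [rewrite -natr1 in aN; apply/andP; split; lra|rewrite y0 yx].
  apply: (@le_trans _ _ (y * (N.+1%:R * (x - y) * x `^ (a - 1)))).
    by rewrite ler_wpM2l.
  rewrite [leLHS]mulrC -[leLHS]mulrA; apply: ler_wpM2l.
    by rewrite mulr_ge0 ?subr_ge0.
  rewrite -(@mulr_powRB1 _ x a)//; last by lra.
  by rewrite mulrC ler_wpM2r ?powR_ge0.
(* For a < 1 the power a - 1 is nonincreasing, which leads to y x^a <= x y^a. The case a = 0 is
   treated apart below, because [mulr_powRB1] asks for a positive exponent. *)
have xy : x `^ (a - 1) <= y `^ (a - 1).
  have -> : a - 1 = - (1 - a) by ring.
  rewrite !powRN lef_pV2 ?posrE ?powR_gt0//; last by lra.
  by apply: ge0_ler_powR; rewrite ?nnegrE; lra.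
have : x `^ a <= x * y `^ (a - 1).
  have [a00|a_gt0] := eqVneq a 0.
    have := xy; rewrite a00 sub0r !powRr0 powR_inv1// powR_inv1// => _.
    by rewrite ler_pdivlMr// mul1r.
  by rewrite -(@mulr_powRB1 _ x a)// ?ler_wpM2l// lt0r a_gt0.
have ya : y * y `^ (a - 1) = y `^ a.
  have [a00|a_gt0] := eqVneq a 0.
    by rewrite a00 sub0r powRr0 powR_inv1// mulfV.
  by rewrite mulr_powRB1// lt0r a_gt0.
have yax : y `^ a <= x `^ a by apply: ge0_ler_powR; rewrite ?nnegrE; lra.
move=> h.
have h1 : y * x `^ a <= x * y `^ a by rewrite -ya mulrCA; apply: ler_wpM2l.
have h2 : (x - y) * y `^ a <= (x - y) * x `^ a by rewrite ler_wpM2l// subr_ge0.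
have h3 : (x - y) * x `^ a <= N.+1%:R * (x - y) * x `^ a.
  by rewrite -mulrA ler_peMl ?mulr_ge0 ?subr_ge0// ler1n.
lra.
Qed.

Lemma signed_pow_sym_degenerate : 2 <= p -> exists2 c, 0 <= c &
  forall t m, 0 <= m -> J (t + m) - J (t - m) <= c * m * (`|t| + m) `^ (p - 2).
Proof.
move=> p2; pose N := (Num.truncn (p - 2)).+1.
have pN : p - 2 <= N%:R by apply/ltW; exact: truncnS_gt.
(* Sum of the constants of two cases: 2(N + 1) from the mean value inequality across a gap 2m when m
   <= t, and 4 from 2(t + m) <= 4m when t < m. *)
exists (4 + 2 * N.+1%:R) => [|t m m0]; first by rewrite addr_ge0 ?mulr_ge0.
wlog t0 : t / 0 <= t => [wl|].
  have [|/ltW t0] := leP 0 t; first exact: wl.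
  have := wl (- t); rewrite normrN oppr_ge0 => /(_ t0).
  by rewrite signed_pow_symN.
rewrite ger0_norm//.
have P0 : 0 <= (t + m) `^ (p - 2) by exact: powR_ge0.
have E z : 0 <= z -> J z = z * z `^ (p - 2).
  by move=> z0; rewrite /signed_pow ger0_norm// mulrC.
have [tm|tm] := leP m t.
  rewrite !signed_pow_ge0E; [|lra|lra].
  have -> : p - 1 = (p - 2) + 1 by ring.
  have := @powR_diff_le (p - 2) (t + m) (t - m) N.
  have -> : t + m - (t - m) = 2 * m by ring.
  move=> /(_ _ _) H; apply: (le_trans (H _ _)); try (apply/andP; split; lra).
  by rewrite ler_wpM2r//; nra.
rewrite -[t - m]opprB signed_powN opprK.
apply: (@le_trans _ _ (2 * J (t + m))).
  rewrite mulr_natl mulr2n lerD2l; apply: ler_signed_pow; lra.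
rewrite E; last by lra.
rewrite mulrA ler_wpM2r//; nra.
Qed.

(** The power p - 2 is negative. For m >= t/2 the two values of [J] are bounded separately, giving
    3m + 2m; for m < t/2 both arguments stay above t/2 and the gap 2m suffices. *)
Lemma signed_pow_sym_singular t m : p < 2 -> t != 0 -> 0 <= m ->
  J (t + m) - J (t - m) <= 5 * m * `|t| `^ (p - 2).
Proof.
have p1 := p_gt1.
move=> p2 t_neq0 m0.
wlog t0 : t t_neq0 / 0 < t => [wl|].
  have [|tle0] := ltP 0 t; first exact: wl.
  have := wl (- t); rewrite normrN oppr_gt0 oppr_eq0 lt_neqAle t_neq0 => /(_ isT tle0).
  by rewrite signed_pow_symN.
rewrite (ger0_norm (ltW t0)).
have anti x y : 0 < x -> x <= y -> y `^ (p - 2) <= x `^ (p - 2).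
  move=> x0 xy; have -> : p - 2 = - (2 - p) by ring.
  rewrite !powRN lef_pV2 ?posrE ?powR_gt0//; last by lra.
  by apply: ge0_ler_powR; rewrite ?nnegrE; lra.
have E z : 0 <= z -> J z = z * z `^ (p - 2).
  by move=> z0; rewrite /signed_pow ger0_norm// mulrC.
have P0 : 0 <= t `^ (p - 2) by exact: powR_ge0.
(* The factor is 2^(2 - p), at most 2 because p > 1. *)
have half : (t / 2) `^ (p - 2) <= 2 * t `^ (p - 2).
  rewrite [leRHS]mulrC powRM ?(ltW t0) ?invr_ge0//; apply: ler_wpM2l => //.
  rewrite -powR_inv1// -powRrM -[leRHS]powRr1//.
  by apply: ler_powR; lra.
have [tm|tm] := leP (t / 2) m.
  have h1 : J (t + m) <= 3 * m * t `^ (p - 2).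
    apply: (@le_trans _ _ (J (3 * m))); first by apply: ler_signed_pow; lra.
    rewrite E; last by lra.
    by rewrite ler_wpM2l ?mulr_ge0//; apply: anti; lra.
  have h2 : - J (t - m) <= 2 * m * t `^ (p - 2).
    rewrite -signed_powN opprB.
    apply: (@le_trans _ _ (J m)); first by apply: ler_signed_pow; lra.
    rewrite E// [2 * m]mulrC -mulrA; apply: ler_wpM2l => //.
    by apply: le_trans half; apply: anti; lra.
  have -> : 5 * m * t `^ (p - 2) = 3 * m * t `^ (p - 2) + 2 * m * t `^ (p - 2).
    by ring.
  exact: lerD.
rewrite !E; [|lra|lra].
set x := t + m; set y := t - m.
have h1 : x * x `^ (p - 2) <= x * y `^ (p - 2).
  by rewrite ler_wpM2l; [|rewrite /x; lra|apply: anti; rewrite /x /y; lra].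
have h2 : y `^ (p - 2) <= 2 * t `^ (p - 2).
  by apply: le_trans half; apply: anti; rewrite /y; lra.
have h3 : (x - y) * y `^ (p - 2) <= (x - y) * (2 * t `^ (p - 2)).
  by rewrite ler_wpM2l// /x /y; lra.
have h4 : 0 <= m * t `^ (p - 2) by rewrite mulr_ge0.
have -> : 5 * m * t `^ (p - 2) =
   (x - y) * (2 * t `^ (p - 2)) + m * t `^ (p - 2) by rewrite /x /y; ring.
by rewrite mulrBl in h3; lra.
Qed.

End signed_power.

(** * Cancellation in the singular kernel *)

Section singular_kernel.
Context {R : realType} {n : nat}.
Local Notation mu := (@lebesgue_rV R n).
Local Notation LT := (lebesgueType R n).
Implicit Types (b z : 'rV[R]_n) (r : R).

Lemma lebesgue_hyperplane b r : b != 0 -> 0 < r ->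
  mu [set z | (enorm z < r)%R /\ dot b z = 0%R] = 0%E.
Proof.
move=> b0 r0; apply/eqP; rewrite eq_le measure_ge0 andbT.
apply/lee_addgt0Pr => e e0; rewrite add0e.
have nb0 : 0 < enorm b by rewrite enorm_gt0.
(* The slab estimate at half-width tau is [K] times tau, so half-width e / K gives exactly e. *)
pose K := (4 * r) ^+ n * 2 / (r * enorm b).
have K0 : 0 < K by rewrite divr_gt0 ?mulr_gt0 ?exprn_gt0 ?mulr_gt0.
have t0 : 0 < e / K by rewrite divr_gt0.
apply: (@le_trans _ _ (mu [set z | (enorm z < r)%R /\ (`|dot b z| < e / K)%R])).
  by apply: le_outer_measure => z /= [-> ->]; rewrite normr0.
apply: le_trans (lebesgue_slab b (e / K) r b0 t0 r0) _; rewrite lee_fin.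
rewrite le_eqVlt; apply/orP; left; apply/eqP.
by rewrite /K; field; rewrite !gt_eqF ?exprn_gt0 ?mulr_gt0.
Qed.

(** The layer where |b.z| is about beta / 2^k has volume of order 2^-k by the slab estimate. As p -
    2 > -1, the contributions decrease with ratio 2^-(p - 1). On the ball, |b.z| stays below beta =
    |b| r. *)
Lemma integral_dot_powR b (p : R) : b != 0 -> 1 < p < 2 -> exists2 c : R, 0 <= c &
  forall r, 0 < r ->
  (\int[mu]_(z in [set z | (enorm z < r)%R /\ dot b z != 0%R])
     (`|dot b z| `^ (p - 2))%:E <= (c * r ^+ n * r `^ (p - 2))%:E)%E.
Proof.
move=> b0 /andP[p1 p2].
have nb0 : 0 < enorm b by rewrite enorm_gt0.
have l01 : 0 <= (2^-1 : R) `^ (p - 1) < 1 by apply: powR_half_lt1; lra.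
exists ((enorm b / 2) `^ (p - 2) * 4 ^+ n * 2 / (1 - 2^-1 `^ (p - 1))).
  rewrite divr_ge0 ?mulr_ge0 ?powR_ge0//.
  by case/andP: l01 => _ h; rewrite subr_ge0 ltW.
move=> r r0.
pose beta := enorm b * r.
have beta0 : 0 < beta by rewrite mulr_gt0.
pose A k : set LT := [set z | enorm z < r] `&`
  [set z | beta / 2 ^+ k.+1 <= `|dot b z| < beta / 2 ^+ k].
have -> : [set z : LT | enorm z < r /\ dot b z != 0] = \bigcup_k A k.
  apply/seteqP; split => z /=.
    move=> [zr bz]; have [k hk] : exists k : nat, beta / 2 ^+ k.+1 <= `|dot b z| < beta / 2 ^+ k.
      apply: halving_layer; first by rewrite normr_gt0.
      by apply: le_lt_trans (dot_le _ _) _; rewrite ltr_pM2l.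
    by exists k.
  move=> [k _ [zr /= /andP[h _]]]; split => //; rewrite -normr_gt0.
  by apply: lt_le_trans h; rewrite divr_gt0 ?exprn_gt0.
have mA k : measurable (A k).
  rewrite (_ : A k = (eball 0 r : set LT) `&` ([set: LT] `&`
      (fun z : LT => `|dot b z|) @^-1` `[beta / 2 ^+ k.+1, beta / 2 ^+ k[%classic)).
    apply: measurableI; first exact: measurable_eball.
    have md : measurable_fun [set: LT] (fun z : LT => `|dot b z|).
      exact: (measurableT_comp (@normr_measurable R setT) (measurable_dot b)).
    exact: md.
  by apply/seteqP; split => z; rewrite /A /eball /= subr0 in_itv/= => -[? h]; split => //; case: h.
have mf : measurable_fun [set: LT] (fun z : LT => (`|dot b z| `^ (p - 2))%:E).
  apply/measurable_EFinP; apply: (measurableT_comp (measurable_powR (p - 2))).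
  exact: (measurableT_comp (@normr_measurable R setT) (measurable_dot b)).
have -> : (enorm b / 2) `^ (p - 2) * 4 ^+ n * 2 / (1 - 2^-1 `^ (p - 1)) *
    r ^+ n * r `^ (p - 2) =
    ((beta / 2) `^ (p - 2) * (4 * r) ^+ n * 2) / (1 - 2^-1 `^ (p - 1)).
  have -> : beta / 2 = enorm b / 2 * r by rewrite /beta; ring.
  rewrite [(_ * r) `^ _]powRM ?(ltW r0) ?divr_ge0 ?(ltW nb0)// exprMn.
  ring.
apply: integral_bigcup_geometric.
- exact: mA.
- have := @trivIset_layers R LT (fun z => `|dot b z|)
    (fun k => beta / 2 ^+ k.+1) (fun k => beta / 2 ^+ k) _.
  move=> /(_ _)/trivIsetP H; apply/trivIsetP => i j _ _ ij.
  apply/seteqP; split => // z [[_ zi] [_ zj]].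
  suff : ([set z | beta / 2 ^+ i.+1 <= `|dot b z| < beta / 2 ^+ i] `&`
     [set z | beta / 2 ^+ j.+1 <= `|dot b z| < beta / 2 ^+ j]) z.
    by rewrite H// => k l kl; right; rewrite ler_pM2l// lef_pV2 ?posrE
      ?exprn_gt0// ler_eXn2l// ltr1n.
  by split.
- exact: measurable_funTS.
- by move=> z _; rewrite lee_fin powR_ge0.
- exact: l01.
move=> k.
have bk0 : 0 < beta / 2 ^+ k by rewrite divr_gt0 ?exprn_gt0.
have bk1 : 0 < beta / 2 ^+ k.+1 by rewrite divr_gt0 ?exprn_gt0.
have -> : (beta / 2) `^ (p - 2) * (4 * r) ^+ n * 2 * (2^-1 `^ (p - 1)) ^+ k =
   (beta / 2 ^+ k.+1) `^ (p - 2) *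
   ((4 * r) ^+ n * (2 * (beta / 2 ^+ k)) / (r * enorm b)).
  have -> : beta / 2 ^+ k.+1 = beta / 2 / 2 ^+ k by rewrite exprS invfM mulrA.
  rewrite powR_halves ?divr_ge0 ?(ltW beta0)//.
  have -> : 2^-1 `^ (p - 1) = 2^-1 * 2^-1 `^ (p - 2) :> R.
    by rewrite -[X in X * _]powRr1 ?invr_ge0// -powRD; [congr (_ `^ _); ring|apply/implyP].
  rewrite [(_ * _) ^+ k]exprMn [_^-1 ^+ k]exprVn /beta.
  by field; rewrite !gt_eqF ?exprn_gt0 ?nb0.
apply: integral_le_cst.
- exact: mA.
- exact: measurable_funTS.
- by move=> z _; rewrite lee_fin powR_ge0.
- move=> z [_ /= /andP[h1 h2]]; rewrite lee_fin.
  have -> : p - 2 = - (2 - p) by ring.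
  rewrite !powRN lef_pV2 ?posrE ?powR_gt0//; last by apply: lt_le_trans h1.
  by apply: ge0_ler_powR => //; rewrite ?nnegrE ?(ltW bk1)//; lra.
- exact: powR_ge0.
apply: le_trans (lebesgue_slab b (beta / 2 ^+ k) r b0 bk0 r0).
by apply: le_outer_measure => z [/= zr /andP[_ ?]]; split.
Qed.

Section affine_plus_quadratic.
Variables (p t C : R) (b : 'rV[R]_n).
Hypotheses (p_gt1 : 1 < p) (t_ge0 : 0 <= t) (C_ge0 : 0 <= C) (b_neq0 : b != 0).
Local Notation J := (signed_pow p).

(** The kernel of the increment b.z + C |z|^2 added to its reflection; [t] stands for p s. *)
Let G z := (J (dot b z + C * dot z z) - J (dot b z - C * dot z z))
             / enorm z `^ (n%:R + t).

Lemma measurable_sym_kernel : measurable_fun [set: LT] (G : LT -> R).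
Proof.
have mJ := measurable_signed_pow p.
have mC : measurable_fun [set: LT] (fun z : LT => C * dot z z).
  exact: (measurable_funM (measurable_cst C) measurable_dotxx).
apply: measurable_funM.
  apply: measurable_funB; apply: (measurableT_comp mJ).
    exact: (measurable_funD (measurable_dot b) mC).
  exact: (measurable_funB (measurable_dot b) mC).
rewrite (_ : (fun z => _) = (fun z : LT => enorm z `^ (- (n%:R + t)))).
  exact: measurable_enorm_powR.
by apply/funext => z; rewrite powRN.
Qed.

Lemma sym_kernel_ge0 z : 0 <= G z.
Proof.
by rewrite divr_ge0 ?powR_ge0// signed_pow_sym_ge0// mulr_ge0// dotxx_ge0.
Qed.

Let annulusE r z : 0 < r -> annulus (r / 2) r z ->
  [/\ 0 < enorm z, dot z z <= r ^+ 2 &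
      (enorm z `^ (n%:R + t))^-1 <= ((r / 2) `^ (n%:R + t))^-1].
Proof.
move=> r0 /andP[h1 h2]; have r20 : 0 < r / 2 by rewrite divr_gt0.
have z0 : 0 < enorm z by apply: lt_le_trans h1.
split => //.
  by rewrite -enorm_sqr ler_pXn2r ?nnegrE ?enorm_ge0 ?(ltW r0)// ltW.
rewrite lef_pV2 ?posrE ?powR_gt0//; apply: ge0_ler_powR; rewrite ?nnegrE ?enorm_ge0 ?(ltW r20)//.
by rewrite addr_ge0.
Qed.

(** Count of exponents common to both ranges of p: 2 from the quadratic part, p - 2 from the
    derivative of [J], -(n + t) from the kernel and n from the volume. *)
Let scaling r : 0 < r ->
  r ^+ 2 * r `^ (p - 2) * ((r / 2) `^ (n%:R + t))^-1 * r ^+ n =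
  2 `^ (n%:R + t) * r `^ (p - t).
Proof.
move=> r0; have r_neq0 : r != 0 by rewrite gt_eqF.
rewrite powRM ?(ltW r0) ?invr_ge0// -[2^-1]powR_inv1// -powRrM mulN1r powRN.
rewrite -!powR_mulrn ?(ltW r0)//.
have E : r `^ (p - t) * r `^ (n%:R + t) = r `^ 2%:R * r `^ (p - 2) * r `^ n%:R.
  by rewrite -!powRD ?r_neq0 ?implybT//; congr (_ `^ _); ring.
transitivity (2 `^ (n%:R + t) *
    (r `^ 2%:R * r `^ (p - 2) * r `^ n%:R) / r `^ (n%:R + t)).
  by field; rewrite !gt_eqF ?powR_gt0.
by rewrite -E; field; rewrite gt_eqF ?powR_gt0.
Qed.

(* For p < 2 the symmetrized kernel is only controlled by [|b.z|^(p - 2)], which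
   is singular on the hyperplane b.z = 0 but integrable by the slab estimate. *)
Lemma sym_kernel_annulus : exists2 c, 0 <= c & forall r, 0 < r <= 1 ->
  (\int[mu]_(z in annulus (r / 2) r) (G z)%:E <= (c * r `^ (p - t))%:E)%E.
Proof.
have p1 := p_gt1; have nb0 : 0 < enorm b by rewrite enorm_gt0.
have mG : measurable_fun [set: LT] (fun z : LT => (G z)%:E).
  by apply/measurable_EFinP; exact: measurable_sym_kernel.
have G0 z : (0 <= (G z)%:E)%E by rewrite lee_fin sym_kernel_ge0.
have [p2|p2] := leP 2 p.
  have [c0 c0_ge0 Hc0] := signed_pow_sym_degenerate p p_gt1 p2.
  pose c := c0 * C * (enorm b + C) `^ (p - 2) * 2 `^ (n%:R + t) * 2 ^+ n.
  exists c; first by rewrite /c !mulr_ge0 ?powR_ge0.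
  move=> r /andP[r0 r1].
  pose M := c0 * (C * r ^+ 2) * ((enorm b + C) * r) `^ (p - 2) *
    ((r / 2) `^ (n%:R + t))^-1.
  have -> : c * r `^ (p - t) = M * (2 * r) ^+ n.
    rewrite /c /M [(_ * r) `^ _]powRM ?addr_ge0 ?(ltW nb0) ?(ltW r0)// exprMn.
    transitivity (c0 * C * (enorm b + C) `^ (p - 2) * 2 ^+ n *
      (2 `^ (n%:R + t) * r `^ (p - t))); first by ring.
    by rewrite -(scaling r r0); ring.
  apply: integral_le_cst.
  - exact: measurable_annulus.
  - exact: measurable_funTS.
  - by move=> z _; exact: G0.
  - move=> z zr; have [z0 z2 zv] := annulusE r z r0 zr.
    have m0 : 0 <= C * dot z z by rewrite mulr_ge0 ?dotxx_ge0.
    rewrite lee_fin /G /M ler_pM ?powR_ge0 ?invr_ge0 ?powR_ge0 ?signed_pow_sym_ge0//.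
    apply: (le_trans (Hc0 _ _ m0)).
    rewrite ler_pM ?mulr_ge0 ?powR_ge0 ?dotxx_ge0//.
      by rewrite ler_wpM2l// ler_wpM2l.
    apply: ge0_ler_powR; [by lra|by rewrite nnegrE addr_ge0| |].
      by rewrite nnegrE !mulr_ge0 ?addr_ge0 ?(ltW nb0) ?(ltW r0).
    case/andP: zr => _ zr.
    have := dot_le b z; have : enorm b * enorm z <= enorm b * r.
      by rewrite ler_wpM2l ?(ltW nb0)// ltW.
    have : C * dot z z <= C * r ^+ 2 by rewrite ler_wpM2l.
    (* The restriction r <= 1 absorbs the quadratic part, so that |b.z| + C |z|^2 <= (|b| + C) r. *)
    have : C * r ^+ 2 <= C * r by rewrite ler_wpM2l// expr2 ger_pMr.
    lra.
  - by rewrite /M !mulr_ge0 ?invr_ge0 ?powR_ge0 ?exprn_ge0 ?(ltW r0).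
  - by apply: lebesgue_annulus; rewrite ltW.
have [c0 c0_ge0 Hc0] := integral_dot_powR b p b_neq0 (introT andP (conj p_gt1 p2)).
pose c := 5 * C * c0 * 2 `^ (n%:R + t).
exists c; first by rewrite /c !mulr_ge0 ?powR_ge0.
move=> r /andP[r0 r1].
(* The pointwise bound for p < 2 needs b.z <> 0, so the part of the hyperplane in the ball is
   discarded as a null set. *)
pose N : set LT := [set z | enorm z < r /\ dot b z = 0].
pose S : set LT := [set z | enorm z < r /\ dot b z != 0].
have mN : measurable N.
  rewrite (_ : N = (eball 0 r : set LT) `&` ([set: LT] `&` (dot b) @^-1` [set 0])).
    by apply: measurableI; [exact: measurable_eball|exact: measurable_dot].
  by apply/seteqP; split => z; rewrite /N /eball /= subr0 => -[? h]; split => //; case: h.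
have mS : measurable S.
  rewrite (_ : S = (eball 0 r : set LT) `\` N); first by apply: measurableD; [exact: measurable_eball|].
  apply/seteqP; split => z; rewrite /N /S /eball /= subr0.
    by move=> [h /eqP ?]; split => // -[].
  by move=> [h H]; split => //; apply/eqP => ?; apply: H.
pose M := 5 * (C * r ^+ 2) * ((r / 2) `^ (n%:R + t))^-1.
have M0 : 0 <= M by rewrite /M !mulr_ge0 ?invr_ge0 ?powR_ge0 ?exprn_ge0 ?(ltW r0).
have mann : measurable (annulus (r / 2) r : set LT) by exact: measurable_annulus.
have md : measurable_fun [set: LT] (fun z : LT => (`|dot b z| `^ (p - 2))%:E).
  apply/measurable_EFinP; apply: (measurableT_comp (measurable_powR (p - 2))).
  exact: (measurableT_comp (@normr_measurable R setT) (measurable_dot b)).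
have N0 : mu N = 0%E by exact: lebesgue_hyperplane.
rewrite (ge0_negligible_integral mN mann (measurable_funTS mG) (fun z _ => G0 z) N0).
have mD : measurable (annulus (r / 2) r `\` N : set LT) by exact: measurableD.
have d0 z : (0 <= (`|dot b z| `^ (p - 2))%:E)%E by rewrite lee_fin powR_ge0.
apply: (@le_trans _ _ (\int[mu]_(z in annulus (r / 2) r `\` N)
   (M%:E * (`|dot b z| `^ (p - 2))%:E))%E).
  apply: ge0_le_integral.
  - exact: mD.
  - by move=> z _; exact: G0.
  - exact: measurable_funTS.
  - by apply: measurable_funTS; exact: measurable_funeM.
  - move=> z [zr zN]; have [z0 z2 zv] := annulusE r z r0 zr.
    have m0 : 0 <= C * dot z z by rewrite mulr_ge0 ?dotxx_ge0.
    have bz : dot b z != 0.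
      by apply/eqP => bz; apply: zN; split => //; case/andP: zr.
    rewrite -EFinM lee_fin /G /M [leRHS]mulrAC.
    apply: ler_pM => //; rewrite ?invr_ge0 ?powR_ge0 ?signed_pow_sym_ge0//.
    apply: (le_trans (signed_pow_sym_singular p p_gt1 _ _ p2 bz m0)).
    by rewrite ler_wpM2r ?powR_ge0// ler_wpM2l// ler_wpM2l.
rewrite (ge0_integralZl mu mD (measurable_funTS md) (fun z _ => d0 z)); last first.
  by rewrite lee_fin.
have -> : c * r `^ (p - t) = M * (c0 * r ^+ n * r `^ (p - 2)).
  transitivity (5 * C * c0 * (2 `^ (n%:R + t) * r `^ (p - t))).
    by rewrite /c; ring.
  by rewrite -(scaling r r0) /M; ring.
rewrite [leRHS]EFinM; apply: lee_wpmul2l; first by rewrite lee_fin.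
apply: le_trans (Hc0 r r0).
apply: ge0_subset_integral.
- exact: mD.
- exact: mS.
- exact: measurable_funTS.
- by move=> z _; exact: d0.
move=> z [/andP[_ zr] zN]; split => //.
by apply/eqP => bz; apply: zN.
Qed.

End affine_plus_quadratic.
End singular_kernel.

(** * Principal value near the contact point, and the tail *)

Section principal_value.
Context {R : realType} {n : nat}.
Variables p s : R.
Hypotheses (p_gt1 : 1 < p) (s_gt0 : 0 < s).
Local Notation mu := (@lebesgue_rV R n).
Local Notation LT := (lebesgueType R n).
Local Notation J := (signed_pow p).
Local Notation v := (n%:R + p * s).
Local Notation k := (fun z : 'rV[R]_n => enorm z `^ v).
Implicit Types (x y z : 'rV[R]_n).

Let v_ge0 : 0 <= v.
Proof. by rewrite addr_ge0// mulr_ge0 ?(ltW s_gt0)// (le_trans ler01)// ltW. Qed.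

Lemma measurable_div_kernel (f : LT -> R) : measurable_fun [set: LT] f ->
  measurable_fun [set: LT] (fun z : LT => (f z / k z)%:E).
Proof.
move=> mf; apply/measurable_EFinP; apply: (measurable_funM mf).
rewrite (_ : (fun z => _) = (fun z : LT => enorm z `^ (- v))).
  exact: measurable_enorm_powR.
by apply/funext => z; rewrite powRN.
Qed.

Lemma integrable_annulus (f : LT -> R) (e r M : R) :
  measurable_fun [set: LT] f -> 0 < e -> 0 <= r ->
  (forall z, enorm z < r -> `|f z| <= M) ->
  mu.-integrable (annulus e r) (fun z => (f z / k z)%:E).
Proof.
move=> mf e0 r0 fM; have mfk := measurable_div_kernel f mf.
apply/integrableP; split; first exact: measurable_funTS.
apply: (@le_lt_trans _ _ (`|M| / e `^ v * (2 * r) ^+ n)%:E); last exact: ltry.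
apply: integral_le_cst.
- exact: measurable_annulus.
- exact: (measurableT_comp (@abse_measurable R setT) (measurable_funTS mfk)).
- by move=> z _; exact: abse_ge0.
- move=> z /andP[ez zr]; rewrite abse_EFin lee_fin normrM normfV.
  have ez0 : 0 < enorm z := lt_le_trans e0 ez.
  apply: ler_pM => //; first exact: le_trans (fM z zr) (ler_norm M).
  rewrite ger0_norm ?powR_ge0// lef_pV2 ?posrE ?powR_gt0//.
  by apply: ge0_ler_powR; rewrite ?nnegrE ?enorm_ge0 ?(ltW e0).
- by rewrite divr_ge0 ?powR_ge0.
- exact: lebesgue_annulus.
Qed.

Lemma integral_annulus_reflect (f : LT -> \bar R) (e r : R) :
  measurable_fun [set: LT] f ->
  (\int[mu]_(z in annulus e r) f (- (z : 'rV[R]_n))%R =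
   \int[mu]_(z in annulus e r) f z)%E.
Proof.
move=> mf.
rewrite (integral_affine 0 (-1) (annulus e r) f); [|by right|exact: measurable_annulus|exact: measurable_funTS].
rewrite (_ : _ @^-1` _ = annulus e r).
  by apply: eq_integral => z _; rewrite add0r scaleN1r.
by apply/seteqP; split => z; rewrite /annulus/= add0r scaleN1r enormN.
Qed.

Lemma measurable_reflect (f : LT -> R) : measurable_fun [set: LT] f ->
  measurable_fun [set: LT] ((fun z : 'rV[R]_n => f (- z)) : LT -> R).
Proof.
move=> mf; rewrite (_ : (fun z => _) = (fun z : 'rV[R]_n => f (0 + (-1) *: z))).
  exact: (measurable_fun_affine _ _ f 0 (-1) (or_intror erefl) mf).
by apply/funext => z; rewrite add0r scaleN1r.
Qed.

Section odd_cancellation.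
Variables (f : LT -> R) (r M B : R).
Hypotheses (mf : measurable_fun [set: LT] f) (r_gt0 : 0 < r)
  (f_bnd : forall z : 'rV[R]_n, enorm z < r -> `|f z| <= M)
  (f_sym : forall z : 'rV[R]_n, 0 <= f z + f (- z))
  (f_int : (\int[mu]_(z in [set z : LT | (0 < enorm z < r)%R])
     ((f z + f (- (z : 'rV[R]_n))) / k z)%:E <= (2 * B)%:E)%E).

Let g (z : LT) : \bar R := ((f z + f (- (z : 'rV[R]_n))) / k z)%:E.

Let mg : measurable_fun [set: LT] g.
Proof.
apply: measurable_div_kernel.
exact: (measurable_funD mf (measurable_reflect f mf)).
Qed.

Let g0 z : (0 <= g z)%E.
Proof. by rewrite lee_fin divr_ge0// powR_ge0. Qed.

(** Away from the origin f / k is integrable, so the integral of the symmetrization splits; its two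
    halves agree by reflection. *)
Let half_sym e : 0 < e ->
  (\int[mu]_(z in annulus e r) (f z / k z)%:E =
   (2^-1)%:E * \int[mu]_(z in annulus e r) g z)%E.
Proof.
move=> e0; have r0 := ltW r_gt0.
have if1 := integrable_annulus f e r M mf e0 r0 f_bnd.
have if2 : mu.-integrable (annulus e r)
    (fun z : LT => (f (- (z : 'rV[R]_n)) / k z)%:E).
  apply: (integrable_annulus _ e r M (measurable_reflect f mf) e0 r0).
  by move=> z zr; apply: f_bnd; rewrite enormN.
have -> : (\int[mu]_(z in annulus e r) g z =
   \int[mu]_(z in annulus e r) (f z / k z)%:E +
   \int[mu]_(z in annulus e r) (f (- (z : 'rV[R]_n)) / k z)%:E)%E.
  rewrite -integralD//; last exact: measurable_annulus.
  by apply: eq_integral => z _; rewrite /g mulrDl EFinD.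
have -> : (\int[mu]_(z in annulus e r) (f (- (z : 'rV[R]_n)) / k z)%:E =
   \int[mu]_(z in annulus e r) (f z / k z)%:E)%E.
  rewrite -[RHS]integral_annulus_reflect; last exact: measurable_div_kernel.
  by apply: eq_integral => z _; rewrite enormN.
have fin := integrable_fin_num (measurable_annulus e r) if1.
rewrite -(fineK fin) -EFinD -EFinM; congr EFin; by field.
Qed.

(** The symmetrized integrand is nonnegative, so the annulus integrals increase as e decreases to 0:
    the limit exists as a supremum, bounded by [f_int], even where f / k is not absolutely
    integrable at the origin. *)
Lemma odd_cancellation : exists2 P : R, 0 <= P <= B &
  (\int[mu]_(z in annulus e r) (f z / k z)%:E)%E @[e --> 0^'+] --> P%:E.
Proof.
pose h e : \bar R := (2^-1%:E * \int[mu]_(z in annulus e r) g z)%E.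
have h0 e : (0 <= h e)%E.
  by rewrite mule_ge0 ?lee_fin ?invr_ge0// integral_ge0// => z _; exact: g0.
have hB e : 0 < e -> (h e <= B%:E)%E.
  move=> e0; have -> : B = 2^-1 * (2 * B) by field.
  rewrite /h EFinM lee_wpmul2l ?lee_fin ?invr_ge0//.
  apply: le_trans f_int; apply: ge0_subset_integral.
  - exact: measurable_annulus.
  - rewrite (_ : [set _ | _] = [set: LT] `&` (@enorm R n) @^-1` `]0, r[%classic).
      exact: measurable_enorm.
    by apply/seteqP; split => z; rewrite /= in_itv/= => //; case.
  - exact: measurable_funTS.
  - by move=> z _; exact: g0.
  - by move=> z /andP[ez zr]; rewrite /= zr andbT (lt_le_trans e0).
have hcvg : h e @[e --> 0^'+] --> ereal_sup (h @` `]0, r[%classic).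
  apply: (nonincreasing_at_right_cvge (BLeft r)); first by rewrite bnd_simp.
  move=> a b; rewrite !in_itv /= => /andP[a0 ar] /andP[b0 br] ab.
  rewrite /h lee_wpmul2l ?lee_fin ?invr_ge0//.
  apply: ge0_subset_integral.
  - exact: measurable_annulus.
  - exact: measurable_annulus.
  - exact: measurable_funTS.
  - by move=> z _; exact: g0.
  - by move=> z /andP[ez zr]; rewrite /annulus /= zr andbT (le_trans ab).
have supB : (ereal_sup (h @` `]0%R, r[%classic) <= B%:E)%E.
  apply: ge_ereal_sup => _ [e /= + <-]; rewrite in_itv/= => /andP[e0 _].
  exact: hB.
have sup0 : (0 <= ereal_sup (h @` `]0%R, r[%classic))%E.
  apply: le_trans (h0 (r / 2)) _; apply: ereal_sup_ubound.
  exists (r / 2) => //=; rewrite in_itv/= divr_gt0//=.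
  by rewrite ltr_pdivrMr// ltr_pMr// ltr1n.
have supfin : ereal_sup (h @` `]0%R, r[%classic) \is a fin_num.
  by rewrite ge0_fin_numE// (le_lt_trans supB)// ltry.
exists (fine (ereal_sup (h @` `]0%R, r[%classic))).
  by rewrite -!lee_fin fineK// sup0.
rewrite fineK//; apply: cvg_trans hcvg.
apply: near_eq_cvg; near=> e.
by rewrite /h half_sym.
Unshelve. all: by end_near. Qed.

End odd_cancellation.

Lemma tail_integrable (u : 'rV[R]_n -> R) x (r : R) :
  tail_space p s u -> 0 < r ->
  mu.-integrable (~` eball 0 r) (fun z : LT =>
    (J (u x - u (x + (z : 'rV[R]_n))) / k z)%:E).
Proof.
move=> [mu_ u_tail] r0.
have ps0 : 0 < p * s by rewrite mulr_gt0// (lt_trans ltr01).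
have mD : measurable (~` eball 0 r : set LT).
  by apply: measurableC; exact: measurable_eball.
have mux : measurable_fun [set: LT] ((fun z : 'rV[R]_n => u (x + z)) : LT -> R).
  exact: (measurable_fun_shift _ _ (u : LT -> R) x mu_).
have mF : measurable_fun [set: LT] (fun z : LT =>
    (J (u x - u (x + (z : 'rV[R]_n))) / k z)%:E).
  apply: (measurable_div_kernel (fun z : LT => J (u x - u (x + (z : 'rV[R]_n))))).
  apply: (measurableT_comp (measurable_signed_pow p)).
  exact: (measurable_funB (measurable_cst (u x)) mux).
pose c := 2 `^ (p - 1); pose a := `|u x| `^ (p - 1).
(* Chosen so that 1 + |x + z|^v <= C |z|^v for |z| >= r: the first summand absorbs 1, the second
   uses |x + z| <= (|x| / r + 1) |z|. This compares the kernel with the weight of the tail space. *)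
pose C := (r `^ v)^-1 + (enorm x / r + 1) `^ v.
have c0 : 0 <= c by exact: powR_ge0.
have C0 : 0 <= C by rewrite addr_ge0 ?invr_ge0 ?powR_ge0.
pose F1 (z : LT) : \bar R := ((k z)^-1)%:E.
pose F2 (y : LT) : \bar R := (`|u y| `^ (p - 1) / (1 + k y))%:E.
have F10 z : (0 <= F1 z)%E by rewrite lee_fin invr_ge0 powR_ge0.
have F20 z : (0 <= F2 z)%E.
  by rewrite lee_fin divr_ge0 ?powR_ge0// addr_ge0 ?powR_ge0.
have mF1 : measurable_fun [set: LT] F1.
  rewrite (_ : F1 = (fun z => (cst 1 z / k z)%:E)); first exact: measurable_div_kernel.
  by apply/funext => z; rewrite /F1 /cst mul1r.
have mk : measurable_fun [set: LT] (fun y : LT => (1 + k y)^-1).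
  rewrite (_ : (fun y : LT => _) = (fun y : LT => (1 + k y) `^ (-1))).
    apply: (measurableT_comp (measurable_powR (-1))).
    apply: (measurable_funD _ (measurable_enorm_powR v)).
    exact: (@measurable_cst _ _ LT R setT 1).
  by apply/funext => y; rewrite powR_inv1// addr_ge0 ?powR_ge0.
have mF2 : measurable_fun [set: LT] F2.
  apply/measurable_EFinP; apply: (measurable_funM _ mk).
  apply: (measurableT_comp (measurable_powR (p - 1))).
  exact: (measurableT_comp (@normr_measurable R setT) mu_).
have mF2x : measurable_fun [set: LT] (fun z : LT => F2 (x + 1 *: (z : 'rV[R]_n))).
  exact: (measurable_fun_affine _ _ F2 x 1 (or_introl erefl) mF2).
have I1 : mu.-integrable (~` eball 0 r) F1.
  apply/integrableP; split; first exact: measurable_funTS.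
  have [K HK] := @integral_tail R n (p * s) r ps0 r0.
  rewrite (eq_integral F1) => [|z _]; last exact: gee0_abs.
  by apply: le_lt_trans HK _; exact: ltry.
have I2 : mu.-integrable (~` eball 0 r) (fun z : LT => F2 (x + 1 *: (z : 'rV[R]_n))%R).
  apply/integrableP; split; first exact: measurable_funTS.
  rewrite (eq_integral (fun z : LT => F2 (x + 1 *: (z : 'rV[R]_n))%R)) => [|z _]; last exact: gee0_abs.
  apply: le_lt_trans u_tail.
  rewrite (ge0_integral_affine x 1 setT F2 (or_introl erefl) measurableT mF2 (fun y _ => F20 y)).
  apply: ge0_subset_integral.
  - exact: mD.
  - exact: measurableT.
  - exact: mF2x.
  - by move=> z _; exact: F20.
  - by [].
apply: (le_integrable mD (measurable_funTS mF) _
  (integrableD mD (integrableZl mD (c * a) I1) (integrableZl mD (c * C) I2))).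
move=> z; rewrite /eball /= subr0 => /negP; rewrite -leNgt => rz.
have z0 : 0 < enorm z := lt_le_trans r0 rz.
have kz0 : 0 < k z by rewrite powR_gt0.
rewrite lee_fin [leRHS]ger0_norm; last first.
  apply: addr_ge0; first by rewrite divr_ge0 ?mulr_ge0// powR_ge0.
  apply: mulr_ge0; first exact: mulr_ge0.
  by rewrite divr_ge0 ?powR_ge0// addr_ge0 ?powR_ge0.
rewrite scale1r normrM normfV (ger0_norm (ltW kz0)).
rewrite ler_pdivrMr// mulrDl mulfVK ?gt_eqF//.
apply: le_trans (normr_signed_powB p p_gt1 _ _) _.
set U := `|u (x + z)| `^ (p - 1).
have U0 : 0 <= U by exact: powR_ge0.
have key : 1 + k (x + z) <= C * k z.
  rewrite /C mulrDl; apply: lerD.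
    rewrite mulrC ler_pdivlMr ?powR_gt0// mul1r.
    by apply: ge0_ler_powR; rewrite ?nnegrE ?enorm_ge0 ?(ltW r0).
  rewrite -powRM ?addr_ge0 ?divr_ge0 ?enorm_ge0 ?(ltW r0)//.
  apply: ge0_ler_powR; [exact: v_ge0|by rewrite nnegrE enorm_ge0| |].
    by rewrite nnegrE mulr_ge0 ?addr_ge0 ?divr_ge0 ?enorm_ge0 ?(ltW r0).
  apply: le_trans (enormD x z) _; rewrite mulrDl mul1r lerD2r.
  by rewrite mulrAC ler_pdivlMr// ler_wpM2l ?enorm_ge0.
have k1 : 0 < 1 + k (x + z) by rewrite ltr_wpDr ?powR_ge0.
have -> : c * C * (U / (1 + k (x + z))) * k z =
    c * (U * (C * k z / (1 + k (x + z)))) by ring.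
rewrite mulrDr lerD2l ler_wpM2l// ler_peMr//.
by rewrite (ler_pdivlMr _ _ k1) mul1r; exact: key.
Qed.

(** Separates the operator on the patched function into the principal value of an explicit [f] over
    the ball and a tail that involves only [u]. *)
Lemma frac_plapE (u phi f : 'rV[R]_n -> R) x (r M P : R) :
  tail_space p s u -> 0 < r -> phi x = u x ->
  measurable_fun [set: LT] (f : LT -> R) ->
  (forall z, enorm z < r -> `|f z| <= M) ->
  (forall z, enorm z < r -> J (phi x - phi (x + z)) = f z) ->
  (\int[mu]_(z in annulus e r) (f z / k z)%:E)%E @[e --> 0^'+] --> P%:E ->
  (frac_plap p s (patch u (eball x r) phi) x =
   2%:E * (P%:E + \int[mu]_(z in ~` eball 0 r)
     (J (u x - u (x + (z : 'rV[R]_n))) / k z)%:E))%E.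
Proof.
move=> ut r0 phix mf fM fE fP; have [mu_ _] := ut.
have Tint := tail_integrable u x r ut r0.
pose w := patch u (eball x r) phi.
pose G (z : LT) : \bar R := ((if (enorm z < r)%R then f z else J (u x - u (x + z))) / k z)%:E.
have mG : measurable_fun [set: LT] G.
  apply: measurable_div_kernel.
  have mux := measurable_fun_shift _ _ (u : LT -> R) x mu_.
  have mJ := measurableT_comp (measurable_signed_pow p)
    (measurable_funB (measurable_cst (u x)) mux).
  exact: (measurable_fun_ifT
    (measurable_fun_ltr measurable_enorm (measurable_cst r)) mf mJ).
have shiftE e : (\int[mu]_(y in ~` eball x e) (J (w x - w y) / enorm (x - y) `^ v)%:E
   = \int[mu]_(z in ~` eball 0 e) G z)%E.
  rewrite (integral_affine (- x) 1 (~` eball 0 e) G (or_introl erefl)); last 2 first.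
  - by apply: measurableC; exact: measurable_eball.
  - exact: measurable_funTS.
  have -> : (fun z : 'rV[R]_n => - x + 1 *: z) @^-1` (~` eball 0 e) = ~` eball x e.
    by rewrite (eball_shiftN x e).
  apply: eq_integral => y _.
  have -> : - x + 1 *: (y : 'rV[R]_n) = (y : 'rV[R]_n) - x by rewrite scale1r addrC.
  have E : x + ((y : 'rV[R]_n) - x) = y by rewrite addrC subrK.
  rewrite /G E enormB; congr (_ / _)%:E.
  rewrite /w /patch [in LHS]mem_set; last by rewrite /eball /= subrr enorm0.
  case: ifPn => yr.
    have yr' : enorm ((y : 'rV[R]_n) - x) < r by rewrite inE in yr.
    by rewrite yr' -fE// E.
  have -> : (enorm ((y : 'rV[R]_n) - x) < r) = false.
    by apply: contraNF yr => yr; rewrite inE.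
  by rewrite phix.
have splitE e : 0 < e < r -> (\int[mu]_(z in ~` eball 0 e) G z =
   \int[mu]_(z in annulus e r) (f z / k z)%:E +
   \int[mu]_(z in ~` eball 0 r) (J (u x - u (x + (z : 'rV[R]_n))) / k z)%:E)%E.
  move=> /andP[e0 er].
  have -> : ~` eball 0 e = annulus e r `|` ~` eball 0 r :> set LT.
    apply/seteqP; split => z; rewrite /annulus /eball /= subr0.
      move=> /negP; rewrite -leNgt => ez.
      by have [rz|zr] := leP r (enorm z); [right; exact/negP|left; rewrite ez].
    move=> [/andP[ez _]|/negP]; first by apply/negP; rewrite -leNgt.
    rewrite -leNgt => rz; apply/negP; rewrite -leNgt.
    by rewrite (le_trans _ rz)// ltW.
  rewrite integral_setU; last 4 first.
  - exact: measurable_annulus.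
  - by apply: measurableC; exact: measurable_eball.
  - exact: measurable_funTS.
  - apply/disj_setPS => z [/andP[_ zr]]; rewrite /eball /= subr0 => /negP.
    by rewrite zr.
  congr (_ + _)%E; apply: eq_integral => z; rewrite inE.
    by move=> /andP[_ zr]; rewrite /G zr.
  by rewrite /eball /= subr0 => /negP/negbTE zr; rewrite /G zr.
rewrite /frac_plap; congr (_ * _)%E; apply: cvg_lim => //.
have Tfin := integrable_fin_num (measurableC (measurable_eball 0 r)) Tint.
set T := (X in (_ + X)%E).
have h : ((\int[mu]_(z in annulus e r) (f z / k z)%:E + T)%E @[e --> 0^'+]
    --> P%:E + T)%E.
  by apply: cvgeD; [rewrite fin_num_adde_defl|exact: fP|exact: cvg_cst].
apply: cvg_trans h.
apply: near_eq_cvg; near=> e.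
rewrite -/w shiftE splitE//.
by apply/andP; split; near: e; [exact: nbhs_right_gt|exact: nbhs_right_lt].
Unshelve. all: by end_near. Qed.

End principal_value.

(** * Polynomial test functions *)

Section polynomial_functions.
Context {R : realType} {n : nat}.
Local Notation V := 'rV[R]_n.
Implicit Types (x y z b : V) (i j : 'I_n).

Lemma is_derive_coord x v j : is_derive x v (fun y : V => y 0 j : R) (v 0 j).
Proof.
have H : (fun h => h^-1 *: (((fun y : V => y 0 j : R) \o shift x) (h *: v) - x 0 j))
    @ (0 : R)^' --> v 0 j.
  apply: (@cvg_trans _ ((fun=> v 0 j) @ (0 : R)^')); last exact: cvg_cst.
  apply: near_eq_cvg; near=> h => /=.
  have h0 : h != 0 by near: h; exact: nbhs_dnbhs_neq.
  by rewrite !mxE addrK /GRing.scale /= mulKf.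
by apply: DeriveDef; [apply/cvg_ex; exists (v 0 j)|exact: cvg_lim].
Unshelve. all: by end_near. Qed.

(* Polynomial functions, for which [Ck k] holds for all k because they are stable
   under partial derivatives. *)
Inductive polyfun : (V -> R) -> Prop :=
| polyfun_cst c : polyfun (cst c)
| polyfun_coord i : polyfun (fun y => y 0 i)
| polyfunD f g : polyfun f -> polyfun g -> polyfun (f \+ g)
| polyfunM f g : polyfun f -> polyfun g -> polyfun (f \* g).

Lemma polyfun_sum (I : Type) (r : seq I) (F : I -> V -> R) :
  (forall l, polyfun (F l)) -> polyfun (fun y => \sum_(l <- r) F l y).
Proof.
move=> H; elim: r => [|l r ih].
  by rewrite (_ : (fun y => _) = cst 0) //; [exact: polyfun_cst|apply/funext => y; rewrite big_nil].
rewrite (_ : (fun y => _) = F l \+ (fun y => \sum_(l <- r) F l y)).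
  exact: polyfunD.
by apply/funext => y; rewrite big_cons.
Qed.

Lemma polyfunX f k : polyfun f -> polyfun (fun y => f y ^+ k).
Proof.
move=> pf; elim: k => [|k ih].
  rewrite (_ : (fun y => _) = cst 1) //; exact: polyfun_cst.
rewrite (_ : (fun y => _) = f \* (fun y => f y ^+ k)); first exact: polyfunM.
by apply/funext => y; rewrite exprS.
Qed.

Lemma polyfun_continuous f : polyfun f -> continuous f.
Proof.
elim=> [c|i|f1 f2 _ c1 _ c2|f1 f2 _ c1 _ c2] x.
- exact: cst_continuous.
- exact: coord_continuous.
- exact: (cvgD (c1 x) (c2 x)).
- exact: (cvgM (c1 x) (c2 x)).
Qed.

Lemma polyfun_partial f i : polyfun f ->
  (forall x, derivable f x (delta_mx 0 i)) /\ polyfun (partial i f).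
Proof.
elim=> [c|j|f1 f2 p1 [d1 q1] p2 [d2 q2]|f1 f2 p1 [d1 q1] p2 [d2 q2]].
- split=> [x|]; first exact: derivable_cst.
  rewrite (_ : partial i _ = cst 0); first exact: polyfun_cst.
  by apply/funext => x; rewrite /partial derive_cst.
- split=> [x|]; first by have [] := is_derive_coord x (delta_mx 0 i) j.
  rewrite (_ : partial i _ = cst ((delta_mx 0 i : V) 0 j)); first exact: polyfun_cst.
  by apply/funext => x; have [_] := is_derive_coord x (delta_mx 0 i) j.
- split=> [x|]; first exact: derivableD.
  rewrite (_ : partial i _ = partial i f1 \+ partial i f2); first exact: polyfunD.
  by apply/funext => x; rewrite /partial deriveD.
- split=> [x|]; first exact: derivableM.
  rewrite (_ : partial i _ = (f1 \* partial i f2) \+ (f2 \* partial i f1)).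
    by apply: polyfunD; exact: polyfunM.
  by apply/funext => x; rewrite /partial deriveM.
Qed.

Lemma polyfun_Ck f k (D : set V) : polyfun f -> Ck k D f.
Proof.
elim: k f => [|k ih] f pf; split => //; try by move=> x _; exact: polyfun_continuous.
move=> i; have [df pf'] := polyfun_partial f i pf.
by split; [move=> x _; exact: df|exact: ih].
Qed.

Lemma polyfun_dot b : polyfun (dot b).
Proof.
apply: polyfun_sum => i.
by apply: (polyfunM (cst (b 0 i)) (fun y => y 0 i)); [exact: polyfun_cst|exact: polyfun_coord].
Qed.

Lemma polyfun_dotB b x : polyfun (fun y => dot b (y - x)).
Proof.
rewrite (_ : (fun y => _) = dot b \+ cst (- dot b x)).
  by apply: polyfunD; [exact: polyfun_dot|exact: polyfun_cst].
by apply/funext => y; rewrite /= dotDr dotNr.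
Qed.

Lemma polyfun_dotxxB x : polyfun (fun y => dot (y - x) (y - x)).
Proof.
apply: polyfun_sum => i.
have H : polyfun (fun y => (y - x) 0 i).
  rewrite (_ : (fun y => _) = (fun y => y 0 i) \+ cst (- x 0 i)).
    by apply: polyfunD; [exact: polyfun_coord|exact: polyfun_cst].
  by apply/funext => y; rewrite !mxE.
exact: (polyfunM _ _ H H).
Qed.

(** One formula for both kinds of tests: b <> 0 with k = 1, where the gradient at [x] is nonzero,
    and b = 0 with k large, where it vanishes. *)
Definition quasiquadratic (c a : R) b (k : nat) x y :=
  c + dot b (y - x) + a * dot (y - x) (y - x) ^+ k.

Lemma polyfun_quasiquadratic c a b k x : polyfun (quasiquadratic c a b k x).
Proof.
apply: (polyfunD (cst c \+ (fun y => dot b (y - x)))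
  (cst a \* (fun y => dot (y - x) (y - x) ^+ k))).
  by apply: polyfunD; [exact: polyfun_cst|exact: polyfun_dotB].
by apply: polyfunM; [exact: polyfun_cst|apply: polyfunX; exact: polyfun_dotxxB].
Qed.

Lemma is_derive_coordB x y v j :
  is_derive y v (fun y : V => (y - x) 0 j : R) (v 0 j).
Proof.
rewrite (_ : (fun y : V => _) = (fun y : V => y 0 j : R) + cst (- x 0 j)).
  rewrite -[v 0 j]addr0; apply: is_deriveD; exact: is_derive_coord.
by apply/funext => z; rewrite !mxE.
Qed.

Lemma is_derive_dotB b x y v : is_derive y v (fun y => dot b (y - x)) (dot b v).
Proof.
rewrite (_ : (fun y => _) = \sum_(j < n) (b 0 j *: (fun y : V => (y - x) 0 j : R))).
  by apply: is_derive_sum => j; apply: is_deriveZ; exact: is_derive_coordB.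
by apply/funext => z; rewrite fct_sumE.
Qed.

Lemma is_derive_dotxxB x y v :
  is_derive y v (fun y => dot (y - x) (y - x)) (2 * dot (y - x) v).
Proof.
rewrite (_ : (fun y => _) =
  \sum_(j < n) ((fun y : V => (y - x) 0 j : R) * (fun y : V => (y - x) 0 j : R))).
  rewrite (_ : 2 * _ = \sum_(j < n) ((y - x) 0 j *: v 0 j + (y - x) 0 j *: v 0 j)).
    by apply: is_derive_sum => j; apply: is_deriveM; exact: is_derive_coordB.
  by rewrite /dot mulr_sumr; apply: eq_bigr => j _; rewrite /GRing.scale/=; ring.
by apply/funext => z; rewrite fct_sumE.
Qed.

Lemma is_derive_quasiquadratic c a b k x y v :
  is_derive y v (quasiquadratic c a b k x)
    (dot b v + a * (k%:R * dot (y - x) (y - x) ^+ k.-1 * (2 * dot (y - x) v))).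
Proof.
rewrite (_ : quasiquadratic c a b k x = (cst c + (fun y => dot b (y - x))) +
  a *: (fun y => dot (y - x) (y - x)) ^+ k); last first.
  by apply/funext => z; rewrite /quasiquadratic/= exprfctE.
apply: is_deriveD.
  by rewrite -[dot b v]add0r; apply: is_deriveD; exact: is_derive_dotB.
apply: is_deriveZ.
apply: is_derive_eq; first by apply: is_deriveX; exact: is_derive_dotxxB.
by rewrite /GRing.scale/=; ring.
Qed.

Lemma dot_delta z i : dot z (delta_mx 0 i) = z 0 i.
Proof.
rewrite /dot (bigD1 i)//= mxE !eqxx mulr1 big1 ?addr0// => j ji.
by rewrite mxE (negbTE ji) andbF mulr0.
Qed.

Lemma grad_quasiquadratic c a b k x y :
  grad (quasiquadratic c a b k x) y =
  b + (2 * a * k%:R * dot (y - x) (y - x) ^+ k.-1) *: (y - x).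
Proof.
apply/rowP => i; rewrite !mxE /partial.
have [_ ->] := is_derive_quasiquadratic c a b k x y (delta_mx 0 i).
by rewrite !dot_delta !mxE; ring.
Qed.

(** The truncated predecessors are harmless: whenever one of them is truncated, the factor k or k -
    1 in front vanishes. *)
Lemma partial2_radial c a k x y i j :
  partial i (partial j (quasiquadratic c a 0 k x)) y =
  2 * a * k%:R * (k.-1%:R * dot (y - x) (y - x) ^+ k.-2 * (2 * (y - x) 0 i) * (y - x) 0 j
   + dot (y - x) (y - x) ^+ k.-1 * (i == j)%:R).
Proof.
have -> : partial j (quasiquadratic c a 0 k x) =
  (2 * a * k%:R) *: ((fun y => dot (y - x) (y - x)) ^+ k.-1 *
    (fun y : V => (y - x) 0 j : R)).
  apply/funext => z; have := grad_quasiquadratic c a 0 k x z.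
  move=> /rowP/(_ j); rewrite [in LHS]mxE => ->.
  rewrite mxE [in X in X + _]mxE add0r mxE -[LHS]mulrA.
  by rewrite exprfctE.
apply: derive_val; apply: is_derive_eq.
  apply: is_deriveZ; apply: is_deriveM; last exact: is_derive_coordB.
  by apply: is_deriveX; exact: is_derive_dotxxB.
rewrite dot_delta /GRing.scale/= exprfctE [delta_mx _ _ _ _]mxE eqxx/= [j == i]eq_sym.
by ring.
Qed.

Section radial_test.
Variables (c a : R) (k : nat) (x : V) (r : R).
Hypotheses (a_neq0 : a != 0) (k_ge2 : (2 <= k)%N) (r_gt0 : 0 < r).
Let phi := quasiquadratic c a 0 k x.
Let A := 2 * `|a| * k%:R.

Let A_gt0 : 0 < A.
Proof. by rewrite !mulr_gt0 ?normr_gt0// ltr0n (leq_trans _ k_ge2). Qed.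

Let phi_grad y : grad phi y = (2 * a * k%:R * enorm (y - x) ^+ (2 * k.-1)) *: (y - x).
Proof. by rewrite grad_quasiquadratic add0r exprM enorm_sqr. Qed.

Let enorm_grad y : enorm (grad phi y) = A * enorm (y - x) ^+ (2 * k).-1.
Proof.
rewrite phi_grad enormZ !normrM (ger0_norm (x := enorm _ ^+ _)) ?exprn_ge0 ?enorm_ge0//.
rewrite normr_nat normr_nat -[LHS]mulrA -exprSr; congr (_ * _ ^+ _).
by case: k k_ge2 => // m _; rewrite mulnS.
Qed.

Lemma critical_set_radial : critical_set (eball x r) phi = [set x].
Proof.
apply/seteqP; split => y; rewrite /critical_set /=; last first.
  by move=> ->; rewrite /eball /= phi_grad subrr scaler0 enorm0.
move=> [_ /eqP]; rewrite -enorm_eq0 enorm_grad mulf_eq0 gt_eqF//= expf_eq0.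
by rewrite enorm_eq0 subr_eq0 => /andP[_ /eqP].
Qed.

Let dist_set1 y : fine (dist_set y [set x]) = enorm (y - x).
Proof. by rewrite /dist_set image_set1 ereal_inf1. Qed.

Let hessian_le y : hessian_norm phi y <= n%:R * (A * k.*2%:R * enorm (y - x) ^+ (2 * k.-1)).
Proof.
set B := A * _ * _.
have B0 : 0 <= B by rewrite !mulr_ge0 ?(ltW A_gt0) ?exprn_ge0 ?enorm_ge0.
have H i j : `|partial i (partial j phi) y| <= B.
  rewrite partial2_radial normrM.
  have -> : `|2 * a * k%:R| = A by rewrite !normrM !normr_nat.
  have -> : B = A * (k.*2%:R * enorm (y - x) ^+ (2 * k.-1)) by rewrite /B mulrA.
  apply: ler_wpM2l; first exact: ltW.
  rewrite exprM enorm_sqr.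
  set N := dot _ _.
  have N0 : 0 <= N by exact: dotxx_ge0.
  apply: le_trans (ler_normD _ _) _.
  have ij : `|N ^+ k.-1 * (i == j)%:R| <= N ^+ k.-1.
    rewrite normrM ger0_norm ?exprn_ge0// normr_nat ler_piMr ?exprn_ge0//.
    by case: (i == j); rewrite ?lexx ?ler01.
  have zz : `|(y - x) 0 i * (y - x) 0 j| <= N.
    rewrite normrM /N -enorm_sqr expr2.
    by apply: ler_pM => //; exact: coord_le_enorm.
  have kN : N ^+ k.-1 = N ^+ k.-2 * N.
    by rewrite -exprSr; case: k k_ge2 => [|[|m]].
  have : `|k.-1%:R * N ^+ k.-2 * (2 * (y - x) 0 i) * (y - x) 0 j| <=
      2 * k.-1%:R * N ^+ k.-1.
    have -> : k.-1%:R * N ^+ k.-2 * (2 * (y - x) 0 i) * (y - x) 0 j =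
      2 * k.-1%:R * N ^+ k.-2 * ((y - x) 0 i * (y - x) 0 j) by ring.
    have P0 : 0 <= 2 * k.-1%:R * N ^+ k.-2 by rewrite !mulr_ge0 ?exprn_ge0.
    by rewrite normrM (ger0_norm P0) kN [leRHS]mulrA ler_wpM2l.
  move=> H; apply: le_trans (lerD H ij) _.
  have -> : k.*2%:R = 2 * k.-1%:R + 2 :> R.
    by rewrite -muln2 natrM -{1}(prednK (ltnW k_ge2)) -natr1; ring.
  rewrite [leRHS]mulrDl; apply: lerD => //.
  by rewrite ler_peMl ?exprn_ge0// ler1n.
rewrite /hessian_norm -(ger0_norm (mulr_ge0 (ler0n R n) B0)) -sqrtr_sqr.
apply: ler_wsqrtr; rewrite exprMn expr2.
have -> : n%:R * n%:R * B ^+ 2 = \sum_(i < n) \sum_(j < n) B ^+ 2.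
  by rewrite !sumr_const card_ord -mulrnA -[RHS]mulr_natr natrM mulrC.
apply: ler_sum => i _; apply: ler_sum => j _.
by rewrite -real_normK ?num_real// lerXn2r ?nnegrE.
Qed.

Lemma isolated_radial : isolated (critical_set (eball x r) phi) x.
Proof.
rewrite critical_set_radial; split; first by rewrite inE.
by exists setT; [exact: filterT|rewrite setTI].
Qed.

(** With d the distance to the only critical point, the gradient has norm A d^(2k - 1) and the
    Hessian is at most a multiple of d^(2k - 2). For beta = 2k both quotients are therefore bounded
    by constants. *)
Lemma C2beta_radial : C2beta (2 * k)%:R (eball x r) phi.
Proof.
split; first by apply: polyfun_Ck; exact: polyfun_quasiquadratic.
exists (A^-1 + n%:R * (A * k.*2%:R)) => _ [y [_ yN] <-].
rewrite critical_set_radial in yN *.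
rewrite dist_set1; set d := enorm (y - x).
have d0 : 0 < d.
  by rewrite enorm_gt0 subr_eq0; apply/eqP.
have E1 : d `^ ((2 * k)%:R - 1) = d ^+ (2 * k).-1.
  rewrite -powR_mulrn ?(ltW d0)//; congr (_ `^ _).
  by rewrite -{1}(@prednK (2 * k)) ?muln_gt0 ?(ltnW k_ge2)// -natr1 addrK.
have E2 : d `^ ((2 * k)%:R - 2) = d ^+ (2 * k.-1).
  rewrite -powR_mulrn ?(ltW d0)//; congr (_ `^ _).
  by rewrite -{1}(prednK (ltnW k_ge2)) !natrM -natr1; ring.
rewrite E1 E2 enorm_grad -/d; apply: lerD.
  have D0 : 0 < A * d ^+ (2 * k).-1 by rewrite mulr_gt0 ?exprn_gt0.
  rewrite (ler_pdivrMr _ _ D0) mulrA mulVf ?gt_eqF// mul1r.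
  by rewrite ge_min lexx.
rewrite ler_pdivrMr ?exprn_gt0// -mulrA; exact: hessian_le.
Qed.

Lemma admissible_test_radial (p s : R) : 1 < p -> p * s / (p - 1) < (2 * k)%:R ->
  admissible_test p s x r phi.
Proof.
move=> p1 hk.
have [ps|ps] := ltP (2 / (2 - s)) p; first by left; right.
right; split; first by rewrite p1.
- by rewrite phi_grad subrr scaler0.
- exact: isolated_radial.
- exists (2 * k)%:R; split => //; last exact: C2beta_radial.
  by rewrite ler1n muln_gt0 (ltnW k_ge2).
Qed.

End radial_test.

Lemma admissible_test_gradient (p s c a : R) b k x r : b != 0 ->
  admissible_test p s x r (quasiquadratic c a b k x).
Proof.
move=> b0; left; left.
by rewrite grad_quasiquadratic subrr scaler0 addr0.
Qed.

End polynomial_functions.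

(** * Euclidean balls in the topology of the sup norm *)

Section euclidean_topology.
Context {R : realType} {n : nat}.
Implicit Types x y z : 'rV[R]_n.

Lemma enorm_continuous : continuous (@enorm R n).
Proof.
move=> x; rewrite (_ : enorm = Num.sqrt \o (fun z : 'rV[R]_n => dot (z - 0) (z - 0))).
  apply: continuous_comp; last exact: sqrt_continuous.
  exact: (polyfun_continuous _ (polyfun_dotxxB 0)).
by apply/funext => z /=; rewrite subr0 enormE.
Qed.

Lemma enormB_continuous x : continuous (fun y => enorm (y - x)).
Proof.
move=> y; rewrite (_ : (fun y => _) = Num.sqrt \o (fun z : 'rV[R]_n => dot (z - x) (z - x))).
  apply: continuous_comp; last exact: sqrt_continuous.
  exact: (polyfun_continuous _ (polyfun_dotxxB x)).
by apply/funext => z /=; rewrite enormE.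
Qed.

Lemma closure_eball x (r : R) : closure (eball x r) `<=` [set y | enorm (y - x) <= r].
Proof.
have Cc : closed [set y | enorm (y - x) <= r].
  apply: (@preimage_closed _ _ (fun y => enorm (y - x)) [set t | t <= r]).
    by move=> y _; exact: enormB_continuous.
  exact: closed_le.
rewrite [X in _ `<=` X](closure_id _).1//; apply: closureS => y.
by rewrite /eball /= => /ltW.
Qed.

Lemma nbhs_eball x (A : set 'rV[R]_n) : nbhs x A ->
  exists2 r : R, 0 < r & forall y, enorm (y - x) <= r -> A y.
Proof.
move=> /nbhs_ballP[e /= e0 eA]; exists (e / 2); first by rewrite divr_gt0.
move=> y yx; apply: eA; rewrite -ball_normE /ball_ /= distrC.
apply: le_lt_trans (normr_le_enorm _) _; apply: le_lt_trans yx _.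
by rewrite ltr_pdivrMr// ltr_pMr// ltr1n.
Qed.

Lemma open_eball (Omega : set 'rV[R]_n) x : open Omega -> Omega x ->
  exists2 r0 : R, 0 < r0 & forall r, r <= r0 -> closure (eball x r) `<=` Omega.
Proof.
move=> oO Ox; have [r0 r00 H] := nbhs_eball x Omega (open_nbhs_nbhs (conj oO Ox)).
exists r0 => // r rr0 y /closure_eball /= yr; apply: H.
exact: le_trans yr rr0.
Qed.

End euclidean_topology.

(** * Viscosity inequalities for the polynomial tests *)

Section test_inequalities.
Context {R : realType} {n : nat}.
Variables p s : R.
Hypotheses (n_gt0 : (0 < n)%N) (p_gt1 : 1 < p) (s_gt0 : 0 < s) (s_lt1 : s < 1).
Local Notation mu := (@lebesgue_rV R n).
Local Notation LT := (lebesgueType R n).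
Local Notation J := (signed_pow p).
Local Notation v := (n%:R + p * s).
Implicit Types (x y z b : 'rV[R]_n) (a r : R) (k : nat).

Let ps_gt0 : 0 < p * s.
Proof. by rewrite mulr_gt0// (lt_trans ltr01). Qed.

Lemma quasiquadratic_center (c a : R) b k x : (0 < k)%N ->
  quasiquadratic c a b k x x = c.
Proof.
move=> k0; rewrite /quasiquadratic subrr -(scale0r (0 : 'rV[R]_n)) !dotZr !mul0r.
by rewrite expr0n gtn_eqF// mulr0 !addr0.
Qed.

(** Touching from above uses u x + increment b a k z, touching from below u x - increment b a k (-
    z): the linear part b.z is the same in both, as doubling requires. *)
Definition increment b a k z := dot b z + a * dot z z ^+ k.

Lemma measurable_increment b a k : measurable_fun [set: LT] (increment b a k : LT -> R).
Proof.
apply: (measurable_funD (measurable_dot b)).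
exact: (measurable_funM (measurable_cst a) (measurable_funX k measurable_dotxx)).
Qed.

Lemma incrementN b a k z : increment b a k (- z) = - dot b z + a * dot z z ^+ k.
Proof.
have zz : dot (- z) (- z) = dot z z by rewrite dotNr dotC dotNr opprK.
by rewrite /increment zz dotNr.
Qed.

Lemma increment_bounded b a k r z : 0 <= a -> enorm z < r ->
  `|J (increment b a k z)| <= (enorm b * r + a * (r ^+ 2) ^+ k) `^ (p - 1).
Proof.
move=> a0 zr; have p1 := p_gt1; have r0 : 0 <= r.
  by rewrite (le_trans (enorm_ge0 z))// ltW.
have z2 : dot z z <= r ^+ 2 by rewrite -enorm_sqr lerXn2r ?nnegrE ?enorm_ge0// ltW.
have z2k : a * dot z z ^+ k <= a * (r ^+ 2) ^+ k.
  by rewrite ler_wpM2l// lerXn2r ?nnegrE ?dotxx_ge0 ?exprn_ge0.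
rewrite normr_signed_pow//; apply: ge0_ler_powR; rewrite ?nnegrE//; first by lra.
  by rewrite addr_ge0 ?mulr_ge0 ?exprn_ge0 ?enorm_ge0.
apply: le_trans (ler_normD _ _) _; apply: lerD.
  by apply: le_trans (dot_le _ _) _; rewrite ler_wpM2l ?enorm_ge0// ltW.
by rewrite ger0_norm// mulr_ge0 ?exprn_ge0 ?dotxx_ge0.
Qed.

Lemma increment_sym_ge0 b a k z : 0 <= a ->
  0 <= J (increment b a k z) + J (increment b a k (- z)).
Proof.
move=> a0; rewrite incrementN signed_pow_symE.
by rewrite signed_pow_sym_ge0// mulr_ge0 ?exprn_ge0 ?dotxx_ge0.
Qed.

(* Twice the principal value of the increment over the ball of radius r. *)
Definition sym_energy b a k r : \bar R :=
  (\int[mu]_(z in [set z : LT | (0 < enorm z < r)%R])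
    ((J (increment b a k z) + J (increment b a k (- (z : 'rV[R]_n))))
      / enorm z `^ v)%:E)%E.

Lemma pv_increment b a k r B : 0 <= a -> 0 < r -> (sym_energy b a k r <= (2 * B)%:E)%E ->
  exists2 P : R, 0 <= P <= B &
  (\int[mu]_(z in annulus e r) (J (increment b a k z) / enorm z `^ v)%:E)%E
     @[e --> 0^'+] --> P%:E /\
  (\int[mu]_(z in annulus e r)
     (J (increment b a k (- (z : 'rV[R]_n))) / enorm z `^ v)%:E)%E
     @[e --> 0^'+] --> P%:E.
Proof.
move=> a0 r0 HB.
have mf : measurable_fun [set: LT] ((fun z => J (increment b a k z)) : LT -> R).
  exact: (measurableT_comp (measurable_signed_pow p) (measurable_increment b a k)).
have [P PB HP] := @odd_cancellation R n p s p_gt1 s_gt0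
  (fun z => J (increment b a k z)) r _ B mf r0
  (fun z zr => increment_bounded b a k r z a0 zr)
  (fun z => increment_sym_ge0 b a k z a0) HB.
exists P => //; split => //.
rewrite (_ : (fun e => _) = (fun e => \int[mu]_(z in annulus e r)
  (J (increment b a k z) / enorm z `^ v)%:E)%E)//.
apply/funext => e.
rewrite -[RHS](integral_annulus_reflect
  (fun z : LT => (J (increment b a k z) / enorm z `^ v)%:E)).
  by apply: eq_integral => z _; rewrite enormN.
exact: (measurable_div_kernel p s _ mf).
Qed.

(** [J] of a |z|^(2k) is a^(p - 1) |z|^(2k(p - 1)), and for |z| <= 1 the lower bound on k makes this
    at most a^(p - 1) |z|^v, which cancels the kernel. The bound tends to 0 with [a] at fixed
    radius. *)
Lemma sym_energy_radial a k r : 0 <= a -> 0 < r <= 1 -> v <= (2 * k)%:R * (p - 1) ->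
  (sym_energy 0 a k r <= (2 * (a `^ (p - 1) * (2 * r) ^+ n))%:E)%E.
Proof.
move=> a0 /andP[r0 r1] kv; have p1 := p_gt1.
have mf : measurable_fun [set: LT] ((fun z => J (increment 0 a k z)) : LT -> R).
  exact: (measurableT_comp (measurable_signed_pow p) (measurable_increment 0 a k)).
have mD : measurable ([set z : LT | 0 < enorm z < r]).
  rewrite (_ : [set _ | _] = [set: LT] `&` (@enorm R n) @^-1` `]0, r[%classic).
    exact: measurable_enorm.
  by apply/seteqP; split => z; rewrite /= in_itv/= => //; case.
rewrite mulrA; apply: integral_le_cst.
- exact: mD.
- apply: measurable_funTS; apply: measurable_div_kernel.
  exact: (measurable_funD mf (measurable_reflect _ mf)).
- by move=> z _; rewrite lee_fin divr_ge0 ?powR_ge0// increment_sym_ge0.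
- move=> z /= /andP[z0 zr]; rewrite lee_fin incrementN /increment.
  have -> : dot 0 z = 0 by rewrite /dot big1// => i _; rewrite mxE mul0r.
  rewrite oppr0 !add0r -enorm_sqr -exprM.
  rewrite signed_pow_ge0E ?mulr_ge0 ?exprn_ge0 ?enorm_ge0//.
  rewrite powRM ?exprn_ge0 ?enorm_ge0// -powR_mulrn ?enorm_ge0// -powRrM.
  set M := a `^ _; set E := enorm z `^ ((2 * k)%:R * _).
  have Ev : E <= enorm z `^ v.
    by apply: ger_powR => //; rewrite z0 /= (le_trans (ltW zr)).
  rewrite ler_pdivrMr ?powR_gt0//.
  have -> : M * E + M * E = 2 * M * E by ring.
  by rewrite ler_wpM2l// mulr_ge0// powR_ge0.
- by rewrite mulr_ge0 ?powR_ge0.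
- apply: le_trans (lebesgue_rV_eball 0 r (ltW r0)).
  by apply: le_outer_measure => z /andP[_ zr]; rewrite /eball/= subr0.
Qed.

Lemma sym_energy_small b a k : 0 <= a ->
  (b != 0 /\ k = 1%N) \/ (b = 0 /\ v <= (2 * k)%:R * (p - 1)) ->
  forall e, 0 < e -> exists2 r0, 0 < r0 & forall r, 0 < r <= r0 ->
    (sym_energy b a k r <= (2 * e)%:E)%E.
Proof.
move=> a0 [[b0 ->]|[-> kv]] e e0; have p1 := p_gt1; have s1 := s_lt1.
  (* This is where s < 1 enters: p - p s is the exponent of the radius left by the annulus
     estimate. *)
  have sg : 0 < p - p * s by rewrite -[X in X - _]mulr1 -mulrBr mulr_gt0 ?subr_gt0//; lra.
  have [c c0 Hc] := @sym_kernel_annulus R n p (p * s) a b p_gt1 (ltW ps_gt0) a0 b0.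
  pose K := c / (1 - 2^-1 `^ (p - p * s)).
  have K0 : 0 <= K.
    rewrite divr_ge0// subr_ge0 ltW//.
    by have /andP[] := powR_half_lt1 (p - p * s) sg.
  (* [q] solves (K + 1) q^(p - p s) = 2e; the added 1 keeps the divisor positive when K = 0. *)
  pose q := (2 * e / (K + 1)) `^ (p - p * s)^-1.
  have K1 : 0 < K + 1 by rewrite ltr_wpDl.
  have qq0 : 0 < 2 * e / (K + 1) by rewrite divr_gt0 ?mulr_gt0.
  have q0 : 0 < q by rewrite powR_gt0.
  exists (Num.min 1 q); first by rewrite lt_min ltr01.
  move=> r /andP[r0]; rewrite le_min => /andP[r1 rq].
  pose G z : R := (J (dot b z + a * dot z z) - J (dot b z - a * dot z z)) / enorm z `^ v.
  have mG : measurable_fun [set: LT] (fun z : LT => (G z)%:E).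
    by apply/measurable_EFinP; exact: (measurable_sym_kernel p (p * s) a b).
  have G0 z : (0 <= (G z)%:E)%E.
    by rewrite lee_fin; apply: (sym_kernel_ge0 p (p * s)).
  have HG rho : 0 < rho <= r -> (\int[mu]_(z in annulus (rho / 2) rho) (G z)%:E <=
      (c * rho `^ (p - p * s))%:E)%E.
    by move=> /andP[rho0 rhor]; apply: Hc; rewrite rho0 (le_trans rhor).
  have := @integral_punctured_ball R n (fun z => (G z)%:E) c _ r mG G0 sg r0 HG.
  have -> : sym_energy b a 1 r =
      (\int[mu]_(z in [set z : LT | (0 < enorm z < r)%R]) (G z)%:E)%E.
    apply: eq_integral => z _; congr (_ / _)%:E.
    by rewrite incrementN /increment expr1 signed_pow_symE.
  move=> h; apply: (le_trans h); rewrite lee_fin -/K.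
  have : r `^ (p - p * s) <= 2 * e / (K + 1).
    have -> : 2 * e / (K + 1) = q `^ (p - p * s).
      by rewrite /q -powRrM mulVf ?gt_eqF// powRr1 ?(ltW qq0).
    by apply: ge0_ler_powR; rewrite ?nnegrE ?(ltW sg) ?(ltW r0) ?(ltW q0).
  rewrite ler_pdivlMr// => h2.
  apply: le_trans h2; rewrite mulrC ler_wpM2l ?powR_ge0//; lra.
pose M := a `^ (p - 1).
have M0 : 0 <= M by exact: powR_ge0.
(* 2r <= 1 and n > 0 reduce (2r)^n to 2r; the second entry then makes 2 M r at most e. *)
exists (Num.min 2^-1 (e / (2 * (M + 1)))).
  by rewrite lt_min invr_gt0 ltr0n divr_gt0// mulr_gt0// ltr_wpDl.
move=> r /andP[r0]; rewrite le_min => /andP[r1 re].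
have r11 : r <= 1 by lra.
apply: le_trans (sym_energy_radial a k r a0 (introT andP (conj r0 r11)) kv) _.
rewrite lee_fin ler_wpM2l// -/M.
apply: (@le_trans _ _ (M * (2 * r))).
  rewrite ler_wpM2l//; have : 0 <= 2 * r <= 1 by apply/andP; split; lra.
  by case: n n_gt0 => // m _ /andP[h0 h1]; rewrite exprS ler_piMr// exprn_ile1.
move: re; rewrite ler_pdivlMr ?mulr_gt0 ?ltr_wpDl// => re.
have : M * r >= 0 by rewrite mulr_ge0// ltW.
lra.
Qed.

(** The principal value over the ball is replaced by its upper bound [B], so that only the tail of
    [u] remains. In the subsolution counterpart the same quantity enters with the opposite sign. *)
Lemma supersolution_increment (Omega : set 'rV[R]_n) (f u : 'rV[R]_n -> R)
    x b a k r B :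
  viscosity_supersolution p s Omega f u -> Omega x -> 0 < r ->
  closure (eball x r) `<=` Omega -> 0 <= a -> (0 < k)%N ->
  (forall z, enorm z <= r -> z != 0 -> u x - increment b a k (- z) < u (x + z)) ->
  admissible_test p s x r (quasiquadratic (u x) (- a) b k x) ->
  (sym_energy b a k r <= (2 * B)%:E)%E ->
  f x <= 2 * (B + fine (\int[mu]_(z in ~` eball 0 r)
     (J (u x - u (x + (z : 'rV[R]_n))) / enorm z `^ v)%:E)%E).
Proof.
move=> [ut uc fc H] Ox r0 cO a0 k0 touch adm HB.
have [P /andP[P0 PB] [_ HP]] := pv_increment b a k r B a0 r0 HB.
pose phi := quasiquadratic (u x) (- a) b k x.
have phix : phi x = u x.
  by rewrite /phi quasiquadratic_center.
have phiE y : phi y = u x - increment b a k (- (y - x)).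
  by rewrite incrementN /phi /quasiquadratic; ring.
have Ck2 : Ck 2 (eball x r) phi by apply: polyfun_Ck; exact: polyfun_quasiquadratic.
have := H x r phi Ox r0 cO Ck2 phix _ adm.
have mf : measurable_fun [set: LT] ((fun z => J (increment b a k (- z))) : LT -> R).
  apply: (measurable_reflect (fun z => J (increment b a k z))).
  exact: (measurableT_comp (measurable_signed_pow p) (measurable_increment b a k)).
have fbnd z : enorm z < r -> `|J (increment b a k (- z))| <=
    (enorm b * r + a * (r ^+ 2) ^+ k) `^ (p - 1).
  by move=> zr; apply: increment_bounded; rewrite ?enormN.
have fE z : enorm z < r -> J (phi x - phi (x + z)) = J (increment b a k (- z)).
  by move=> zr; rewrite phix phiE [x + z]addrC addrK opprB addrC subrK.
rewrite (frac_plapE p s p_gt1 s_gt0 u phi _ x r _ P ut r0 phix mf fbnd fE HP).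
have Tfin := integrable_fin_num (measurableC (measurable_eball 0 r))
    (tail_integrable p s p_gt1 s_gt0 u x r ut r0).
rewrite -(fineK Tfin) -EFinD -EFinM lee_fin => h.
apply: le_trans (h _) _; last by rewrite ler_wpM2l// lerD2r.
move=> y /closure_eball yr yx; rewrite phiE.
have := touch (y - x) yr; rewrite subr_eq0 => /(_ yx).
by rewrite [x + _]addrC subrK.
Qed.

Lemma subsolution_increment (Omega : set 'rV[R]_n) (f u : 'rV[R]_n -> R)
    x b a k r B :
  viscosity_subsolution p s Omega f u -> Omega x -> 0 < r ->
  closure (eball x r) `<=` Omega -> 0 <= a -> (0 < k)%N ->
  (forall z, enorm z <= r -> z != 0 -> u (x + z) < u x + increment b a k z) ->
  admissible_test p s x r (quasiquadratic (u x) a b k x) ->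
  (sym_energy b a k r <= (2 * B)%:E)%E ->
  2 * (- B + fine (\int[mu]_(z in ~` eball 0 r)
     (J (u x - u (x + (z : 'rV[R]_n))) / enorm z `^ v)%:E)%E) <= f x.
Proof.
move=> [ut uc fc H] Ox r0 cO a0 k0 touch adm HB.
have [P /andP[P0 PB] [HP _]] := pv_increment b a k r B a0 r0 HB.
pose phi := quasiquadratic (u x) a b k x.
have phix : phi x = u x.
  by rewrite /phi quasiquadratic_center.
have phiE y : phi y = u x + increment b a k (y - x).
  by rewrite /increment addrA.
have Ck2 : Ck 2 (eball x r) phi by apply: polyfun_Ck; exact: polyfun_quasiquadratic.
have := H x r phi Ox r0 cO Ck2 phix _ adm.
have mJ : measurable_fun [set: LT] ((fun z => J (increment b a k z)) : LT -> R).
  exact: (measurableT_comp (measurable_signed_pow p) (measurable_increment b a k)).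
have mf : measurable_fun [set: LT] ((fun z => - J (increment b a k z)) : LT -> R).
  exact: measurable_funN.
have fbnd z : enorm z < r -> `|- J (increment b a k z)| <=
    (enorm b * r + a * (r ^+ 2) ^+ k) `^ (p - 1).
  by move=> zr; rewrite normrN; exact: increment_bounded.
have fE z : enorm z < r -> J (phi x - phi (x + z)) = - J (increment b a k z).
  move=> zr; rewrite phix phiE [x + z]addrC addrK -signed_powN; congr signed_pow.
  by rewrite opprD addrA subrr add0r.
have HPN : (\int[mu]_(z in annulus e r) (- J (increment b a k z) / enorm z `^ v)%:E)%E
     @[e --> 0^'+] --> (- P)%:E.
  apply: cvg_trans (cvgeN HP); apply: near_eq_cvg; near=> e.
  have e0 : 0 < e by near: e; exact: nbhs_right_gt.
  have iJ := integrable_annulus p s p_gt1 s_gt0 _ e r _ mJ e0 (ltW r0)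
    (fun z zr => increment_bounded b a k r z a0 zr).
  rewrite -[LHS]mulN1e -(integralZl (measurable_annulus e r) iJ (-1)).
  by apply: eq_integral => z _; rewrite -EFinM; congr EFin; ring.
rewrite (frac_plapE p s p_gt1 s_gt0 u phi _ x r _ (- P) ut r0 phix mf fbnd fE HPN).
have Tfin := integrable_fin_num (measurableC (measurable_eball 0 r))
    (tail_integrable p s p_gt1 s_gt0 u x r ut r0).
rewrite -(fineK Tfin) -EFinD -EFinM lee_fin => h.
apply: (le_trans _ (h _)); first by rewrite ler_wpM2l// lerD2r lerN2.
move=> y /closure_eball yr yx; rewrite phiE.
have := touch (y - x) yr; rewrite subr_eq0 => /(_ yx).
by rewrite [x + _]addrC subrK.
Unshelve. all: by end_near. Qed.

End test_inequalities.

(** * Strong maximum principle *)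

Section strong_maximum_principle.
Context {R : realType} {n : nat}.
Variables p s : R.
Hypotheses (n_gt0 : (0 < n)%N) (p_gt1 : 1 < p) (s_gt0 : 0 < s) (s_lt1 : s < 1).
Local Notation mu := (@lebesgue_rV R n).
Local Notation LT := (lebesgueType R n).
Local Notation J := (signed_pow p).
Local Notation v := (n%:R + p * s).
Implicit Types (x y z : 'rV[R]_n) (u : 'rV[R]_n -> R).

(* The first bound makes [J (|z|^(2k)) / |z|^v] bounded; the second one allows
   beta = 2 k in [admissible_test]. *)
Lemma radial_exponent : exists k, [/\ (2 <= k)%N, v <= (2 * k)%:R * (p - 1) &
  p * s / (p - 1) < (2 * k)%:R].
Proof.
have p1 : 0 < p - 1 by rewrite subr_gt0.
pose k := (Num.truncn (v / (p - 1))).+2; exists k.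
have kv : v / (p - 1) < (2 * k)%:R.
  have := truncnS_gt (v / (p - 1)) => h; apply: (lt_le_trans h).
  by rewrite ler_nat mul2n -addnn (leq_trans (leqnSn _))// leq_addl.
split => //; first by rewrite -ler_pdivrMr// ltW.
apply: le_lt_trans kv; rewrite ler_pM2r ?invr_gt0//.
by rewrite lerDr.
Qed.

Lemma ae_eq0_shift u x (r : R) : measurable_fun [set: LT] (u : LT -> R) ->
  {ae mu, forall z : LT, (~` eball 0 r) z -> u (x + (z : 'rV[R]_n)) = 0} ->
  mu.-negligible [set y : LT | ~ eball x r y /\ u y <> 0].
Proof.
move=> mu_ [A [mA A0 HA]].
exists ((fun y : 'rV[R]_n => - x + 1 *: y) @^-1` A); split.
- by rewrite -[X in measurable X]setTI; apply: (measurable_affine (- x) 1 (or_introl erefl)).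
- by rewrite (lebesgue_rV_affine (- x) 1 A (or_introl erefl)).
move=> y [yr uy]; apply: HA => /= H; apply: uy.
have E : x + (- x + 1 *: (y : 'rV[R]_n)) = y by rewrite addrA subrr add0r scale1r.
rewrite -[in LHS]E; apply: H => h; apply: yr.
by move: h; rewrite /eball /= subr0 scale1r addrC.
Qed.

Lemma strong_maximum (Omega : set 'rV[R]_n) f u x : open Omega ->
  (forall y, 0 <= u y) -> viscosity_supersolution p s Omega f u ->
  Omega x -> u x = 0 -> 0 <= f x -> {ae mu, forall y, u y = 0}.
Proof.
move=> oO u0 us Ox ux fx; have p1 := p_gt1.
have [ut _ _ _] := us; have [mu_ _] := ut.
have [k [k2 kv kps]] := radial_exponent.
have [r0 r00 Hr0] := open_eball Omega x oO Ox.
have key r : 0 < r -> r <= Num.min r0 1 -> mu.-negligible [set y : LT | ~ eball x r y /\ u y <> 0].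
  move=> rgt0; rewrite le_min => /andP[rr0 r1]; apply: ae_eq0_shift => //.
  pose F (z : LT) : \bar R := (J (u x - u (x + (z : 'rV[R]_n))) / enorm z `^ v)%:E.
  have iF : mu.-integrable (~` eball 0 r) F := tail_integrable p s p_gt1 s_gt0 u x r ut rgt0.
  have mD : measurable (~` eball 0 r : set LT).
    by apply: measurableC; exact: measurable_eball.
  have F0 z : (F z <= 0)%E.
    rewrite /F lee_fin ux sub0r signed_powN mulNr oppr_le0.
    by rewrite divr_ge0 ?powR_ge0// signed_pow_ge0.
  have absE : (\int[mu]_(z in ~` eball 0 r) `|F z| =
      (-1)%:E * \int[mu]_(z in ~` eball 0 r) F z)%E.
    rewrite -(integralZl mD iF); apply: eq_integral => z _.
    by rewrite lee0_abs// mulN1e.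
  (* The tail is nonpositive by sign. Letting the radial coefficient tend to 0 at fixed [r] shows
     that it is also at least -e for every e > 0. *)
  have T0 : (\int[mu]_(z in ~` eball 0 r) F z = 0)%E.
    have Tfin := integrable_fin_num mD iF.
    rewrite -(fineK Tfin); congr EFin; apply/eqP; rewrite eq_le; apply/andP; split.
      have : (0 <= \int[mu]_(z in ~` eball 0 r) `|F z|)%E by exact: integral_ge0.
      by rewrite absE -(fineK Tfin) -EFinM lee_fin mulN1r oppr_ge0.
    rewrite -oppr_le0; apply/ler_addgt0Pr => e e0; rewrite add0r.
    have V0 : 0 < (2 * r) ^+ n by rewrite exprn_gt0// mulr_gt0.
    (* Makes the ball term a^(p - 1) (2r)^n equal to e. *)
    pose a := (e / (2 * r) ^+ n) `^ (p - 1)^-1.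
    have ea : 0 < e / (2 * r) ^+ n by rewrite divr_gt0.
    have a0 : 0 < a by rewrite powR_gt0.
    have aE : a `^ (p - 1) * (2 * r) ^+ n = e.
      rewrite /a -powRrM mulVf ?gt_eqF ?subr_gt0// powRr1 ?(ltW ea)//.
      by rewrite divfK// gt_eqF.
    have := @supersolution_increment R n p s p_gt1 s_gt0 Omega f u x 0 a k r e
      us Ox rgt0 (Hr0 r rr0) (ltW a0) (ltnW k2).
    have HB := @sym_energy_radial R n p s p_gt1 a k r (ltW a0)
      (introT andP (conj rgt0 r1)) kv.
    rewrite aE in HB.
    move=> /(_ _ _ HB) H.
    have {}H : f x <= 2 * (e + fine (\int[mu]_(z in ~` eball 0 r) F z)%E).
      apply: H.
        move=> z _ z0; rewrite ux sub0r incrementN; apply: lt_le_trans (u0 _).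
        have -> : dot 0 z = 0 by rewrite -(scale0r (0 : 'rV[R]_n)) dotZl mul0r.
        rewrite oppr0 add0r oppr_lt0 mulr_gt0// exprn_gt0//.
        by rewrite lt0r dotxx_eq0 z0 dotxx_ge0.
      apply: admissible_test_radial => //; first by rewrite oppr_eq0 gt_eqF.
    by move: H; set T := fine _ => H; lra.
  have : (\int[mu]_(z in ~` eball 0 r) `|F z| = 0)%E.
    by rewrite absE T0 mule0.
  move/(ae_eq_integral_abs mu mD (measurable_int mu iF)).
  apply: filterS => z /= H zr.
  have := H zr; rewrite /F ux sub0r => -[] /eqP.
  have z0 : 0 < enorm z.
    move: zr; rewrite /eball /= subr0 => /negP; rewrite -leNgt; exact: lt_le_trans.
  rewrite mulf_eq0 invr_eq0 [X in _ || X]gt_eqF ?powR_gt0// orbF.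
  rewrite -normr_eq0 normr_signed_pow// powR_eq0 => /andP[].
  by rewrite normr_eq0 oppr_eq0 => /eqP.
(* Vanishing holds outside balls about [x] of arbitrarily small radius; their complements exhaust
   everything but [x], where [u] is 0. *)
have : mu.-negligible (\bigcup_j [set y : LT | ~ eball x (Num.min r0 1 / j.+1%:R) y /\ u y <> 0]).
  have m0 : 0 < Num.min r0 1 by rewrite lt_min r00 ltr01.
  apply: negligible_bigcup => j; apply: key; first by rewrite divr_gt0.
  by rewrite ler_pdivrMr// ler_peMr ?(ltW m0)// ler1n.
apply: negligibleS => y /= uy.
have yx : 0 < enorm (y - x).
  by rewrite enorm_gt0 subr_eq0; apply/eqP => yx; apply: uy; rewrite yx.
pose j := Num.truncn (Num.min r0 1 / enorm (y - x)).
exists j => //; split => //; rewrite /eball /=; apply/negP; rewrite -leNgt.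
rewrite ler_pdivrMr// mulrC -ler_pdivrMr//; apply/ltW; exact: truncnS_gt.
Qed.

(** If every set {u > 1/(j + 1), |y| < j + 1} were null, so would be their union {u > 0}. *)
Lemma positive_mass u : measurable_fun [set: LT] (u : LT -> R) ->
  (forall y, 0 <= u y) -> ~ {ae mu, forall y, u y = 0} ->
  exists c rad : R, [/\ 0 < c, 0 < rad &
    measurable ([set y | c < u y /\ enorm y < rad] : set LT) /\
    (0 < mu [set y | (c < u y)%R /\ (enorm y < rad)%R])%E].
Proof.
move=> mu_ u0 nae.
pose K (j : nat) : set LT := [set y | j.+1%:R^-1 < u y /\ enorm y < j.+1%:R].
have mK j : measurable (K j).
  rewrite (_ : K j = ([set: LT] `&` (u : LT -> R) @^-1` `]j.+1%:R^-1, +oo[%classic) `&`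
    (eball 0 j.+1%:R : set LT)).
    by apply: measurableI; [exact: mu_|exact: measurable_eball].
  apply/seteqP; split => y; rewrite /K /eball /= subr0 in_itv/= andbT.
    by move=> [].
  by move=> [[_ ?] ?].
apply: contrapT => H; apply: nae.
have : mu.-negligible (\bigcup_j K j).
  apply: negligible_bigcup => j; apply/negligibleP; first exact: mK.
  apply/eqP; rewrite eq_le measure_ge0 andbT leNgt; apply/negP => K0.
  apply: H; exists j.+1%:R^-1, j.+1%:R; split; rewrite ?invr_gt0//.
  by split; [exact: mK|exact: K0].
apply: negligibleS => y /= /eqP uy.
have uy0 : 0 < u y by rewrite lt0r uy u0.
pose j := Num.truncn (Num.max (u y)^-1 (enorm y)).
have jm : Num.max (u y)^-1 (enorm y) < j.+1%:R by exact: truncnS_gt.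
move: jm; rewrite gt_max => /andP[j1 j2].
exists j => //; split => //.
by rewrite invf_plt ?posrE.
Qed.

End strong_maximum_principle.

(** * Doubling of variables *)

Section doubling_of_variables.
Context {R : realType} {n : nat}.
Variables p s : R.
Hypotheses (n_gt0 : (0 < n)%N) (p_gt1 : 1 < p) (s_gt0 : 0 < s) (s_lt1 : s < 1).
Local Notation mu := (@lebesgue_rV R n).
Local Notation LT := (lebesgueType R n).
Local Notation J := (signed_pow p).
Local Notation v := (n%:R + p * s).
Implicit Types (x y z b : 'rV[R]_n) (u w : 'rV[R]_n -> R).

(** Second-order bound, by multiplying the bound for m by A + t >= 0; the cubic remainder is
    absorbed through t <= S. *)
Lemma exp_taylor (A S : R) (m : nat) : 0 <= A -> 0 <= S -> exists2 C, 0 <= C &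
  forall t, `|t| <= S -> 0 <= A + t ->
    (A + t) ^+ m <= A ^+ m + m%:R * A ^+ m.-1 * t + C * t ^+ 2.
Proof.
move=> A0 S0; elim: m => [|m [C C0 H]].
  by exists 0 => // t _ _; rewrite !expr0 !mul0r !addr0.
have D0 : 0 <= m%:R * A ^+ m.-1 by rewrite mulr_ge0 ?exprn_ge0.
exists (m%:R * A ^+ m.-1 + C * (A + S)).
  by rewrite addr_ge0// mulr_ge0// addr_ge0.
move=> t tS At; rewrite exprS.
apply: le_trans (ler_wpM2l At (H t tS At)) _.
have -> : m.+1%:R * A ^+ m.+1.-1 = A ^+ m + A * (m%:R * A ^+ m.-1).
  rewrite -natr1 mulrDl mul1r addrC; congr (_ + _).
  by case: (m) => [|j]; rewrite ?mul0r ?mulr0//= exprS; ring.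
rewrite [A ^+ m.+1]exprS.
have t2 : 0 <= t ^+ 2 by exact: sqr_ge0.
have tS' : t <= S by rewrite (le_trans (ler_norm t)).
have : C * (A + t) * t ^+ 2 <= C * (A + S) * t ^+ 2.
  by rewrite ler_wpM2r// ler_wpM2l// lerD2l.
set P := A ^+ m; set Q := m%:R * A ^+ m.-1; lra.
Qed.

(** Selects the test by whether the difference [x] of the two points vanishes. The inequality is
    strict because a test must touch at one point only. *)
Lemma penalty_increment (H : R) k x : 0 < H -> (2 <= k)%N ->
  exists b (C : R) m, [/\ 0 < C, (0 < m)%N,
    (b != 0 /\ m = 1%N) \/ (b = 0 /\ m = k) &
    forall z, enorm z <= 1 -> z != 0 ->
      H * dot (x + z) (x + z) ^+ k - H * dot x x ^+ k < increment b C m z].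
Proof.
move=> H0 k2; have [->|x0] := eqVneq x 0.
  exists 0, (2 * H), k; split; [by rewrite mulr_gt0|exact: ltnW|by right|].
  move=> z _ z0; rewrite add0r /increment.
  have d0 y : dot (0 : 'rV[R]_n) y = 0 by rewrite -(scale0r (0 : 'rV[R]_n)) dotZl mul0r.
  rewrite !d0 expr0n gtn_eqF ?(ltnW k2)// mulr0 subr0 add0r.
  have : 0 < H * dot z z ^+ k.
    by rewrite mulr_gt0// exprn_gt0// lt0r dotxx_eq0 z0 dotxx_ge0.
  by rewrite -mulrA; lra.
pose A := dot x x; pose S := 2 * enorm x + 1.
have A0 : 0 < A by rewrite lt0r dotxx_eq0 x0 dotxx_ge0.
have S0 : 0 <= S by rewrite addr_ge0 ?mulr_ge0 ?enorm_ge0.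
have [C C0 HC] := exp_taylor A S k (ltW A0) S0.
pose Q := H * (k%:R * A ^+ k.-1).
have Q0 : 0 < Q by rewrite !mulr_gt0 ?exprn_gt0// ltr0n ltnW.
(* (2Q) x is the gradient of the penalty at [x]. In the quadratic coefficient, Q comes from the
   |z|^2 inside t, H C S^2 from the Taylor remainder with |t| <= S |z|, and 1 gives strictness. *)
exists ((2 * Q) *: x), (Q + H * (C * S ^+ 2) + 1), 1%N; split => //.
- by rewrite ltr_wpDl// addr_ge0 ?(ltW Q0) ?mulr_ge0 ?(ltW H0) ?exprn_ge0.
- by left; rewrite scaler_eq0 negb_or x0 gt_eqF// mulr_gt0.
move=> z z1 z0.
have zz0 : 0 < dot z z by rewrite lt0r dotxx_eq0 z0 dotxx_ge0.
pose t := 2 * dot x z + dot z z.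
have NE : dot (x + z) (x + z) = A + t.
  by rewrite dotDr !dotDl (dotC z x) /t /A; ring.
have tS : `|t| <= S * enorm z.
  rewrite /S mulrDl mul1r; apply: le_trans (ler_normD _ _) _; apply: lerD.
    by rewrite normrM normr_nat -mulrA ler_wpM2l// dot_le.
  by rewrite ger0_norm ?(ltW zz0)// -enorm_sqr expr2 ler_piMr ?enorm_ge0.
have tS1 : `|t| <= S by apply: le_trans tS _; rewrite ler_piMr.
have t2 : t ^+ 2 <= S ^+ 2 * dot z z.
  rewrite -real_normK ?num_real// -enorm_sqr -exprMn lerXn2r ?nnegrE//.
  by rewrite mulr_ge0 ?enorm_ge0.
have At : 0 <= A + t by rewrite -NE dotxx_ge0.
have h := ler_wpM2l (ltW H0) (HC t tS1 At).
rewrite NE /increment dotZl expr1 -/A.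
have h2 : H * (C * t ^+ 2) <= H * (C * (S ^+ 2 * dot z z)).
  by rewrite ler_wpM2l ?(ltW H0)// ler_wpM2l.
have hQ : H * (k%:R * A ^+ k.-1 * t) = Q * t by rewrite /Q; ring.
have E1 : H * (A ^+ k + k%:R * A ^+ k.-1 * t + C * t ^+ 2) =
  H * A ^+ k + Q * t + H * (C * t ^+ 2) by rewrite -hQ; ring.
rewrite E1 in h.
have -> : (Q + H * (C * S ^+ 2) + 1) * dot z z =
  Q * dot z z + H * (C * (S ^+ 2 * dot z z)) + dot z z by ring.
have : Q * t = 2 * Q * dot x z + Q * dot z z by rewrite /t; ring.
lra.
Qed.

(** Moving only X makes the penalty a test from above for [w] at x; moving only Y makes it a test
    from below for [u] at y, with displacement -z. Both tests have the same linear part up to the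
    factor e, and their ball terms cost t each. *)
Lemma doubling_inequality (Omega : set 'rV[R]_n) f1 f2 u w (e H : R) k x y :
  open Omega -> viscosity_supersolution p s Omega f1 u ->
  viscosity_subsolution p s Omega f2 w -> Omega x -> Omega y ->
  0 < e -> 0 < H -> (2 <= k)%N -> v <= (2 * k)%:R * (p - 1) ->
  p * s / (p - 1) < (2 * k)%:R ->
  (forall X Y, e * w X - u Y - H * dot (X - Y) (X - Y) ^+ k <=
     e * w x - u y - H * dot (x - y) (x - y) ^+ k) ->
  forall t, 0 < t -> exists2 r0, 0 < r0 & forall r, 0 < r <= r0 ->
    (\int[mu]_(z in ~` eball 0 r)
      ((J (e * w x - e * w (x + (z : 'rV[R]_n))) - J (u y - u (y + (z : 'rV[R]_n))))
         / enorm z `^ v)%:E <=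
      ((e `^ (p - 1) * f2 x - f1 y) / 2 + 2 * t)%:E)%E.
Proof.
move=> oO us ws Ox Oy e0 H0 k2 kv kps Hmax t t0.
have [ut _ _ _] := us; have [wt _ _ _] := ws.
have [b [C [m [C0 m0 bm touch]]]] := penalty_increment H k (x - y) H0 k2.
have [rx rx0 Hrx] := open_eball Omega x oO Ox.
have [ry ry0 Hry] := open_eball Omega y oO Oy.
pose ep := e `^ (p - 1).
have ep0 : 0 < ep by rewrite powR_gt0.
have bm1 : (b != 0 /\ m = 1%N) \/ (b = 0 /\ v <= (2 * m)%:R * (p - 1)).
  by case: bm => [?|[-> ->]]; [left|right].
have bm2 : (e^-1 *: b != 0 /\ m = 1%N) \/ (e^-1 *: b = 0 /\ v <= (2 * m)%:R * (p - 1)).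
  case: bm => [[b0 ->]|[-> ->]]; [left|right]; last by rewrite scaler0.
  by rewrite scaler_eq0 invr_eq0 gt_eqF.
have Ce0 : 0 < C / e by rewrite divr_gt0.
have [r1 r10 Hr1] := sym_energy_small p s n_gt0 p_gt1 s_gt0 s_lt1 b C m (ltW C0) bm1 t t0.
(* The inequality for [w] is later multiplied by ep = e^(p - 1), which turns this error into t. *)
have te0 : 0 < t / ep by rewrite divr_gt0.
have [r2 r20 Hr2] := sym_energy_small p s n_gt0 p_gt1 s_gt0 s_lt1 (e^-1 *: b) (C / e) m
  (ltW Ce0) bm2 (t / ep) te0.
exists (Num.min 1 (Num.min (Num.min rx ry) (Num.min r1 r2))).
  by rewrite !lt_min ltr01 rx0 ry0 r10 r20.
move=> r /andP[r0]; rewrite !le_min => /and3P[rle1 /andP[rrx rry] /andP[rr1 rr2]].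
have adm c C' b' x' : b' != 0 /\ m = 1%N \/ b' = 0 /\ m = k -> C' != 0 ->
    admissible_test p s x' r (quasiquadratic c C' b' m x').
  move=> [[b'0 _]|[-> ->]] C'0; first exact: admissible_test_gradient.
  exact: admissible_test_radial.
have incE z : increment (e^-1 *: b) (C / e) m z = e^-1 * increment b C m z.
  by rewrite /increment dotZl; ring.
have hsup : f1 y <= 2 * (t + fine (\int[mu]_(z in ~` eball 0 r)
     (J (u y - u (y + (z : 'rV[R]_n))) / enorm z `^ v)%:E)%E).
  apply: (supersolution_increment p s p_gt1 s_gt0 Omega f1 u y b C m r t us Oy r0
    (Hry r rry) (ltW C0) m0).
  - move=> z zr z0; have := Hmax x (y + z).
    have zN1 : enorm (- z) <= 1 by rewrite enormN (le_trans zr).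
    have := touch (- z) zN1; rewrite oppr_eq0 => /(_ z0).
    rewrite opprD addrA; lra.
  - by apply: adm => //; rewrite oppr_eq0 gt_eqF.
  - by apply: Hr1; rewrite r0.
have hsub : 2 * (- (t / ep) + fine (\int[mu]_(z in ~` eball 0 r)
     (J (w x - w (x + (z : 'rV[R]_n))) / enorm z `^ v)%:E)%E) <= f2 x.
  apply: (subsolution_increment p s p_gt1 s_gt0 Omega f2 w x (e^-1 *: b) (C / e) m r
    (t / ep) ws Ox r0 (Hrx r rrx) (ltW Ce0) m0).
  - move=> z zr z0; have := Hmax (x + z) y.
    have := touch z (le_trans zr rle1) z0.
    rewrite incE [x + z - y]addrAC => h1 h2.
    rewrite -ltrBlDl mulrC ltr_pdivlMr// mulrBl ![_ * e]mulrC; lra.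
  - apply: adm; last by rewrite gt_eqF.
    case: bm => [[b0 ->]|[-> ->]]; [left|right]; last by rewrite scaler0.
    by rewrite scaler_eq0 invr_eq0 gt_eqF.
  - by apply: Hr2; rewrite r0.
have mD : measurable (~` eball 0 r : set LT).
  by apply: measurableC; exact: measurable_eball.
have iu := tail_integrable p s p_gt1 s_gt0 u y r ut r0.
have iw := tail_integrable p s p_gt1 s_gt0 w x r wt r0.
have iew := integrableZl mD ep iw.
have -> : (\int[mu]_(z in ~` eball 0 r)
      ((J (e * w x - e * w (x + (z : 'rV[R]_n))) - J (u y - u (y + (z : 'rV[R]_n))))
         / enorm z `^ v)%:E)%E =
   (ep%:E * \int[mu]_(z in ~` eball 0 r) (J (w x - w (x + (z : 'rV[R]_n))) / enorm z `^ v)%:E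
    - \int[mu]_(z in ~` eball 0 r) (J (u y - u (y + (z : 'rV[R]_n))) / enorm z `^ v)%:E)%E.
  rewrite -(integralZl mD iw) -(integralB mD iew iu).
  apply: eq_integral => z _ /=; rewrite -EFinM -EFinB; congr EFin.
  by rewrite -mulrBr signed_powM ?(ltW e0)// -/ep; ring.
have fu := integrable_fin_num mD iu; have fw := integrable_fin_num mD iw.
rewrite -(fineK fu) -(fineK fw) -EFinM -EFinB lee_fin.
move: hsup hsub; set Tu := fine _; set Tw := fine _ => hsup hsub.
have : ep * (2 * (- (t / ep) + Tw)) <= ep * f2 x by rewrite ler_wpM2l ?(ltW ep0).
have -> : ep * (2 * (- (t / ep) + Tw)) = - 2 * t + 2 * (ep * Tw).
  by field; rewrite gt_eqF.
rewrite -/ep; lra.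
Qed.

End doubling_of_variables.

(** * Comparison with the torsion function *)

Section comparison.
Context {R : realType} {n : nat}.
Variables p s : R.
Hypotheses (n_gt0 : (0 < n)%N) (p_gt1 : 1 < p) (s_gt0 : 0 < s) (s_lt1 : s < 1).
Local Notation mu := (@lebesgue_rV R n).
Local Notation LT := (lebesgueType R n).
Local Notation J := (signed_pow p).
Local Notation v := (n%:R + p * s).
Implicit Types (x y z b : 'rV[R]_n) (u w : 'rV[R]_n -> R).

Lemma closed_enorm_le (r : R) : closed [set x : 'rV[R]_n | enorm x <= r].
Proof.
apply: (@preimage_closed _ _ (@enorm R n) [set t | t <= r]); last exact: closed_le.
by move=> x _; exact: enorm_continuous.
Qed.

Lemma compact_enorm_le (r : R) : compact [set x : 'rV[R]_n | enorm x <= r].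
Proof.
apply: bounded_closed_compact; last exact: closed_enorm_le.
exists r; split; first exact: num_real.
by move=> M rM x /= xr; rewrite (le_trans (normr_le_enorm x))// (le_trans xr)// ltW.
Qed.

Lemma bounded_enorm (A : set 'rV[R]_n) : bounded_set A ->
  exists2 r : R, 0 < r & closure A `<=` [set x | enorm x <= r].
Proof.
move=> /ex_strict_bound_gt0[M M0 HM]; exists (n%:R * M).
  by rewrite mulr_gt0// ltr0n.
rewrite closureE; apply: smallest_sub; first exact: closed_enorm_le.
move=> x Ax /=; apply: le_trans (enorm_le_normr x) _.
by rewrite ler_wpM2l// ltW// HM.
Qed.

(** The pairs on which [w] differs by at least sigma form a compact set off the diagonal; rho is
    their minimal distance. *)
Lemma uniform_continuity w (r sigma : R) : continuous w -> 0 < sigma ->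
  exists2 rho, 0 < rho & forall x y, enorm x <= r -> enorm y <= r ->
    enorm (x - y) < rho -> `|w x - w y| < sigma.
Proof.
move=> wc s0; pose B := [set x : 'rV[R]_n | enorm x <= r].
pose D := [set z : 'rV[R]_n * 'rV[R]_n | sigma <= `|w z.1 - w z.2|].
have wc1 : continuous (fun z : 'rV[R]_n * 'rV[R]_n => `|w z.1 - w z.2|).
  move=> z; apply: cvg_norm; apply: cvgB.
    by apply: (continuous_comp (f := fst)); [exact: cvg_fst|exact: wc].
  by apply: (continuous_comp (f := snd)); [exact: cvg_snd|exact: wc].
have cD : compact ((B `*` B) `&` D).
  apply: compact_closedI; first by apply: compact_setX; exact: compact_enorm_le.
  apply: (@preimage_closed _ _ (fun z : 'rV[R]_n * 'rV[R]_n => `|w z.1 - w z.2|)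
    [set t | sigma <= t]); last exact: closed_ge.
  by move=> z _; exact: wc1.
have ec : continuous (fun z : 'rV[R]_n * 'rV[R]_n => enorm (z.1 - z.2)).
  move=> z; apply: (continuous_comp (f := fun z : 'rV[R]_n * 'rV[R]_n => z.1 - z.2)).
    by apply: cvgB; [exact: cvg_fst|exact: cvg_snd].
  exact: enorm_continuous.
have [[z0 Dz0]|D0] := pselect (((B `*` B) `&` D) !=set0); last first.
  exists 1 => // x y xr yr _; rewrite ltNge; apply/negP => h.
  by apply: D0; exists (x, y).
have [c] := compact_EVT_min (ex_intro _ z0 Dz0) cD (continuous_subspaceT ec).
rewrite inE => -[_ Dc] Hc; exists (enorm (c.1 - c.2)).
  rewrite enorm_gt0 subr_eq0; apply/eqP => E; move: Dc.
  by rewrite /D /= E subrr normr0 leNgt s0.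
move=> x y xr yr; apply: contraTlt => h; rewrite -leNgt.
by have := Hc (x, y); apply; rewrite inE.
Qed.

(** [u] is continuous only relative to [T], hence the argument through the within filter for the
    second coordinate. *)
Lemma penalized_max (T : set 'rV[R]_n) u w (H : R) k : T !=set0 -> compact T ->
  continuous w -> {within T, continuous u} ->
  exists x y, [/\ T x, T y & forall X Y, T X -> T Y ->
    w X - u Y - H * dot (X - Y) (X - Y) ^+ k <=
    w x - u y - H * dot (x - y) (x - y) ^+ k].
Proof.
move=> [z0 Tz0] cT wc uc.
pose F (z : 'rV[R]_n * 'rV[R]_n) := w z.1 - u z.2 - H * dot (z.1 - z.2) (z.1 - z.2) ^+ k.
have dc : continuous (fun z : 'rV[R]_n * 'rV[R]_n => enorm (z.1 - z.2)).
  move=> z; apply: (continuous_comp (f := fun z : 'rV[R]_n * 'rV[R]_n => z.1 - z.2)).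
    by apply: cvgB; [exact: cvg_fst|exact: cvg_snd].
  exact: enorm_continuous.
have ec : continuous (fun z : 'rV[R]_n * 'rV[R]_n => H * dot (z.1 - z.2) (z.1 - z.2) ^+ k).
  have -> : (fun z : 'rV[R]_n * 'rV[R]_n => H * dot (z.1 - z.2) (z.1 - z.2) ^+ k) =
      (fun z : 'rV[R]_n * 'rV[R]_n => H * enorm (z.1 - z.2) ^+ (2 * k)).
    by apply/funext => z; rewrite exprM enorm_sqr.
  move=> z; apply: cvgM; first exact: cvg_cst.
  apply: (continuous_comp (f := fun z : 'rV[R]_n * 'rV[R]_n => enorm (z.1 - z.2))
    (g := fun t : R => t ^+ (2 * k))); first exact: dc.
  exact: exprn_continuous.
have Fc : {within T `*` T, continuous F}.
  apply/subspace_continuousP => z [Tz1 Tz2]; apply: cvgB.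
    apply: cvgB.
      apply: cvg_within_filter.
      by apply: (continuous_comp (f := fst)); [exact: cvg_fst|exact: wc].
    move/subspace_continuousP : uc => /(_ _ Tz2) uz.
    apply: (cvg_trans _ uz) => A /= uA.
    have c2 : (fun y : 'rV[R]_n * 'rV[R]_n => y.2) @ z --> z.2 by exact: cvg_snd.
    have h : nbhs z (fun y : 'rV[R]_n * 'rV[R]_n => T y.2 -> A (u y.2)) := c2 _ uA.
    change (nbhs z (fun y : 'rV[R]_n * 'rV[R]_n => (T `*` T) y -> A (u y.2))).
    by apply: filterS h => y h [_ Ty]; exact: h.
  by apply: cvg_within_filter; exact: ec.
have [c] := compact_EVT_max (ex_intro _ (z0, z0) (conj Tz0 Tz0)) (compact_setX cT cT) Fc.
rewrite inE => -[Tc1 Tc2] Hc; exists c.1, c.2; split => // X Y TX TY.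
by have := Hc (X, Y); apply; rewrite inE.
Qed.

Lemma integral_ge_cst (D A : set LT) (f : LT -> R) (a : R) :
  measurable D -> measurable A -> A `<=` D -> measurable_fun D f ->
  (forall z, D z -> 0 <= f z) -> 0 <= a -> (forall z, A z -> a <= f z) ->
  (a%:E * mu A <= \int[mu]_(z in D) (f z)%:E)%E.
Proof.
move=> mD mA AD mf f0 a0 fa.
have mE : measurable_fun D (EFin \o f) by exact/measurable_EFinP.
rewrite -(integral_cst mu mA a%:E).
apply: (@le_trans _ _ (\int[mu]_(z in A) (f z)%:E)%E).
  apply: (ge0_le_integral mu mA).
  - by move=> z _; rewrite lee_fin.
  - exact: measurable_cst.
  - exact: (measurable_funS mD AD mE).
  - by move=> z Az; rewrite lee_fin fa.
by apply: (ge0_subset_integral mu mA mD mE) => // z Dz; rewrite lee_fin f0.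
Qed.

(** Ordered increments make the integrand nonnegative everywhere; on the translate of [K] the values
    [a] and [b] separate them, and d bounds the kernel from below. *)
Lemma incremental_gain u w x y (K : set LT) (a b d r : R) :
  measurable_fun [set: LT] (u : LT -> R) -> measurable_fun [set: LT] (w : LT -> R) ->
  measurable K -> 0 < r -> a <= b ->
  (forall z, u y - u (y + z) <= w x - w (x + z)) ->
  (forall z, K (y + z) -> r <= enorm z <= d) ->
  (forall z, K (y + z) -> u y - u (y + z) <= a /\ b <= w x - w (x + z)) ->
  (((J b - J a) / d `^ v)%:E * mu K <= \int[mu]_(z in ~` eball 0 r)
      ((J (w x - w (x + (z : 'rV[R]_n))) - J (u y - u (y + (z : 'rV[R]_n))))
         / enorm z `^ v)%:E)%E.
Proof.
move=> mu_ mw mK r0 ab inc Kd Kab.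
have v0 : 0 <= v.
  have : 0 <= p * s by rewrite mulr_ge0 ?(ltW s_gt0)// (le_trans ler01)// ltW.
  by move=> h; rewrite addr_ge0.
have mD : measurable (~` eball 0 r : set LT).
  by apply: measurableC; exact: measurable_eball.
pose A : set LT := (fun z : 'rV[R]_n => y + 1 *: z) @^-1` K.
have mA : measurable A.
  rewrite -[A]setTI; exact: (measurable_affine y 1 (or_introl erefl)).
have muA : mu A = mu K := lebesgue_rV_affine y 1 K (or_introl erefl).
have AK (z : 'rV[R]_n) : A z -> K (y + z) by rewrite /A /= scale1r.
have AD : A `<=` (~` eball 0 r : set LT).
  by move=> z /AK/Kd/andP[rz _]; rewrite /eball /= subr0 => /lt_geF; rewrite rz.
have Jab : 0 <= J b - J a by rewrite subr_ge0 ler_signed_pow.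
rewrite -muA; apply: (integral_ge_cst _ _ _ _ mD mA AD).
- apply: (measurable_funS measurableT (@subsetT _ _)).
  apply/measurable_EFinP; apply: (measurable_div_kernel p s
    (fun z : LT => J (w x - w (x + (z : 'rV[R]_n))) - J (u y - u (y + (z : 'rV[R]_n))))).
  apply: measurable_funB.
    apply: (measurableT_comp (measurable_signed_pow p)).
    exact: (measurable_funB (measurable_cst _) (measurable_fun_shift _ _ w x mw)).
  apply: (measurableT_comp (measurable_signed_pow p)).
  exact: (measurable_funB (measurable_cst _) (measurable_fun_shift _ _ u y mu_)).
- by move=> z _; rewrite divr_ge0 ?powR_ge0// subr_ge0 ler_signed_pow.
- by rewrite divr_ge0 ?powR_ge0.
- move=> z /AK Kz; have /andP[rz zd] := Kd _ Kz; have [ua wb] := Kab _ Kz.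
  have z0 : 0 < enorm (z : 'rV[R]_n) := lt_le_trans r0 rz.
  apply: ler_pM => //; first by rewrite invr_ge0 powR_ge0.
    by rewrite lerB// ler_signed_pow.
  have d0 := lt_le_trans z0 zd.
  rewrite lef_pV2 ?posrE ?powR_gt0//.
  by apply: ge0_ler_powR; rewrite ?nnegrE ?(ltW z0) ?(ltW d0).
Qed.

Lemma subsolution_comparison (Omega : set 'rV[R]_n) (g : R -> R) u w :
  open Omega -> bounded_set Omega ->
  {within [set t : R | 0 <= t], continuous g} -> g 0 = 0 ->
  {within closure Omega, continuous u} -> (forall x, 0 <= u x) ->
  viscosity_supersolution p s Omega (fun x => g (u x)) u ->
  continuous w -> (forall x, ~ Omega x -> w x = 0) ->
  viscosity_subsolution p s Omega (cst 1) w ->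
  ~ {ae mu, forall x, u x = 0} ->
  exists C : R, 0 < C /\ forall x, Omega x -> C * w x <= u x.
Proof.
move=> oO bO gc g0 uc u0 us wc w0 ws nae.
have p1 : 0 < p - 1 by rewrite subr_gt0.
have [[mu_ _] _ _ _] := us.
have [c [rad [c0 rad0 [mK muK]]]] := positive_mass u mu_ u0 nae.
set K : set LT := [set y | _] in mK muK.
have [rT rT0 clT] := bounded_enorm Omega bO.
have OT : Omega `<=` closure Omega := @subset_closure _ Omega.
have [S S0 wS] : exists2 S : R, 0 < S & forall x, w x <= S.
  have B0 : [set x : 'rV[R]_n | enorm x <= rT] !=set0.
    by exists 0; rewrite /= enorm0 ltW.
  have [a _ Ha] := compact_EVT_max B0 (compact_enorm_le rT) (continuous_subspaceT wc).
  exists (Num.max 1 (w a)); first by rewrite lt_max ltr01.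
  move=> x; have [Ox|nO] := pselect (Omega x).
    by rewrite le_max Ha ?orbT// inE; exact: clT (OT _ Ox).
  by rewrite w0// le_max ler01.
pose d := rad + rT; have d0 : 0 < d by rewrite addr_gt0.
(* For y + z in [K], the increment of [u] is at most c/4 - c = -3c/4, while that of e w is at least
   -c/4, since e w <= c/4 everywhere and e w > 0 at the maximum. *)
pose eta := J (- (c / 4)) - J (- (3 * c / 4)).
have eta0 : 0 < eta.
  rewrite /eta !signed_powN// opprK addrC subr_gt0.
  by apply: ltr_signed_pow_ge0 => //; lra.
pose kap := eta / d `^ v * fine (mu K).
have muKoo : (mu K < +oo)%E.
  apply: (@le_lt_trans _ _ (mu (eball 0 rad))).
    apply: le_measure; rewrite ?inE//; first exact: measurable_eball.
    by move=> y [_ yr]; rewrite /eball /= subr0.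
  by apply: le_lt_trans (lebesgue_rV_eball 0 rad (ltW rad0)) _; rewrite ltry.
have kap0 : 0 < kap.
  by rewrite /kap mulr_gt0 ?divr_gt0 ?powR_gt0// fine_gt0// muK muKoo.
have [tau tau0 gtau] : exists2 tau, 0 < tau &
    forall t, 0 <= t -> t < tau -> `|g t| < kap / 4.
  have k4 : 0 < kap / 4 by rewrite divr_gt0.
  move/subspace_continuousP : gc => /(_ 0 (lexx 0)) /cvgrPdist_lt /(_ _ k4).
  rewrite /prop_near1 /within /= => /nbhs_ballP[tau /= tau0 H]; exists tau => // t t0 tt.
  have := H t; rewrite /ball /= sub0r normrN ger0_norm// => /(_ tt t0).
  by rewrite /from_subspace g0 sub0r normrN.
(* With doubling error 2 (kap / 8), the final upper bound is below (kap/4 + kap/4)/2 + kap/4 =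
   kap/2, which contradicts the gain kap. *)
have [e [e0 eS etau ek]] : exists e : R, [/\ 0 < e, e * S <= c / 4, e * S < tau &
    e `^ (p - 1) <= kap / 4].
  have k4 : 0 < kap / 4 by rewrite divr_gt0.
  pose e := Num.min (c / 4 / S) (Num.min (tau / 2 / S) ((kap / 4) `^ (p - 1)^-1)).
  have e0 : 0 < e by rewrite !lt_min !divr_gt0// powR_gt0.
  exists e; split => //.
  - by rewrite -ler_pdivlMr// ge_min lexx.
  - apply: (@le_lt_trans _ _ (tau / 2)); last lra.
    by rewrite -ler_pdivlMr// !ge_min lexx orbT.
  - apply: (@le_trans _ _ (((kap / 4) `^ (p - 1)^-1) `^ (p - 1))).
      apply: ge0_ler_powR; rewrite ?nnegrE ?powR_ge0 ?(ltW p1) ?(ltW e0)//.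
      by rewrite !ge_min lexx !orbT.
    by rewrite -powRrM mulVf ?gt_eqF// powRr1// ltW.
exists e; split => // x0 Ox0; rewrite leNgt; apply/negP => lt0.
pose sigma := e * w x0 - u x0; have sigma0 : 0 < sigma by rewrite subr_gt0.
have ewc : continuous (fun x => e * w x).
  by move=> x; apply: continuousM; [exact: cst_continuous|exact: wc].
(* Radius rT + 1, since a point within rho <= 1 of the closure of Omega may lie outside it. *)
have [rho1 rho10 Hrho1] := uniform_continuity (fun x => e * w x) (rT + 1) sigma ewc sigma0.
pose rho := Num.min 1 rho1.
have rho0 : 0 < rho by rewrite lt_min ltr01.
have small x y : enorm x <= rT -> enorm (x - y) < rho -> `|e * w x - e * w y| < sigma.
  rewrite lt_min => xr /andP[xy1 xy2]; apply: Hrho1 => //; first lra.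
  have := enormBD y x 0; rewrite !subr0 enormB; lra.
have [k [k2 kv kps]] := radial_exponent (n := n) p s p_gt1.
have rk0 : 0 < (rho ^+ 2) ^+ k by rewrite !exprn_gt0.
(* Pairs at distance rho or more pay a penalty above e S, the bound for e w. *)
pose H := (e * S + 1) / (rho ^+ 2) ^+ k.
have eS0 : 0 < e * S by rewrite mulr_gt0.
have H0 : 0 < H by rewrite divr_gt0//; lra.
have far x y : rho <= enorm (x - y) -> e * S < H * dot (x - y) (x - y) ^+ k.
  move=> h; apply: (@lt_le_trans _ _ (H * (rho ^+ 2) ^+ k)).
    by rewrite /H divfK ?gt_eqF//; lra.
  rewrite ler_wpM2l ?(ltW H0)// -enorm_sqr.
  by rewrite !lerXn2r ?nnegrE ?exprn_ge0 ?enorm_ge0 ?(ltW rho0).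
have cT : compact (closure Omega).
  rewrite -(setIidr clT); apply: compact_closedI; last exact: closed_closure.
  exact: compact_enorm_le.
have [x [y [Tx Ty Hmax]]] := penalized_max (closure Omega) u (fun x => e * w x) H k
  (ex_intro _ x0 (OT _ Ox0)) cT ewc uc.
pose M := e * w x - u y - H * dot (x - y) (x - y) ^+ k.
have pen0 (X Y : 'rV[R]_n) : 0 <= H * dot (X - Y) (X - Y) ^+ k.
  by rewrite mulr_ge0 ?(ltW H0)// exprn_ge0// dotxx_ge0.
have ewS X : e * w X <= e * S by rewrite ler_wpM2l ?(ltW e0).
have Msigma : sigma <= M.
  have := Hmax x0 x0 (OT _ Ox0) (OT _ Ox0); rewrite subrr.
  rewrite -[in X in X -> _](scale0r (0 : 'rV[R]_n)) dotZl mul0r expr0n gtn_eqF ?(ltnW k2)//.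
  by rewrite mulr0 subr0.
have wx0 : 0 < e * w x by have := pen0 x y; have := u0 y; rewrite /M in Msigma; lra.
have Ox : Omega x by apply: contrapT => /w0 h; rewrite h mulr0 ltxx in wx0.
have xy : enorm (x - y) < rho.
  rewrite ltNge; apply/negP => /far h; have := ewS x; have := u0 y.
  by rewrite /M in Msigma; lra.
(* If [y] were outside Omega, w y = 0 and uniform continuity would give e w x < sigma, below the
   maximum M. *)
have Oy : Omega y.
  apply: contrapT => /w0 h; have := small x y (clT _ Tx) xy.
  rewrite h mulr0 subr0 ltr_norml => /andP[_].
  by have := pen0 x y; have := u0 y; rewrite /M in Msigma; lra.
(* The maximum must dominate all pairs, since increments are compared for every displacement. If Y
   leaves the closure, either X is close and e w X < sigma <= M, or the penalty outweighs e w X. *)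
have {}Hmax X Y : e * w X - u Y - H * dot (X - Y) (X - Y) ^+ k <= M.
  have hp := pen0 X Y; have hu := u0 Y.
  have [OX|/w0 ->] := pselect (Omega X); last by rewrite mulr0; lra.
  have [TY|TY] := pselect (closure Omega Y); first exact: Hmax (OT _ OX) TY.
  have [XY|/far h] := ltP (enorm (X - Y)) rho; last by have := ewS X; lra.
  have := small X Y (clT _ (OT _ OX)) XY.
  rewrite (w0 Y) => [|/OT//]; rewrite mulr0 subr0 ltr_norml => /andP[_]; lra.
have uy : u y < c / 4.
  by have := ewS x; have := pen0 x y; rewrite /M in Msigma; lra.
have gy : `|g (u y)| < kap / 4.
  by apply: gtau => //; have := ewS x; have := pen0 x y; rewrite /M in Msigma; lra.
have k8 : 0 < kap / 8 by rewrite divr_gt0.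
have [r1 r10 Hr1] := doubling_inequality p s n_gt0 p_gt1 s_gt0 s_lt1 Omega
  (fun x => g (u x)) (cst 1) u w e H k x y oO us ws Ox Oy e0 H0 k2 kv kps Hmax _ k8.
(* As u y < c and [u] exceeds c on [K], a small ball about [y] misses [K]: the whole gain then comes
   from outside the excised ball. *)
have [r2 r20 Hr2] : exists2 r : R, 0 < r & forall z, enorm (z - y) <= r -> u z < c.
  apply: (nbhs_eball y [set z | u z < c]).
  have uyc : continuous_at y u.
    move/subspace_continuousP : uc => /(_ _ Ty) h.
    apply: cvg_trans h => A uA.
    have uA' : nbhs y (fun z : 'rV[R]_n => closure Omega z -> A (u z)) := uA.
    change (nbhs y (u @^-1` A)).
    by apply: filterS2 uA' (open_nbhs_nbhs (conj oO Oy)) => z h' Oz; apply: h'; exact: OT.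
  have uyc' : u y < c by lra.
  exact: (uyc [set t | t < c] (open_nbhs_nbhs (conj (@open_lt _ c) uyc'))).
pose r := Num.min r1 r2.
have r0 : 0 < r by rewrite lt_min r10.
have rr1 : 0 < r <= r1 by rewrite r0 ge_min lexx.
have inc (z : 'rV[R]_n) : u y - u (y + z) <= e * w x - e * w (x + z).
  by have := Hmax (x + z) (y + z); rewrite opprD addrACA subrr addr0 /M; lra.
have Kd (z : 'rV[R]_n) : K (y + z) -> r <= enorm z <= d.
  have zE : y + z - y = z by rewrite addrC addKr.
  move=> [cz yzr]; apply/andP; split.
    rewrite leNgt; apply/negP; rewrite lt_min => /andP[_ /ltW zr].
    by have := Hr2 (y + z); rewrite zE ltNge (ltW cz) => /(_ zr).
  have := enormD (y + z) (- y); rewrite zE enormN => /le_trans; apply.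
  by rewrite /d lerD ?(ltW yzr)//; exact: clT.
have Kab (z : 'rV[R]_n) : K (y + z) ->
    u y - u (y + z) <= - (3 * c / 4) /\ - (c / 4) <= e * w x - e * w (x + z).
  by move=> [cz _]; have hx := ewS (x + z); split; clear -uy cz wx0 eS hx; lra.
have ab : - (3 * c / 4) <= - (c / 4) by lra.
have [[mw _] _ _ _] := ws.
have mew : measurable_fun [set: LT] ((fun x => e * w x) : LT -> R).
  exact: (measurable_funM (measurable_cst _) mw).
have := incremental_gain u (fun x => e * w x) x y K _ _ d r mu_ mew mK r0 ab inc Kd Kab.
rewrite -/eta => /le_trans /(_ (Hr1 r rr1)).
rewrite -[mu K]fineK ?ge0_fin_numE// -EFinM lee_fin -/kap /cst mulr1.
move: gy ek; rewrite ltr_norml => /andP[gy1 gy2] ek; lra.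
Qed.

End comparison.

Theorem corollary1p2 (R : realType) (n : nat) (p s delta : R)
    (Omega : set 'rV[R]_n) (g : R -> R) (u u_tor : 'rV[R]_n -> R)
    (n_gt0 : (0 < n)%N) (p_gt1 : 1 < p) (s_gt0 : 0 < s) (s_lt1 : s < 1)
    (Omega_bounded : bounded_set Omega) (Omega_open : open Omega)
    (Omega_regular : Wiener_regular p s Omega)
    (delta_gt0 : 0 < delta)
    (g_cont : {within [set t : R | 0 <= t], continuous g}) (g0 : g 0 = 0)
    (u_tail : tail_space p s u)
    (u_cont : {within closure (thickening Omega delta), continuous u})
    (u_ge0 : forall x, 0 <= u x)
    (u_super : viscosity_supersolution p s Omega (fun x => g (u x)) u)
    (u_torP : torsion_function p s Omega u_tor) :
  {ae lebesgue_rV n, forall x, u x = 0} \/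
  ((forall x, Omega x -> 0 < u x) /\
   exists C : R, 0 < C /\ forall x, Omega x -> C * u_tor x <= u x).
Proof.
have [ae0|nae] := pselect {ae lebesgue_rV n, forall x, u x = 0}; first by left.
right; split.
  move=> x Ox; rewrite lt0r u_ge0 andbT; apply/eqP => ux; apply: nae.
  apply: (strong_maximum p s p_gt1 s_gt0 Omega _ u x Omega_open u_ge0 u_super Ox ux).
  by rewrite ux g0.
have [_ tor_cont tor0 [tor_sub _] _] := u_torP.
apply: (subsolution_comparison p s n_gt0 p_gt1 s_gt0 s_lt1 Omega g u u_tor) => //.
apply: continuous_subspaceW u_cont; apply: closureS => x Ox.
rewrite /thickening /=; apply: (@le_lt_trans _ _ 0%E); last by rewrite lte_fin.
apply: ereal_inf_lbound; exists x; first exact: subset_closure.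
by rewrite subrr enorm0.
Qed.
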